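(* Let $\theta,\Theta_1,\Theta_2:[0,+\infty)\to[0,+\infty)$ be functions with $\Theta_1,\Theta_2$ convex and lower semicontinuous, $$\lim_{x\to+\infty}\theta(x)=\lim_{x\to+\infty}\frac{\Theta_1(x)}{x}=\lim_{x\to+\infty}\frac{\Theta_2(x)}{x}=\infty,$$ and, for some constant $C\ge0$, $\Theta_2(2x)\le C\,\Theta_2(x)$ for every $x\ge0$. Then there exists a coercive function $\Psi:C([0,1];\mathbb R)\to[0,+\infty]$ such that the following holds: for every filtered probability space $(\Omega,(\mathcal F_t)_{t\in[0,1]},\mathbb P)$ and progressively measurable real-valued processes $\varphi=(\varphi_t)_t$, $\beta=(\beta_t)_t$, $\alpha=(\alpha_t)_t$ on $[0,1]$, with $\alpha\ge0$ $\mathbb P$-a.s., such that $$[0,1]\ni t\mapsto M_t:=\varphi_t-\int_0^t\beta_s\,ds\qquad\text{and}\qquad[0,1]\ni t\mapsto M_t^2-\int_0^t\alpha_s\,ds$$ are $\mathbb P$-a.s. continuous local martingales, one has $$\mathbb E[\Psi(\varphi)]\le\mathbb E\Big[\theta(|\varphi_0|)+\int_0^1\big[\Theta_1(|\beta_t|)+\Theta_2(\alpha_t)\big]dt\Big].$$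
   Context: $C([0,1];\mathbb R)$ is endowed with the sup norm. A function $\Psi:C([0,1];\mathbb R)\to[0,+\infty]$ is coercive if its sublevel sets $\{\Psi\le c\}$, $c\in[0,\infty)$, are relatively compact. *)

(* Defs.v *)
From HB Require Import structures.
From mathcomp Require Import all_boot all_order all_algebra.
From mathcomp Require Import all_classical all_reals all_analysis.
From mathcomp Require Import measurable_realfun.

Set Implicit Arguments.
Unset Strict Implicit.
Unset Printing Implicit Defensive.

Import Order.TTheory GRing.Theory Num.Theory.
Import numFieldNormedType.Exports.

Local Open Scope classical_set_scope.
Local Open Scope ring_scope.

Section C01.
Variable R : realType.

Local Notation unitI := (set_type `[0 : R, 1]%classic).

Definition continuous_pred : {pred unitI -> R^o} :=
  fun f => `[< continuous f >].

Record C01 := mkC01 { C01_val :> unitI -> R^o; _ : C01_val \in continuous_pred }.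

HB.instance Definition _ := [isSub for C01_val].
HB.instance Definition _ := [Choice of C01 by <:].

Lemma continuous_predP (f : unitI -> R^o) :
  reflect (continuous f) (f \in continuous_pred).
Proof. exact: asboolP. Qed.

Lemma continuous_submod_closed : submod_closed continuous_pred.
Proof.
split; first by apply/continuous_predP => x; exact: (@cst_continuous _ R^o).
move=> a f g /continuous_predP cf /continuous_predP cg.
apply/continuous_predP => x.
have h : (a *: f y + g y) @[y --> x] --> a *: f x + g x.
  have FF : Filter (nbhs x) := nbhs_filter x.
  apply: cvgD; last exact: cg.
  apply: cvgZl_tmp; exact: cf.
exact: h.
Qed.

HB.instance Definition _ :=
  GRing.isSubmodClosed.Build R (unitI -> R^o) continuous_pred
    continuous_submod_closed.
HB.instance Definition _ := [SubChoice_isSubLmodule of C01 by <:].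

Definition supnorm (f : C01) : R := sup (range (fun t : unitI => `|f t|)).

Lemma C01_continuous (f : C01) : continuous (f : unitI -> R^o).
Proof. by case: f => f /= /continuous_predP. Qed.

Lemma C01_has_ubound (f : C01) : has_ubound (range (fun t : unitI => `|f t|)).
Proof.
have /continuous_compact : {within `[0 : R, 1], continuous (valL_ 0 f)}.
  exact/subspace_valL_continuousP'/C01_continuous.
move=> /(_ (@segment_compact _ _ _)) /compact_bounded [M [_ /(_ (M + 1))]].
rewrite ltrDl ltr01 => /(_ isT) bM.
exists (M + 1) => _ [t _ <-]; apply: bM.
exists (set_val t); first exact: set_valP.
by have /(congr1 (@^~ t)) := @valLK _ _ 0 _ (C01_val f).
Qed.

Lemma ler_supnorm (f : C01) t : `|f t| <= supnorm f.
Proof. by apply: ub_le_sup; [exact: C01_has_ubound | exists t]. Qed.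

Lemma zero_in_unitI : 0 \in `[0 : R, 1]%classic.
Proof. by rewrite inE /= in_itv /= lexx ler01. Qed.

Let unitI0 : unitI := SigSub zero_in_unitI.

Lemma supnorm_le (f : C01) M : (forall t, `|f t| <= M) -> supnorm f <= M.
Proof.
by move=> fM; apply: ge_sup; [exists `|f unitI0|, unitI0 | move=> _ [t _ <-]].
Qed.

Lemma ler_supnormD (f g : C01) : supnorm (f + g) <= supnorm f + supnorm g.
Proof.
apply: supnorm_le => t; apply: le_trans (ler_normD _ _) _.
by apply: lerD; exact: ler_supnorm.
Qed.

Lemma supnormZ_le a (f : C01) : supnorm (a *: f) <= `|a| * supnorm f.
Proof.
apply: supnorm_le => t.
by rewrite [_ t]/(a * f t) normrM ler_wpM2l// ler_supnorm.
Qed.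

Lemma supnormZ a (f : C01) : supnorm (a *: f) = `|a| * supnorm f.
Proof.
apply/eqP; rewrite eq_le supnormZ_le /=.
have [->|a0] := eqVneq a 0.
  by rewrite normr0 mul0r (le_trans (normr_ge0 _) (ler_supnorm _ unitI0)).
rewrite -{1}[f](scalerK a0) (le_trans (ler_wpM2l _ (supnormZ_le _ _)))//.
by rewrite mulrA normfV mulfV ?mul1r// normr_eq0.
Qed.

Lemma supnorm0_eq0 (f : C01) : supnorm f = 0 -> f = 0.
Proof.
move=> f0; apply/val_inj/funext => t; apply/eqP.
by have := ler_supnorm f t; rewrite f0 normr_le0.
Qed.

HB.instance Definition _ :=
  Lmodule_isNormed.Build R C01 ler_supnormD supnormZ supnorm0_eq0.

Lemma C01_normE (f : C01) : `|f| = supnorm f.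
Proof. by []. Qed.

Lemma C01_ballE (f g : C01) e : ball f e g <-> supnorm (f - g) < e.
Proof. by rewrite -ball_normE. Qed.

End C01.

(* The time index of processes and filtrations is [0, 1]; their values at times
   outside [0, 1] are irrelevant. *)
Section processes.
Context {d : measure_display} {T : measurableType d} {R : realType}.
Implicit Types (P : probability T R) (F : R -> set_system T) (X Y : T -> R)
  (Z M : R -> T -> R) (tau : T -> R).

Definition filtration F : Prop :=
  [/\ forall t, t \in `[0, 1] -> sigma_algebra [set: T] (F t),
      forall t, t \in `[0, 1] -> F t `<=` measurable &
      forall s t, 0 <= s -> s <= t -> t <= 1 -> F s `<=` F t].

Definition sub_measurable (G : set_system T) X : Prop :=
  measurable_fun [set: T] (X : g_sigma_algebraType G -> R).

Definition adapted F Z : Prop :=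
  forall t, t \in `[0, 1] -> sub_measurable (F t) (Z t).

Definition progressively_measurable F Z : Prop :=
  forall t, t \in `[0, 1] ->
    measurable_fun
      (`[0, t] `*` [set: T] : set (R * g_sigma_algebraType (F t)))
      (fun z : R * g_sigma_algebraType (F t) => Z z.1 z.2).

(* Y is a version of the conditional expectation of X given G. *)
Definition is_cond_exp P (G : set_system T) X Y : Prop :=
  [/\ sub_measurable G Y, P.-integrable [set: T] (EFin \o Y) &
      forall A, G A ->
        (\int[P]_(w in A) (Y w)%:E = \int[P]_(w in A) (X w)%:E)%E].

Definition martingale P F Z : Prop :=
  [/\ adapted F Z,
      forall t, t \in `[0, 1] -> P.-integrable [set: T] (EFin \o Z t) &
      forall s t, 0 <= s -> s <= t -> t <= 1 ->
        is_cond_exp P (F s) (Z t) (Z s)].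

Definition stopping_time F tau : Prop :=
  [/\ forall w, tau w \in `[0, 1] &
      forall t, t \in `[0, 1] -> F t [set w | tau w <= t]].

Definition stopped Z tau : R -> T -> R :=
  fun t w => Z (Num.min t (tau w)) w.

(* M 0 is subtracted so that it need not be integrable. On the compact time
   interval [0, 1], a localizing sequence increases to 1 and is eventually
   equal to 1. *)
Definition local_martingale P F M : Prop :=
  adapted F M /\
  exists tau : nat -> T -> R,
    [/\ forall n, stopping_time F (tau n),
        {ae P, forall w, forall n, tau n w <= tau n.+1 w},
        {ae P, forall w, exists n, tau n w = 1} &
        forall n, martingale P F (fun t w => stopped M (tau n) t w - M 0 w)].

Definition continuous_local_martingale P F M : Prop :=
  {ae P, forall w, {within `[0, 1], continuous (M ^~ w)}} /\
  local_martingale P F M.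

Definition time_integral Z : R -> T -> R :=
  fun t w => \int[lebesgue_measure]_(s in `[0, t]) Z s w.

(* The trajectory of w as an element of C([0, 1]); the trajectories that are
   not continuous on [0, 1] are sent to the null function. *)
Definition trajectory Z (w : T) : C01 R :=
  insubd (0 : C01 R) (fun t : set_type `[0 : R, 1]%classic => Z (\val t) w).

End processes.

Definition coercive {R : realType} (Psi : C01 R -> \bar R) : Prop :=
  forall c : R, 0 <= c -> precompact [set f | (Psi f <= c%:E)%E].

Definition borel_measurable {R : realType} (Psi : C01 R -> \bar R) : Prop :=
  measurable_fun setT (Psi : g_sigma_algebraType (@open (C01 R)) -> \bar R).

(* Main.v *)
Require Import Defs.
From mathcomp Require Import all_boot all_order all_algebra.
From mathcomp Require Import all_classical all_reals all_analysis.
From mathcomp Require Import measurable_realfun.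
From mathcomp Require Import lra ring.
Set Implicit Arguments.
Unset Strict Implicit.
Unset Printing Implicit Defensive.
Import Order.TTheory GRing.Theory Num.Theory.
Import numFieldNormedType.Exports.
Local Open Scope classical_set_scope.
Local Open Scope ring_scope.

(** Let W_k be the set of the paths that start outside [-X_k, X_k], or that
    move by more than e_k away from their value at the left end of some cell
    of the grid of mesh 1/N_k, where e_k tends to 0.  The penalty
    Psi = sum_k 2^k 1_{W_k} is the required function, for a suitable choice of
    X_k and N_k.

    Coercivity: a bound on Psi f keeps f out of W_k for all large k, and the
    paths with this property are uniformly bounded and equicontinuous
    ([tame_precompact]).  As W_k is open, Psi is also Borel.

    Expectation: it is enough to find, for all e and Lam, X and N such that
    Lam P(phi in W) is at most the right-hand side of the theorem
    ([wildness_estimate]); with Lam_k = 2^k 2^(k+1) the terms of E[Psi(phi)]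
    are then bounded by a geometric series.  The initial value is controlled
    by theta.  If phi moves by more than e on a cell, then the drift or the
    martingale part M moves by more than e/2.
    - Drift: Theta1(x) >= L (x - K) with L as large as desired, and the term
      L K / N is negligible when N is large, so that the integral of
      Theta1(|beta|) over the cell is at least Lam.
    - Martingale part: with a the integral of alpha over the cell, M moves by
      more than e/2 with probability at most c E[min(a, 1)^(q+1)]
      ([oscillation_bound]), whereas Lam c min(a, 1)^(q+1) is at most the
      integral of Theta2(alpha) over the cell when N is large
      ([supporting_lines]).  The doubling condition gives a polynomial lower
      bound of Theta2 near 0; its degree q+1 is imposed by the doubling
      constant, which is why moments of M of arbitrarily high order are
      needed.
    Summing over the cells gives the estimate ([path_energy_bound],
    [key_estimate]).

    The moment bound is a Burkholder inequality, proved in discrete time.  If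
    Y is a martingale with bracket A and n = 2q+2, then, by Taylor's formula,
    Y^n - 'C(n, 2) Y^(n-2) A is a supermartingale up to an error that vanishes
    with the size of the steps ([discrete_burkholder]).  It is applied on a
    fine grid to M stopped at the first time rho at which it has moved by e,
    its bracket has grown by 1, or it has oscillated too fast: before rho
    everything is bounded, so that stopping preserves the martingale property
    ([bounded_optional_stopping]). *)

(** * Monotonicity of the integral of arbitrary functions *)

Section lower_integral.
Context d (T : measurableType d) (R : realType).
Variable mu : {measure set T -> \bar R}.
Import HBNNSimple.
Local Open Scope ereal_scope.

(** The integral of a nonnegative function is a supremum over the simple
    functions below it, and cutting a simple function off on a null set does
    not change its integral; so the comparison holds for arbitrary f and g.
    It is applied to integrands built from theta, Theta1 and Theta2, whose
    measurability is unknown. *)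
Lemma le_integral_ae (D : set T) (f g : T -> \bar R) :
  (forall x, D x -> 0 <= f x) ->
  {ae mu, forall x, D x -> f x <= g x} ->
  \int[mu]_(x in D) f x <= \int[mu]_(x in D) g x.
Proof.
move=> f0 [N [mN N0 fgN]].
have fgN' x : D x -> ~ N x -> f x <= g x.
  by move=> Dx Nx; apply: contrapT => fg; apply: Nx; apply: fgN => /(_ Dx).
have simpleN (h : {nnsfun T >-> R}) : sintegral mu h = sintegral mu (h \_ (~` N)).
  rewrite -integral_nnsfun; last exact: measurableC.
  have -> : sintegral mu h = \int[mu]_(x in setT) (h x)%:E by rewrite integral_nnsfun// patch_setT.
  rewrite [LHS]integral_mkcond [RHS]integral_mkcond.
  apply: ge0_ae_eq_integral => //.
  - by apply/(measurable_restrictT _ _).1 => //; exact/measurable_EFinP.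
  - apply/(measurable_restrictT _ _).1 => //; first exact: measurableC.
    by apply: measurable_funTS; exact/measurable_EFinP.
  - by move=> x _; rewrite patch_setT lee_fin.
  - by move=> x _; rewrite /patch; case: ifPn => // _; rewrite lee_fin.
  - exists N; split=> // x /= xN; apply: contrapT => Nx; apply: xN => _.
    by rewrite !patchE in_setT ifT// inE.
rewrite integral_mkcond [leRHS]integral_mkcond.
set f' := f \_ D; set g' := g \_ D.
have f'0 x : 0 <= f' x by rewrite /f' patchE; case: ifPn => //; rewrite inE; exact: f0.
have f'g' x : ~ N x -> f' x <= g' x.
  by move=> Nx; rewrite /f' /g' !patchE; case: ifPn => //; rewrite inE => /fgN'; exact.
rewrite [leRHS]integralE.
have -> : \int[mu]_x g'^\- x = 0.
  rewrite ge0_integralTE; last by move=> x; exact: funeneg_ge0.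
  apply/eqP; rewrite eq_le; apply/andP; split; last first.
    by apply: ereal_sup_ubound; exists nnsfun0; [move=> x /=; exact: funeneg_ge0|exact: sintegral0].
  apply: ge_ereal_sup => _ [h /= hg <-].
  rewrite simpleN (_ : _ \_ _ = cst 0%R) ?sintegral0//.
  apply/funext => x; rewrite patchE /=; case: ifPn => //; rewrite inE /= => Nx.
  apply/eqP; rewrite eq_le fun_ge0 andbT -lee_fin (le_trans (hg x))//.
  by rewrite funenegE ge_max lexx andbT leeNl oppe0 (le_trans (f'0 x))// f'g'.
rewrite sube0 !ge0_integralTE//.
apply: ge_ereal_sup => _ [h /= hf <-].
rewrite simpleN; apply: ereal_sup_ubound => /=.
exists (proj_nnsfun h (measurableC mN)); last by rewrite -mrestrict.
move=> x; rewrite -mrestrict patchE funeposE le_max.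
case: ifPn => [|_]; last by rewrite lexx orbT.
by rewrite inE /= => Nx; rewrite (le_trans (hf x))// f'g'.
Qed.

End lower_integral.

(** * Wild paths and compactness *)

Lemma fmap_ultra (T U : Type) (f : T -> U) (F : set_system T) :
  UltraFilter F -> UltraFilter (f @ F).
Proof.
move=> UF; split=> [|G PG sFG]; first exact: fmap_proper_filter.
apply/seteqP; split=> // A GA.
have [//|FnA] := in_ultra_setVsetC (f @^-1` A) UF.
have /(filterI GA) : G (~` A) by exact: sFG.
by rewrite setICr => /filter_not_empty.
Qed.

Section coercivity.
Variable R : realType.
Local Notation unitI := (set_type `[0 : R, 1]%classic).

(** The oscillation is measured from the left end of a cell, a deterministic
    time, because this is what the maximal inequality controls. *)
Definition wild (X e : R) (N : nat) : set (C01 R) :=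
  [set f | (exists t : unitI, \val t = 0 /\ X < `|f t|) \/
    exists i : nat, exists s t : unitI,
      [/\ (i < N)%N, \val s = i%:R / N%:R, \val s <= \val t,
          \val t <= i.+1%:R / N%:R & e < `|f t - f s|] ].

Lemma unitIP (t : unitI) : 0 <= \val t <= 1.
Proof. by have := set_valP t; rewrite /= in_itv. Qed.

Lemma unitI_mk (x : R) : 0 <= x <= 1 -> {t : unitI | \val t = x}.
Proof.
move=> x01; have xI : x \in `[0 : R, 1]%classic by rewrite inE /= in_itv.
by exists (SigSub xI).
Qed.

Lemma grid_cell (N : nat) (t : R) : (0 < N)%N -> 0 <= t <= 1 ->
  exists i, [/\ (i < N)%N, i%:R / N%:R <= t & t <= i.+1%:R / N%:R].
Proof.
move=> N0 /andP[t0 t1]; have N0' : (0 : R) < N%:R by rewrite ltr0n.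
have : exists i, t <= i.+1%:R / N%:R.
  by exists N.-1; rewrite prednK// divff ?gt_eqF.
move=> ex; have [i hi imin] := ex_minnP (ex : exists i, (fun i => t <= i.+1%:R / N%:R) i).
exists i; split => //.
- rewrite -(prednK N0) ltnS; apply: imin.
  by rewrite prednK// divff ?gt_eqF.
- case: i hi imin => [|i] hi imin; first by rewrite mul0r.
  by rewrite leNgt; apply/negP => /ltW /imin; rewrite ltnn.
Qed.

Lemma evalC01_continuous (t : unitI) : continuous (fun f : C01 R => f t : R^o).
Proof.
move=> f; have FF : ProperFilter (nbhs f) := nbhs_pfilter f.
apply/cvgrPdist_lt => e e0.
have h : nbhs f (ball f e) by exact: nbhsx_ballx.
apply: (filterS _ h) => g /C01_ballE; apply: le_lt_trans.
exact: (ler_supnorm (f - g) t).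
Qed.

Lemma open_wild X e N : open (wild X e N).
Proof.
rewrite openE => f; have FF : ProperFilter (nbhs f) := nbhs_pfilter f.
move=> -[[t [t0 Xt]]|[i [s [t [iN si st ti est]]]]].
  have h : (fun g : C01 R => `|g t|) @ f --> `|f t|.
    exact: (cvg_norm (@evalC01_continuous t f)).
  have : nbhs f (fun g : C01 R => X < `|g t|) by exact: (cvgr_gt _ h).
  by apply: filterS => g Xg; left; exists t.
have h : (fun g : C01 R => `|g t - g s|) @ f --> `|f t - f s|.
  apply: cvg_norm; apply: cvgB.
    exact: (@evalC01_continuous t f).
  exact: (@evalC01_continuous s f).
have : nbhs f (fun g : C01 R => e < `|g t - g s|) by exact: (cvgr_gt _ h).
by apply: filterS => g Xg; right; exists i, s, t.
Qed.

(** Stated for arbitrary functions, so that it also applies to a pointwise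
    limit of paths before this limit is known to be continuous. *)
Definition tame (e : R) (N : nat) (h : unitI -> R) :=
  forall i (s t : unitI), (i < N)%N -> \val s = i%:R / N%:R -> \val s <= \val t ->
     \val t <= i.+1%:R / N%:R -> `|h t - h s| <= e.

(** Two times at distance at most 1/N lie in the same cell or in adjacent
    ones. *)
Lemma tame_modulus e N h (t t' : unitI) : (0 < N)%N -> tame e N h ->
  \val t <= \val t' -> \val t' <= \val t + N%:R^-1 -> `|h t - h t'| <= 3 * e.
Proof.
move=> N0 he tt' t't; have N0' : (0 : R) < N%:R by rewrite ltr0n.
have [i [iN it ti]] := grid_cell N0 (unitIP t).
have grid j : (j <= N)%N -> {s : unitI | \val s = j%:R / N%:R}.
  move=> jN; apply: unitI_mk; rewrite divr_ge0//= ler_pdivrMr// mul1r.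
  by rewrite ler_nat.
have [s se] := grid i (ltnW iN).
have e0 : 0 <= e.
  by apply: le_trans (he i s t iN se _ ti) => //; rewrite se.
have h1 : `|h t - h s| <= e by apply: (he i); rewrite ?se//.
have [t'i|it'] := leP (\val t') (i.+1%:R / N%:R).
  have h2 : `|h t' - h s| <= e by apply: (he i); rewrite ?se// (le_trans it).
  have -> : h t - h t' = (h t - h s) - (h t' - h s) by ring.
  apply: le_trans (ler_normB _ _) _; apply: le_trans (lerD h1 h2) _; lra.
have iN1 : (i.+1 < N)%N.
  rewrite -(ltr_nat R) -(mul1r N%:R) -ltr_pdivrMr//.
  by rewrite (lt_le_trans it')//; case/andP: (unitIP t').
have [s' s'e] := grid i.+1 iN.
have h2 : `|h s' - h s| <= e.
  apply: (he i); rewrite ?se// s'e// ler_pM2r ?invr_gt0// ler_nat//.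
have h3 : `|h t' - h s'| <= e.
  apply: (he i.+1) => //; first by rewrite s'e ltW.
  rewrite (le_trans t't)//.
  rewrite (_ : i.+2%:R / N%:R = i.+1%:R / N%:R + N%:R^-1); last first.
    by rewrite -[i.+2]addn1 natrD mulrDl mul1r.
  by rewrite lerD2r.
have -> : h t - h t' = (h t - h s) - (h s' - h s) - (h t' - h s') by ring.
apply: le_trans (ler_normB _ _) _.
have h4 := le_trans (ler_normB (h t - h s) (h s' - h s)) (lerD h1 h2).
apply: le_trans (lerD h4 h3) _; lra.
Qed.

Lemma not_wild_tame X e N f : ~ wild X e N f -> tame e N f.
Proof.
move=> nw i s t iN si st ti; rewrite leNgt; apply/negP => est.
by apply: nw; right; exists i, s, t.
Qed.

(** From the initial value, the path moves by at most e on each of the N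
    cells. *)
Lemma not_wild_bounded X e N f (t : unitI) : (0 < N)%N ->
  ~ wild X e N f -> `|f t| <= X + N%:R * e.
Proof.
move=> N0 nw; have N0' : (0 : R) < N%:R by rewrite ltr0n.
have he := not_wild_tame nw.
have grid j : (j <= N)%N -> {s : unitI | \val s = j%:R / N%:R}.
  move=> jN; apply: unitI_mk; rewrite divr_ge0//= ler_pdivrMr// mul1r.
  by rewrite ler_nat.
have e0 : 0 <= e.
  have [s se] := grid 0%N (ltnW N0).
  by apply: le_trans (he 0%N s s N0 se _ _) => //; rewrite se mul0r divr_ge0.
have step j (s : unitI) : (j <= N)%N -> \val s = j%:R / N%:R -> `|f s| <= X + j%:R * e.
  elim: j s => [|j IH] s jN se.
    rewrite mul0r addr0 leNgt; apply/negP => Xs; apply: nw; left; exists s.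
    by rewrite se mul0r.
  have [s' s'e] := grid j (ltnW jN).
  have := IH s' (ltnW jN) s'e.
  have : `|f s - f s'| <= e.
    apply: (he j) => //; rewrite se// s'e ler_pM2r ?invr_gt0// ler_nat//.
  have := ler_normD (f s - f s') (f s'); rewrite subrK -natr1 mulrDl mul1r; lra.
have [i [iN it ti]] := grid_cell N0 (unitIP t).
have [s se] := grid i (ltnW iN).
have h1 : `|f t - f s| <= e by apply: (he i); rewrite ?se//.
have h2 := step i s (ltnW iN) se.
have h3 : i.+1%:R * e <= N%:R * e by rewrite ler_wpM2r// ler_nat.
have := ler_normD (f t - f s) (f s); rewrite subrK.
move: h3; rewrite -natr1 mulrDl mul1r; lra.
Qed.

(** The Arzela-Ascoli theorem, by ultrafilters: an ultrafilter on the closed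
    set K of the non-wild paths converges pointwise; the limit inherits the
    control of the oscillations, hence is continuous, and this control turns
    convergence at the finitely many grid points into uniform convergence. *)
Lemma tame_precompact (X e : nat -> R) (N : nat -> nat) (k0 : nat) (S : set (C01 R)) :
  e @ \oo --> 0 -> (forall k, (0 < N k)%N) ->
  (forall f, S f -> forall k, (k0 <= k)%N -> ~ wild (X k) (e k) (N k) f) ->
  precompact S.
Proof.
move=> e0 N0 SK.
pose K := [set f : C01 R | forall k, (k0 <= k)%N -> ~ wild (X k) (e k) (N k) f].
exists K; first by move=> f Sf; exact: SK.
have clK : closed K.
  have -> : K = \bigcap_(k in [set k | (k0 <= k)%N]) ~` wild (X k) (e k) (N k).
    by apply/seteqP; split => f /= h k /= kk; exact: h.
  by apply: closed_bigI => k _; exact/open_closedC/open_wild.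
split=> //.
rewrite compact_ultra => F UF FK.
have FF : ProperFilter F by exact: ultra_proper.
have ecv (t : unitI) : exists l : R, (fun f : C01 R => f t) @ F --> (l : R^o).
  pose B := X k0 + (N k0)%:R * e k0.
  have UG : UltraFilter ((fun f : C01 R => f t : R) @ F) by exact: fmap_ultra.
  have := @segment_compact R (- B) B; rewrite compact_ultra.
  move=> /(_ _ UG) [|l [_ ?]]; last by exists l.
  rewrite /fmap/=; apply: filterS FK => f Kf /=.
  by rewrite in_itv/= -ler_norml; apply: not_wild_bounded => //; exact: Kf.
pose g (t : unitI) : R^o := sval (cid (ecv t)).
have gcv t : (fun f : C01 R => f t) @ F --> (g t : R^o) := svalP (cid (ecv t)).
have gtame k : (k0 <= k)%N -> tame (e k) (N k) g.
  move=> kk i s t iN si st ti.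
  have h : (fun f : C01 R => `|f t - f s|) @ F --> `|g t - g s|.
    by apply: cvg_norm; apply: cvgB; exact: gcv.
  apply: (cvgr_to_le h); apply: filterS FK => f Kf.
  by apply: (not_wild_tame (Kf k kk)) ti.
have smalle (eps : R) : 0 < eps -> exists2 k, (k0 <= k)%N & e k < eps / 4.
  move=> eps0; have [k _ hk] : \forall k \near \oo, e k < eps / 4.
    by apply: (cvgr_lt _ e0); rewrite divr_gt0.
  by exists (maxn k0 k); [exact: leq_maxl|apply: hk; exact: leq_maxr].
have gcont : continuous g.
  move=> t; have Ft : ProperFilter (nbhs t) := nbhs_pfilter t.
  apply/cvgrPdist_lt => eps eps0.
  have [k kk ek] := smalle _ eps0.
  have Nk0 : (0 : R) < (N k)%:R^-1 by rewrite invr_gt0 ltr0n.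
  have : \forall s \near t, `|\val t - \val s| < (N k)%:R^-1.
    have vc : \val @ t --> (\val t : R).
      exact: (@initial_continuous _ _ (@set_val R _) t).
    by move/cvgrPdist_lt : vc => /(_ _ Nk0).
  apply: filterS => s ts.
  suff : `|g t - g s| <= 3 * e k by move=> h; lra.
  have := ltW ts; rewrite ler_distl => /andP[h1 h2].
  have [tles|slet] := leP (\val t) (\val s).
    by apply: tame_modulus (gtame k kk) _ _ => //; lra.
  rewrite distrC.
  by apply: tame_modulus (gtame k kk) _ _ => //; exact: ltW.
have gin : g \in @continuous_pred R by exact/continuous_predP.
exists (mkC01 gin).
set G := mkC01 gin.
have FG : F --> G.
  apply/cvgrPdist_lt => eps eps0.
  have [k kk ek] := smalle _ eps0.
  have grid j : (j <= N k)%N -> {s : unitI | \val s = j%:R / (N k)%:R}.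
    move=> jN; apply: unitI_mk; rewrite divr_ge0//= ler_pdivrMr ?ltr0n// mul1r.
    by rewrite ler_nat.
  pose p (i : 'I_(N k)) : unitI := sval (grid i (ltnW (ltn_ord i))).
  have pE i : \val (p i) = i%:R / (N k)%:R := svalP (grid i (ltnW (ltn_ord i))).
  have : F (fun f : C01 R => forall i, `|g (p i) - f (p i)| < eps / 4).
    apply: filter_forall => i.
    by have /cvgrPdist_lt/(_ (eps / 4)) := gcv (p i); apply; rewrite divr_gt0.
  move=> /(filterI FK); apply: filterS => f [Kf hf].
  rewrite C01_normE; apply: (@le_lt_trans _ _ (eps / 4 * 3)); last by lra.
  apply: supnorm_le => t.
  have [i [iN it ti]] := grid_cell (N0 k) (unitIP t).
  have := hf (Ordinal iN); set s := p _ => hs.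
  have se : \val s = i%:R / (N k)%:R by rewrite pE.
  have h1 : `|f t - f s| <= e k.
    by apply: (not_wild_tame (Kf k kk) iN se _ ti); rewrite se.
  have h2 : `|g t - g s| <= e k by apply: (gtame k kk i s t) => //; rewrite se.
  have -> : (G - f) t = (g t - g s) - (f t - f s) + (g s - f s).
    have aux (a b c r : R) : a - c = (a - b) - (c - r) + (b - r) by ring.
    exact: aux.
  apply: le_trans (ler_normD _ _) _.
  have h3 := le_trans (ler_normB (g t - g s) (f t - f s)) (lerD h2 h1).
  apply: le_trans (lerD h3 (ltW hs)) _; lra.
split=> //.
have : closure K G; last by rewrite -(closure_id _).1.
move=> B BG; have := FG _ BG => /(filterI FK) /filter_ex[f [? ?]]; by exists f.
Qed.

End coercivity.

(** * Sigma-algebras, continuity and expectations *)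

Section sigma_algebra_closure.
Variables (T : pointedType) (G : set_system T).
Hypothesis sG : sigma_algebra setT G.

Lemma sigma_algebraE (A : set T) : G A = measurable (A : set (g_sigma_algebraType G)).
Proof. by rewrite (measurable_g_measurableTypeE sG). Qed.

Lemma sigmaT : G setT.
Proof. by rewrite sigma_algebraE; exact: measurableT. Qed.

Lemma sigmaC (A : set T) : G A -> G (~` A).
Proof. by rewrite !sigma_algebraE; exact: measurableC. Qed.

Lemma sigmaI (A B : set T) : G A -> G B -> G (A `&` B).
Proof. by rewrite !sigma_algebraE; exact: measurableI. Qed.

Lemma sigmaU (A B : set T) : G A -> G B -> G (A `|` B).
Proof. by rewrite !sigma_algebraE; exact: measurableU. Qed.

Lemma sigma_bigcup (D : set rat) (A : rat -> set T) :
  (forall q, D q -> G (A q)) -> G (\bigcup_(q in D) A q).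
Proof.
move=> GA; rewrite bigcup_mkcond sigma_algebraE; apply: bigcupT_measurable_rat => q.
rewrite -sigma_algebraE; case: ifPn => [/set_mem/GA//|_].
by rewrite -setCT; exact/sigmaC/sigmaT.
Qed.

Lemma sigma_bigcap (D : set rat) (A : rat -> set T) :
  (forall q, D q -> G (A q)) -> G (\bigcap_(q in D) A q).
Proof.
move=> GA; rewrite -(setCK (\bigcap_(q in D) A q)) setC_bigcap.
by apply/sigmaC/sigma_bigcup => q Dq; exact/sigmaC/GA.
Qed.

End sigma_algebra_closure.

Section continuity.
Variable R : realType.

Lemma within_unif_continuous (f : R -> R) (a b : R) :
  {within `[a, b], continuous f} -> forall e : R, 0 < e ->
  exists2 d : R, 0 < d & forall x y, a <= x <= b -> a <= y <= b ->
    `|x - y| < d -> `|f x - f y| <= e.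
Proof.
move=> /subspace_continuousP cf e e0.
have /compact_near_coveringP/near_covering_withinP cpt := @segment_compact R a b.
have FF : Filter (0 : R)^'+ by exact: at_right_proper_filter.
have := cpt R (0 : R)^'+ (fun d x => forall y, a <= y <= b -> `|x - y| < d ->
  `|f x - f y| <= e) FF.
case => [x /= xab|d /= d0 hd].
  have /cvgrPdist_lt/(_ (e / 2)) := cf x xab; rewrite divr_gt0// => /(_ isT).
  rewrite near_withinE => -[d /= d0 hd].
  exists ([set z | `|x - z| < d / 2], [set r | r < d / 2]).
    split => /=; first by exists (d / 2) => //=; rewrite divr_gt0.
    exists (d / 2) => /=; first by rewrite divr_gt0.
    by move=> r /=; rewrite sub0r normrN => + r0; rewrite gtr0_norm.
  move=> [z r] /= [xz rd] zab y yab zy.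
  have h1 : `|f x - f z| < e / 2 by apply: hd => //=; lra.
  have h2 : `|f x - f y| < e / 2.
    apply: hd => //=; rewrite (_ : x - y = (x - z) + (z - y)); last by ring.
    by rewrite (le_lt_trans (ler_normD _ _))//; lra.
  rewrite (_ : f z - f y = (f x - f y) - (f x - f z)); last by ring.
  by rewrite (le_trans (ler_normB _ _))//; lra.
exists (d / 2); first by rewrite divr_gt0.
move=> x y xab yab xy; apply: (hd (d / 2)) => //.
- by rewrite /= sub0r normrN gtr0_norm ?divr_gt0// ltr_pdivrMr// ltr_pMr// ltr1n.
- by rewrite divr_gt0.
Qed.

End continuity.

Section expectation.
Context d (T : measurableType d) (R : realType) (P : probability T R).
Implicit Types X Y h : T -> R.
Local Notation L1 X := (P.-integrable [set: T] (EFin \o X)).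
Local Notation Ex X := (Rintegral P [set: T] X).

Lemma bounded_L1 X (c : R) : measurable_fun setT X -> (forall w, `|X w| <= c) -> L1 X.
Proof.
move=> mX Xc; apply: measurable_bounded_integrable => //.
  exact: fin_num_fun_lty.
exists c; split; first exact: num_real.
by move=> x cx w _ /=; rewrite (le_trans (Xc w))// ltW.
Qed.

Lemma L1_measurable X : L1 X -> measurable_fun setT X.
Proof. by move=> /measurable_int/measurable_EFinP. Qed.

Lemma L1D X Y : L1 X -> L1 Y -> L1 (fun w => X w + Y w).
Proof. by move=> iX iY; exact: (integrableD _ iX iY). Qed.

Lemma L1B X Y : L1 X -> L1 Y -> L1 (fun w => X w - Y w).
Proof. by move=> iX iY; exact: (integrableB _ iX iY). Qed.

Lemma L1Z (k : R) X : L1 X -> L1 (fun w => k * X w).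
Proof. by move=> iX; exact: (integrableZl _ k iX). Qed.

Lemma L1M h X (c : R) : measurable_fun setT h -> (forall w, `|h w| <= c) -> L1 X ->
  L1 (fun w => h w * X w).
Proof.
move=> mh hc iX.
apply: (@le_integrable _ _ _ P setT measurableT _ (EFin \o (fun w => c * X w))).
- apply/measurable_EFinP; apply: measurable_funM => //; exact: L1_measurable.
- move=> w _ /=; rewrite lee_fin !normrM ler_wpM2r//.
  by rewrite (le_trans (hc w))// ler_norm.
- exact: L1Z.
Qed.

Lemma L1_indicM (B : set T) X : measurable B -> L1 X -> L1 (fun w => \1_B w * X w).
Proof.
move=> mB iX; apply: (L1M (c := 1)) => //.
by move=> w; rewrite indicE; case: (_ \in _); rewrite /= ?normr1 ?normr0.
Qed.

Lemma L1_sum n (F : nat -> T -> R) : (forall i, (i < n)%N -> L1 (F i)) ->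
  L1 (fun w => \sum_(i < n) F i w).
Proof.
elim: n => [|n IH] h.
  by under eq_fun do rewrite big_ord0; apply: (bounded_L1 (c := 0)) => // w; rewrite normr0.
under eq_fun do rewrite big_ord_recr/=.
by apply: L1D; [apply: IH => i /ltnW; exact: h|exact: h].
Qed.

Lemma expD X Y : L1 X -> L1 Y -> Ex (fun w => X w + Y w) = Ex X + Ex Y.
Proof. by move=> iX iY; rewrite RintegralD. Qed.

Lemma expB X Y : L1 X -> L1 Y -> Ex (fun w => X w - Y w) = Ex X - Ex Y.
Proof. by move=> iX iY; rewrite RintegralB. Qed.

Lemma expZ (k : R) X : L1 X -> Ex (fun w => k * X w) = k * Ex X.
Proof. by move=> iX; rewrite RintegralZl. Qed.

Lemma exp_sum n (F : nat -> T -> R) : (forall i, (i < n)%N -> L1 (F i)) ->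
  Ex (fun w => \sum_(i < n) F i w) = \sum_(i < n) Ex (F i).
Proof.
elim: n => [|n IH] h.
  rewrite big_ord0; under eq_Rintegral do rewrite big_ord0.
  by rewrite Rintegral_cst// mul0r.
under eq_Rintegral do rewrite big_ord_recr/=.
rewrite expD; first by rewrite big_ord_recr/= IH// => i /ltnW; exact: h.
  by apply: L1_sum => i /ltnW; exact: h.
exact: h.
Qed.

Lemma exp_le X Y : L1 X -> L1 Y -> (forall w, X w <= Y w) -> Ex X <= Ex Y.
Proof. by move=> iX iY XY; apply: le_Rintegral. Qed.

Lemma exp_cst (c : R) : Ex (fun=> c) = c.
Proof. by rewrite Rintegral_cst// (congr1 fine (probability_setT P) : fine (P setT) = 1) mulr1. Qed.

Lemma exp_norm_le X : L1 X -> `|Ex X| <= Ex (fun w => `|X w|).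
Proof. by move=> iX; apply: le_normr_Rintegral. Qed.

Lemma L1_norm X : L1 X -> L1 (fun w => `|X w|).
Proof. by move=> iX; exact: integrable_norm. Qed.

Lemma exp_dominated (X_ : nat -> T -> R) X Y :
  (forall n, measurable_fun setT (X_ n)) -> measurable_fun setT X ->
  L1 Y -> (forall n w, `|X_ n w| <= Y w) ->
  (forall w, X_ ^~ w @ \oo --> X w) ->
  L1 X /\ (fun n => Ex (X_ n)) @ \oo --> Ex X.
Proof.
move=> mX_ mX iY XY XX.
have [] := @dominated_convergence _ _ _ P setT measurableT (fun n => EFin \o X_ n)
  (EFin \o X) (EFin \o Y).
- by move=> n; exact/measurable_EFinP.
- exact/measurable_EFinP.
- by apply: aeW => w _; apply: cvg_EFin; [exact: nearW|exact: XX].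
- exact: iY.
- by apply: aeW => w n _ /=; rewrite lee_fin.
move=> iX _ cX; split => //; apply: fine_cvg.
by rewrite fineK//; exact: (integrable_fin_num measurableT iX).
Qed.

Lemma L1_indic (E : set T) : measurable E -> L1 (\1_E : T -> R).
Proof.
move=> mE; apply: (@bounded_L1 _ 1) => //.
by move=> w; rewrite indicE; case: (_ \in _); rewrite /= ?normr1 ?normr0.
Qed.

Lemma mean_indicU (E E' : set T) : measurable E -> measurable E' ->
  Ex (\1_(E `|` E')) <= Ex (\1_E) + Ex (\1_E').
Proof.
move=> mE mE'; rewrite -expD; [|exact: L1_indic|exact: L1_indic].
apply: exp_le; first by apply: L1_indic; exact: measurableU.
  by apply: L1D; exact: L1_indic.
move=> w; rewrite !indicE in_setU.
by case: (w \in E); case: (w \in E') => /=; rewrite ?addr0 ?add0r// lerDl.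
Qed.

(** Dominated convergence, for events each point of which belongs to only
    finitely many of them. *)
Lemma mean_indic_vanish (E : nat -> set T) : (forall k, measurable (E k)) ->
  (forall w, exists k0, forall k, (k0 <= k)%N -> ~ E k w) ->
  forall e : R, 0 < e -> exists k0, forall k, (k0 <= k)%N -> Ex (\1_(E k)) <= e.
Proof.
move=> mE Ew e e0.
have [_ /cvgrPdist_le/(_ e e0)[k0 _ hk]] : L1 (cst 0) /\ (fun n => Ex (\1_(E n))) @ \oo --> Ex (cst 0).
  apply: (@exp_dominated _ _ (cst 1)) => //.
  - by apply: (@bounded_L1 _ 1) => // w; rewrite normr1.
  - by move=> k w; rewrite indicE; case: (_ \in _); rewrite /= ?normr1 ?normr0.
  - move=> w; have [k0 hk] := Ew w; apply: cvg_near_cst; exists k0 => // k /= kk.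
    by rewrite indicE memNset//; exact: hk.
exists k0 => k kk; have := hk k kk.
by rewrite exp_cst sub0r normrN => /(le_trans (ler_norm _)).
Qed.

(** The sum is the integer part of y: indicators of superlevel sets approximate
    a bounded function uniformly. *)
Lemma staircase (y : R) m : 0 <= y <= m%:R ->
  `|y - \sum_(j < m) (j.+1%:R <= y)%R%:R| <= 1.
Proof.
suff [h1 h2] : ((m%:R <= y) -> \sum_(j < m) (j.+1%:R <= y)%R%:R = m%:R :> R) /\
    (0 <= y <= m%:R -> `|y - \sum_(j < m) (j.+1%:R <= y)%R%:R| <= 1) by [].
elim: m => [|m [IH1 IH2]].
  rewrite big_ord0; split=> // /andP[y0 y1].
  by rewrite subr0 ger0_norm// (le_trans y1).
rewrite big_ord_recr/=; split.
  move=> ym; rewrite ym IH1 ?natr1//; apply: le_trans ym; rewrite ler_nat//.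
move=> /andP[y0 ym1].
have [ym|my] := leP y m%:R.
  case: (leP m.+1%:R y) => [/(le_trans)/(_ ym)|_].
    by rewrite ler_nat ltnn.
  by rewrite addr0 IH2// y0.
rewrite IH1; last exact: ltW.
move: ym1; rewrite -natr1 => ym1.
have [my1|] := boolP (m%:R + 1 <= y); last rewrite -ltNge => my1.
  by rewrite ler_norml; apply/andP; split => /=; lra.
by rewrite ler_norml; apply/andP; split => /=; lra.
Qed.

(** The domain is ascribed to [g_sigma_algebraType G], so that the
    sigma-algebra in force is G and not the ambient one. *)
Definition meas_wrt (G : set_system T) X : Prop :=
  measurable_fun [set: g_sigma_algebraType G] (X : g_sigma_algebraType G -> R).

Lemma meas_wrt_preimage (G : set_system T) X : sigma_algebra setT G ->
  meas_wrt G X -> forall S, measurable S -> G (X @^-1` S).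
Proof.
move=> sG mX S mS; have := mX measurableT S mS.
by rewrite setTI measurable_g_measurableTypeE.
Qed.

Lemma meas_wrt_measurable (G : set_system T) X : sigma_algebra setT G ->
  G `<=` measurable -> meas_wrt G X -> measurable_fun setT X.
Proof.
by move=> sG mG mX _ S mS; rewrite setTI; exact/mG/(meas_wrt_preimage sG mX).
Qed.

(** Shifted to be nonnegative and multiplied by k, h is within 1 of a finite sum
    of indicators of events of G ([staircase]), to each of which X is
    orthogonal; so |E[h X]| <= E|X| / k for every k. *)
Lemma orthogonal_bounded (G : set_system T) X h (c : R) :
  sigma_algebra setT G -> G `<=` measurable -> L1 X ->
  (forall B, G B -> Ex (fun w => \1_B w * X w) = 0) ->
  meas_wrt G h -> (forall w, `|h w| <= c) ->
  Ex (fun w => h w * X w) = 0.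
Proof.
move=> sG mG iX X0 mh hc.
have GE := meas_wrt_preimage sG mh.
have mhT := meas_wrt_measurable sG mG mh.
have EX0 : Ex X = 0.
  have GT : G setT by have := GE setT measurableT; rewrite preimage_setT.
  rewrite -[RHS](X0 _ GT); apply: eq_Rintegral => w _.
  by rewrite indicT/= mul1r.
have c0 : 0 <= c by have := hc point; apply: le_trans.
pose y w := h w + c.
have y0 w : 0 <= y w <= 2 * c.
  by have := hc w; rewrite ler_norml /y; lra.
have my : measurable_fun setT y by exact: measurable_funD.
have yb w : `|y w| <= 2 * c by rewrite ger0_norm; case/andP: (y0 w).
have Ey : Ex (fun w => h w * X w) = Ex (fun w => y w * X w).
  under [RHS]eq_Rintegral do rewrite mulrDl.
  by rewrite expD ?expZ ?EX0 ?mulr0 ?addr0//; [exact: L1M hc iX|exact: L1Z].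
rewrite Ey; apply/eqP; rewrite -normr_le0; apply/ler_addgt0Pr => e e0.
rewrite add0r.
have EX := L1_norm iX.
have EXge0 : 0 <= Ex (fun w => `|X w|) by apply: Rintegral_ge0.
pose k := (Num.truncn ((Ex (fun w => `|X w|)) / e)).+1.
have k0 : (0 : R) < k%:R by rewrite ltr0n.
have kE : Ex (fun w => `|X w|) <= e * k%:R.
  rewrite mulrC -ler_pdivrMr// ltW//.
  by rewrite truncnS_gt.
pose m := (Num.truncn (k%:R * (2 * c))).+1.
have hm : k%:R * (2 * c) <= m%:R by apply/ltW/truncnS_gt.
pose B (j : nat) := [set w | j.+1%:R <= k%:R * y w].
have GB j : G (B j).
  have -> : B j = h @^-1` [set x | j.+1%:R <= k%:R * (x + c)] by [].
  apply: GE; rewrite -[X in measurable X]setTI.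
  apply: (@measurable_fun_le _ _ _ setT (cst j.+1%:R) (fun x : R => k%:R * (x + c))) => //.
  by apply: measurable_funM => //; exact: measurable_funD.
have mB j : measurable (B j) by exact/mG.
pose s w := \sum_(j < m) \1_(B j) w : R.
have sX w : k%:R * y w * X w = (k%:R * y w - s w) * X w + \sum_(j < m) \1_(B j) w * X w.
  by rewrite -mulr_suml -mulrDl subrK.
have ms : measurable_fun setT s by apply: measurable_sum => j; exact: measurable_indic.
have sb w : `|k%:R * y w - s w| <= 1.
  rewrite /s; under eq_bigr do rewrite indicE.
  have -> : \sum_(j < m) (w \in B j)%:R = \sum_(j < m) (j.+1%:R <= k%:R * y w)%R%:R :> R.
    apply: eq_bigr => j _.
    by have -> : (w \in B j) = (j.+1%:R <= k%:R * y w)%R by apply/idP/idP; rewrite inE.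
  apply: staircase; have /andP[? ?] := y0 w.
  rewrite mulr_ge0 ?ler0n//= (le_trans _ hm)// ler_wpM2l// ler0n.
have mks : measurable_fun setT (fun w => k%:R * y w - s w).
  by apply: measurable_funB => //; exact: measurable_funM.
have ik : L1 (fun w => (k%:R * y w - s w) * X w) := L1M mks sb iX.
have iy : L1 (fun w => y w * X w) := L1M my yb iX.
have : k%:R * Ex (fun w => y w * X w) = Ex (fun w => (k%:R * y w - s w) * X w).
  rewrite -expZ//; under eq_Rintegral do rewrite mulrA sX.
  pose F j w := \1_(B j) w * X w.
  have iF j : L1 (F j) by exact: L1_indicM.
  rewrite (expD ik (@L1_sum m F (fun j _ => iF j))) (@exp_sum m F (fun j _ => iF j)).
  by rewrite big1 ?addr0// => j _; exact: X0.
move=> kEy.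
have : `|k%:R * Ex (fun w => y w * X w)| <= Ex (fun w => `|X w|).
  rewrite kEy (le_trans (exp_norm_le ik))// exp_le//; first exact: L1_norm.
  by move=> w; rewrite normrM ler_piMl.
rewrite normrM gtr0_norm// => hh.
by rewrite -(ler_pM2l k0) (le_trans hh)// mulrC.
Qed.

End expectation.

(** * Optional stopping *)

Section optional_stopping.
Context d (T : measurableType d) (R : realType) (P : probability T R).
Local Notation L1 X := (P.-integrable [set: T] (EFin \o X)).
Local Notation Ex X := (Rintegral P [set: T] X).
Variables (F : R -> set_system T) (Z : R -> T -> R) (rho : T -> R).
(* B is an event known at time u on which rho >= u.  C r is an event known at
   time r on which Z_r is bounded by K, and which contains the paths just after
   rho: it replaces the domination of Z, which is not available after rho. *)
Variables (B : set T) (C : R -> set T) (u v K : R).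
Hypotheses (fF : filtration F) (u0 : 0 <= u) (uv : u <= v) (v1 : v <= 1).
Hypothesis iZ : forall r, u <= r <= v -> L1 (Z r).
Hypothesis mart : forall r E, u <= r <= v -> F r E ->
  Ex (fun w => \1_E w * (Z v w - Z r w)) = 0.
Hypothesis cZ : forall w, B w -> {within `[0, 1], continuous (Z ^~ w)}.
Hypothesis orho : forall r, u <= r <= v -> F r [set w | rho w < r].
Hypothesis FB : F u B.
Hypothesis Brho : forall w, B w -> u <= rho w.
Hypothesis FC : forall r, u <= r <= v -> F r (C r).
Hypothesis CK : forall r w, u <= r <= v -> B w -> C r w -> `|Z r w| <= K.
Hypothesis Cnear : forall w, B w -> rho w < v -> exists2 e : R, 0 < e &
  forall r, rho w < r -> r < rho w + e -> r <= v -> C r w.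

Let r_ k j : R := u + (v - u) * (j%:R / k%:R).

Let r_in k j : (j <= k)%N -> u <= r_ k j <= v.
Proof.
move=> jk; rewrite /r_; case: k jk => [|k] jk.
  by rewrite invr0 !mulr0 addr0 lexx uv.
have h0 : 0 <= j%:R / k.+1%:R :> R by rewrite divr_ge0.
have h1 : j%:R / k.+1%:R <= 1 :> R by rewrite ler_pdivrMr ?ltr0n// mul1r ler_nat.
have h2 : 0 <= (v - u) * (j%:R / k.+1%:R) by rewrite mulr_ge0 ?subr_ge0.
have h3 : (v - u) * (j%:R / k.+1%:R) <= v - u by rewrite ler_piMr ?subr_ge0.
by rewrite lerDl h2 -lerBrDl h3.
Qed.

Let r_mono k i j : (i <= j)%N -> r_ k i <= r_ k j.
Proof.
by move=> ij; rewrite lerD2l ler_wpM2l ?subr_ge0// ler_wpM2r ?invr_ge0// ler_nat.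
Qed.

Let E_ k j := B `&` [set w | r_ k j <= rho w] `&` [set w | rho w < r_ k j.+1] `&` C (r_ k j.+1).

Let in01 r : u <= r <= v -> r \in `[0, 1].
Proof. by case/andP => h1 h2; rewrite in_itv/= (le_trans u0)//= (le_trans h2). Qed.

Let FE k j : (j < k)%N -> F (r_ k j.+1) (E_ k j).
Proof.
move=> jk; have [sF mF incF] := fF.
have rj := r_in (ltnW jk); have rj1 := r_in jk.
have sG := sF _ (in01 rj1).
have inc A r : u <= r -> r <= r_ k j.+1 -> F r A -> F (r_ k j.+1) A.
  move=> ur rr; apply: incF => //; first exact: le_trans ur.
  by case/andP : rj1 => _ /le_trans; exact.
apply: sigmaI =>//; last exact: FC.
apply: sigmaI =>//; last exact: orho.
apply: sigmaI =>//; first by apply: (inc _ u) => //; case/andP: rj1.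
have -> : [set w | r_ k j <= rho w] = ~` [set w | rho w < r_ k j].
  by apply/seteqP; split => w /= h; [apply/negP; rewrite -leNgt|move/negP: h; rewrite -leNgt].
apply: sigmaC => //; apply: (inc _ (r_ k j)); first by case/andP: rj.
  exact: r_mono.
exact: orho.
Qed.

(* At most one term is nonzero, the one with rho in [r_j, r_{j+1}): then
   r_{j+1} is the discretization of rho from the right, at which the event is
   known. *)
Let f_ k w : R := \sum_(j < k) \1_(E_ k j) w * (Z v w - Z (r_ k j.+1) w).

Let f_E k j w : (j < k)%N -> E_ k j w -> f_ k w = Z v w - Z (r_ k j.+1) w.
Proof.
move=> jk Ew; rewrite /f_ (bigD1 (Ordinal jk))//= indicE mem_set//= mul1r.
rewrite big1 ?addr0// => i ij; rewrite indicE memNset ?mul0r// => -[[[_ /= h1] /= h2] _].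
case: Ew => -[[_ /= h3] /= h4] _.
have [ij'|ji|e] := ltngtP (i : nat) j.
- by have := lt_le_trans h2 (le_trans (r_mono k ij') h3); rewrite ltxx.
- by have := lt_le_trans h4 (le_trans (r_mono k ji) h1); rewrite ltxx.
- by move: ij; rewrite -val_eqE /= e eqxx.
Qed.

Let f_0 k w : (forall j, (j < k)%N -> ~ E_ k j w) -> f_ k w = 0.
Proof. by move=> h; rewrite /f_ big1// => i _; rewrite indicE memNset ?mul0r//; exact: h. Qed.

Let X w := \1_B w * (Z v w - Z (Num.min v (rho w)) w).

Let f_cvg w : f_ ^~ w @ \oo --> X w.
Proof.
have [Bw|nBw] := pselect (B w); last first.
  rewrite /X indicE memNset// mul0r.
  rewrite (_ : f_ ^~ w = cst 0); first exact: cvg_cst.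
  by apply/funext => k; apply: f_0 => j _ -[[[]]].
have [vr|rv] := leP v (rho w).
  rewrite /X min_l// subrr mulr0.
  rewrite (_ : f_ ^~ w = cst 0); first exact: cvg_cst.
  apply/funext => k; apply: f_0 => j jk [[_ /= rr] _].
  by have := lt_le_trans rr (le_trans (andP (r_in jk)).2 vr); rewrite ltxx.
rewrite /X min_r ?ltW// indicE mem_set// mul1r.
have ur := Brho Bw.
have uv' : 0 < v - u by rewrite subr_gt0 (le_lt_trans ur).
have [e e0 eC] := Cnear Bw rv.
apply/cvgrPdist_le => eps eps0.
have [dl dl0 hdl] := within_unif_continuous (cZ Bw) eps0.
pose m := Num.min e dl.
have m0 : 0 < m by rewrite lt_min e0.
near=> k.
have k0 : (0 < k)%N by near: k; exact: nbhs_infty_gt.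
have k0' : (0 : R) < k%:R by rewrite ltr0n.
have km : (v - u) / k%:R < m.
  rewrite ltr_pdivrMr// mulrC -ltr_pdivrMr//.
  by near: k; exact: nbhs_infty_gtr.
pose x := (rho w - u) / (v - u) * k%:R.
have x0 : 0 <= x by rewrite mulr_ge0 ?divr_ge0 ?subr_ge0// ltW.
pose j := Num.truncn x.
have /andP[jx xj] : j%:R <= x < j.+1%:R by exact: truncn_itv.
have rj : r_ k j <= rho w.
  rewrite /r_ -lerBrDl mulrC -ler_pdivlMr// ler_pdivrMr//.
have rj1 : rho w < r_ k j.+1.
  rewrite /r_ -ltrBlDl mulrC -ltr_pdivrMr// ltr_pdivlMr//.
have jk : (j < k)%N.
  rewrite -(ltr_nat R) (le_lt_trans jx)// /x gtr_pMl// ltr_pdivrMr// mul1r; lra.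
have rjm : r_ k j.+1 < rho w + m.
  have -> : r_ k j.+1 = r_ k j + (v - u) / k%:R by rewrite /r_ -natr1; ring.
  by apply: ler_ltD.
have Ejw : E_ k j w.
  split; first by split.
  apply: eC => //; first by rewrite (lt_le_trans rjm)// lerD2l ge_min lexx.
  by case/andP: (r_in jk).
rewrite (f_E jk Ejw).
rewrite (_ : _ - _ = Z (r_ k j.+1) w - Z (rho w) w); last by ring.
have := r_in jk; move=> /andP[h1 h2].
have := r_in (ltnW jk); move=> /andP[h3 h4].
apply: hdl; rewrite ?(le_trans u0)//=.
- exact: le_trans h2 _.
- exact: le_trans (ltW rv) v1.
rewrite gtr0_norm ?subr_gt0// ltrBlDl (lt_le_trans rjm)// lerD2l ge_min lexx orbT.
Unshelve. all: by end_near. Qed.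

(** By the martingale property on the events E_ k j, f_ k has mean zero; it is
    dominated by |Z_v| + |K| and tends to Z_v - Z_{min(v, rho)} on B as the grid
    gets finer.  So this limit also has mean zero on B. *)
Lemma bounded_optional_stopping :
  let Y w := \1_B w * (Z (Num.min v (rho w)) w - Z u w) in
  L1 Y /\ Ex Y = 0.
Proof.
have [sF mF incF] := fF.
have vv : u <= v <= v by rewrite uv lexx.
have uu : u <= u <= v by rewrite uv lexx.
have mB : measurable B by apply: mF FB; exact: in01.
have mE k j : (j < k)%N -> measurable (E_ k j).
  by move=> jk; apply: mF (FE jk); exact/in01/r_in.
have iT k j : (j < k)%N -> L1 (fun w => \1_(E_ k j) w * (Z v w - Z (r_ k j.+1) w)).
  move=> jk; apply: L1_indicM; first exact: mE.
  by apply: L1B; apply: iZ => //; exact: r_in.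
have if_ k : L1 (f_ k).
  apply: (@L1_sum _ _ _ P k (fun j w => \1_(E_ k j) w * (Z v w - Z (r_ k j.+1) w))).
  by move=> j; exact: iT.
have Ef k : Ex (f_ k) = 0.
  have := @exp_sum _ _ _ P k (fun j w => \1_(E_ k j) w * (Z v w - Z (r_ k j.+1) w)).
  move=> ->; last by move=> j; exact: iT.
  rewrite big1// => j _; apply: mart; first exact: r_in.
  exact: FE.
have mX : measurable_fun setT X.
  apply: (measurable_fun_cvg (h := f_)) => // k.
  exact: L1_measurable (if_ k).
have [iX cX] : L1 X /\ (fun n => Ex (f_ n)) @ \oo --> Ex X.
  apply: (@exp_dominated _ _ _ P _ _ (fun w => `|Z v w| + `|K|)) => //.
  - by move=> k; exact: L1_measurable (if_ k).
  - apply: L1D; first by apply: L1_norm; exact: iZ.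
    by apply: (@bounded_L1 _ _ _ _ _ `|K|) => // w; rewrite normr_id.
  - move=> k w; have [[j [jk Ew]]|h] := pselect (exists j, (j < k)%N /\ E_ k j w).
      rewrite (f_E jk Ew) (le_trans (ler_normB _ _))// lerD2l.
      case: (Ew) => -[[Bw _] _] Cw.
      by rewrite (le_trans (CK (r_in jk) Bw Cw))// ler_norm.
    by rewrite f_0 ?normr0 ?addr_ge0// => j jk Ew; apply: h; exists j.
have EX : Ex X = 0.
  have -> : Ex X = limn (fun n => Ex (f_ n)) by apply/esym/cvg_lim.
  by under eq_fun do rewrite Ef; rewrite lim_cst.
have iU : L1 (fun w => \1_B w * (Z v w - Z u w)).
  by apply: L1_indicM => //; apply: L1B; exact: iZ.
have YE : (fun w => \1_B w * (Z (Num.min v (rho w)) w - Z u w)) =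
    (fun w => \1_B w * (Z v w - Z u w) - X w).
  by apply/funext => w; rewrite /X -mulrBr; congr (_ * _); ring.
rewrite /= YE; split; first exact: L1B.
by rewrite expB// EX subr0 mart.
Qed.

End optional_stopping.

(** * A Burkholder inequality in discrete time *)

Section power_taylor.
Variable R : realType.
Implicit Types x y e a : R.

Lemma normX_le y e n : `|y| <= e -> `|y ^+ n| <= e ^+ n.
Proof.
move=> ye; rewrite normrX; apply: lerXn2r; rewrite ?nnegrE//.
exact: le_trans ye.
Qed.

Lemma power_taylor e n : 0 <= e -> exists2 C : R, 0 <= C &
  forall y x, `|y| <= e -> `|y + x| <= e ->
  `|(y + x) ^+ n - (y ^+ n + n%:R * y ^+ n.-1 * x + 'C(n, 2)%:R * y ^+ n.-2 * x ^+ 2)|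
    <= C * `|x| ^+ 3.
Proof.
move=> e0; elim: n => [|n [C C0 IH]].
  exists 0 => // y x _ _; rewrite !expr0 !mul0r !addr0 subrr normr0//.
exists ('C(n, 2)%:R * e ^+ n.-2 + e * C).
  by rewrite addr_ge0// mulr_ge0// exprn_ge0.
move=> y x ye yxe.
have rC := IH y x ye yxe.
have -> : (y + x) ^+ n.+1 - (y ^+ n.+1 + n.+1%:R * y ^+ n.+1.-1 * x +
    'C(n.+1, 2)%:R * y ^+ n.+1.-2 * x ^+ 2) =
    'C(n, 2)%:R * y ^+ n.-2 * x ^+ 3 + (y + x) * ((y + x) ^+ n -
      (y ^+ n + n%:R * y ^+ n.-1 * x + 'C(n, 2)%:R * y ^+ n.-2 * x ^+ 2)).
  rewrite binS bin1 natrD -[n.+1%:R]natr1 !exprS /=.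
  have h1 : n%:R * y ^+ n = n%:R * y ^+ n.-1 * y :> R.
    by case: n {IH rC} => [|n]; rewrite ?mul0r// exprSr mulrA.
  have h2 : 'C(n, 2)%:R * y ^+ n.-1 = 'C(n, 2)%:R * y ^+ n.-2 * y :> R.
    by case: n {IH rC h1} => [|[|n]]; rewrite ?mul0r// exprSr mulrA.
  rewrite expr0 !mulr1.
  apply/eqP; rewrite -subr_eq0; apply/eqP.
  transitivity (('C(n, 2)%:R * y ^+ n.-2 * y - 'C(n, 2)%:R * y ^+ n.-1) * (x * x)
    + (n%:R * y ^+ n.-1 * y - n%:R * y ^+ n) * x); first by ring.
  by rewrite h1 h2 !subrr !mul0r addr0.
rewrite [leRHS]mulrDl; apply: le_trans (ler_normD _ _) (lerD _ _).
  rewrite !normrM normr_nat normrX ler_wpM2r ?exprn_ge0// ler_wpM2l//.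
  by rewrite -normrX normX_le.
by rewrite normrM -[leRHS]mulrA; apply: (ler_pM _ _ yxe rC).
Qed.

Lemma young_pow (x a c : R) q : 0 <= x -> 0 <= a -> 0 < c ->
  c * (x ^+ q * a) <= x ^+ q.+1 / 2 + c * (2 * c) ^+ q * a ^+ q.+1.
Proof.
move=> x0 a0 c0.
have [h|h] := leP (2 * c * a) x.
  apply: ler_wpDr; first by rewrite !mulr_ge0// ?exprn_ge0// ?mulr_ge0// ltW.
  rewrite exprSr ler_pdivlMr//.
  rewrite (_ : c * (x ^+ q * a) * 2 = x ^+ q * (2 * c * a)); last by ring.
  by rewrite ler_wpM2l// exprn_ge0.
apply: ler_wpDl; first by rewrite divr_ge0// exprn_ge0.
rewrite -mulrA ler_pM2l// exprSr mulrA -exprMn ler_wpM2r//.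
by apply: lerXn2r; rewrite ?nnegrE// ?mulr_ge0// ltW.
Qed.

End power_taylor.

Section discrete_burkholder.
Variable R : realType.
Local Notation mean P X := (Rintegral P setT X).

(** Ito's formula for Y^n - 'C(n, 2) Y^(n-2) A over one step, in which Y moves
    from y to y + x and A from a to a + b.  The second-order term of Y^n is
    compensated by the increment of A, up to the martingale increment
    x^2 - b.  The second-order term of Y^(n-2) A has a sign, because n is
    even.  What remains is of third order, bounded by the step size eta. *)
Lemma step_bound (q : nat) (e : R) : 0 <= e -> let n := q.+1.*2 in let c := 'C(n, 2)%:R in
  exists2 K : R, 0 <= K & forall y x a b eta : R, `|y| <= e -> `|y + x| <= e ->
   `|x| <= eta -> 0 <= a -> 0 <= b -> a + b <= 1 ->
   (y + x) ^+ n - c * (y + x) ^+ n.-2 * (a + b) <=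
   (y ^+ n - c * y ^+ n.-2 * a) +
   (n%:R * (y ^+ n.-1 * x) - c * n.-2%:R * (y ^+ n.-2.-1 * a * x) +
    c * (y ^+ n.-2 * (x ^+ 2 - b))) + K * eta * (x ^+ 2 + b).
Proof.
move=> e0 n c.
have c0 : 0 <= c by [].
have [C1 C10 H1] := @power_taylor R e n e0.
have [C2 C20 H2] := @power_taylor R e n.-2 e0.
exists (C1 + c * C2 + c * n.-2%:R * e ^+ n.-2.-1).
  by rewrite !addr_ge0// !mulr_ge0// ?exprn_ge0.
move=> y x a b eta ye yxe xeta a0 b0 ab1.
have eta0 : 0 <= eta by exact: le_trans xeta.
have := H1 y x ye yxe; rewrite ler_norml -/c => /andP[_].
rewrite lerBlDl; set y1 := (y + x) ^+ n => h1.
have := H2 y x ye yxe; rewrite ler_norml => /andP[+ _].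
set y2 := (y + x) ^+ n.-2.
set k := y ^+ n.-2; set k1 := y ^+ n.-2.-1.
have k2 : 0 <= 'C(n.-2, 2)%:R * y ^+ n.-2.-2 * x ^+ 2.
  apply: mulr_ge0; last exact: sqr_ge0.
  rewrite /n; case: q {n c c0 C1 C10 H1 C2 C20 H2 h1 y1 y2 k k1} => [|q] /=.
    by rewrite mul0r.
  by rewrite mulr_ge0// -[q.*2]muln2 exprM sqr_ge0.
move=> h2.
have x3 : `|x| ^+ 3 <= eta * x ^+ 2.
  by rewrite exprS -normrX (ger0_norm (sqr_ge0 x)) ler_wpM2r ?sqr_ge0.
have h2' : k + n.-2%:R * k1 * x - C2 * (eta * x ^+ 2) <= y2.
  have := ler_wpM2l C20 x3; move: h2 k2; rewrite -/k -/k1; lra.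
have h1' : y1 <= y ^+ n + n%:R * y ^+ n.-1 * x + c * k * x ^+ 2 + C1 * (eta * x ^+ 2).
  by apply: (le_trans h1); rewrite lerD2l ler_wpM2l.
have h3 : c * (a + b) * (k + n.-2%:R * k1 * x - C2 * (eta * x ^+ 2)) <= c * (a + b) * y2.
  by rewrite ler_wpM2l// mulr_ge0// addr_ge0.
have x20 := sqr_ge0 x.
have h4 : c * (a + b) * (C2 * (eta * x ^+ 2)) <= c * C2 * eta * x ^+ 2.
  rewrite (_ : c * (a + b) * _ = (a + b) * (c * C2 * eta * x ^+ 2)); last by ring.
  by rewrite ler_piMl//; apply: mulr_ge0 => //; rewrite !mulr_ge0.
have h5 : - (c * n.-2%:R * e ^+ n.-2.-1 * eta * b) <= c * n.-2%:R * (k1 * x * b).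
  have hk : `|k1 * x| <= e ^+ n.-2.-1 * eta.
    by rewrite normrM; apply: ler_pM => //; exact: normX_le.
  have cnb : 0 <= c * n.-2%:R * b by rewrite !mulr_ge0.
  have /andP[hk1 _] : - (e ^+ n.-2.-1 * eta) <= k1 * x <= e ^+ n.-2.-1 * eta.
    by rewrite -ler_norml.
  have := ler_wpM2l cnb hk1; congr (_ <= _); ring.
have h6 : 0 <= (C1 + c * C2) * eta * b by rewrite !mulr_ge0// addr_ge0// mulr_ge0.
have h7 : 0 <= c * n.-2%:R * e ^+ n.-2.-1 * eta * x ^+ 2.
  by apply: mulr_ge0 => //; rewrite !mulr_ge0// exprn_ge0.
have -> : y1 - c * y2 * (a + b) = y1 - c * (a + b) * y2 by ring.
apply: le_trans (lerB h1' h3) _.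
rewrite -subr_ge0.
set f := y ^+ n; set f1 := y ^+ n.-1; set E := e ^+ n.-2.-1 in h5 h7 *.
set N2 := n.-2%:R in h5 h7 *.
rewrite (_ : _ - _ = (c * C2 * eta * x ^+ 2 - c * (a + b) * (C2 * (eta * x ^+ 2)))
  + (c * N2 * (k1 * x * b) + c * N2 * E * eta * b)
  + (C1 + c * C2) * eta * b + c * N2 * E * eta * x ^+ 2); last by ring.
apply: addr_ge0 => //; apply: addr_ge0 => //; apply: addr_ge0.
  by rewrite subr_ge0.
by rewrite addrC -lerBlDl sub0r.
Qed.

(** K is admissible when the moment inequality holds, with the error K eta, for
    all discrete martingales with values in [-e, e], steps at most eta and
    brackets at most 1.  The martingale properties of Y and of Y^2 - A enter only
    through orthogonality to monomials of the past. *)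
Definition burkholder_constant (q : nat) (e K : R) : Prop :=
  let n := q.+1.*2 in let c := 'C(n, 2)%:R in
  forall d (T : measurableType d) (P : probability T R)
    (m : nat) (D B : nat -> T -> R) (eta : R),
  let Y i w := \sum_(j < i) D j w in
  let A i w := \sum_(j < i) B j w in
  0 <= eta -> (forall i, (i < m)%N -> measurable_fun setT (D i)) ->
  (forall i, (i < m)%N -> measurable_fun setT (B i)) ->
  (forall i w, (i < m)%N -> `|D i w| <= eta) ->
  (forall i w, (i < m)%N -> 0 <= B i w) ->
  (forall i w, (i <= m)%N -> `|Y i w| <= e) ->
  (forall w, A m w <= 1) ->
  (forall i a b, (i < m)%N -> mean P (fun w => Y i w ^+ a * A i w ^+ b * D i w) = 0) ->
  (forall i a, (i < m)%N -> mean P (fun w => Y i w ^+ a * (D i w ^+ 2 - B i w)) = 0) ->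
  mean P (fun w => Y m w ^+ n) <= (2 * c) ^+ q.+1 * mean P (fun w => A m w ^+ q.+1) + K * eta.

(** Summing [step_bound], E[Y^n] <= 'C(n, 2) E[Y^(n-2) A] up to an error of
    order eta: the errors eta x^2 have the same mean as eta b, and the b's add
    up to at most 1.  Young's inequality then splits Y^(n-2) A into half of
    the left-hand side and a multiple of A^(q+1). *)
Lemma discrete_burkholder (q : nat) (e : R) : 0 <= e ->
  exists2 K : R, 0 <= K & burkholder_constant q e K.
Proof.
pose n := q.+1.*2; pose c : R := 'C(n, 2)%:R.
move=> e0; have [K K0 HK] := step_bound q e0.
have c0 : 0 < c by rewrite ltr0n bin_gt0.
exists (4 * K); first by rewrite mulr_ge0.
move=> d T P m D B eta Y A eta0 mD mB Deta B0 Ye A1 orthD orthQ; rewrite -/n -/c.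
have Aincr i w : (i <= m)%N -> 0 <= A i w <= A m w.
  move=> im; apply/andP; split.
    by apply: sumr_ge0 => j _; apply: B0; exact: leq_trans im.
  rewrite /A -(subnKC im) big_split_ord /= lerDl; apply: sumr_ge0 => j _; apply: B0.
  by rewrite -ltn_subRL.
have A01 i w : (i <= m)%N -> 0 <= A i w <= 1.
  by move=> /Aincr => /(_ w)/andP[-> h]; exact: le_trans h (A1 w).
have mY i : (i <= m)%N -> measurable_fun setT (Y i).
  move=> im; apply: measurable_sum => j; apply: mD; exact: leq_trans im.
have mA i : (i <= m)%N -> measurable_fun setT (A i).
  move=> im; apply: measurable_sum => j; apply: mB; exact: leq_trans im.
have YS i w : Y i.+1 w = Y i w + D i w by rewrite /Y big_ord_recr.
have AS i w : A i.+1 w = A i w + B i w by rewrite /A big_ord_recr.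
have B1 i w : (i < m)%N -> `|B i w| <= 1.
  move=> im; rewrite ger0_norm ?B0//.
  have := A01 i w (ltnW im); have := A01 i.+1 w im; rewrite AS; lra.
have normA i w : (i <= m)%N -> `|A i w| <= 1.
  by move=> im; case/andP: (A01 i w im) => ? ?; rewrite ger0_norm.
have iYAD i a b : (i < m)%N ->
    P.-integrable setT (EFin \o (fun w => Y i w ^+ a * A i w ^+ b * D i w)).
  move=> im; apply: (@bounded_L1 _ _ _ _ _ (e ^+ a * 1 ^+ b * eta)).
    apply: measurable_funM; last exact: mD.
    by apply: measurable_funM; apply: measurable_funX; [apply: mY|apply: mA]; exact: ltnW.
  move=> w; rewrite !normrM; apply: ler_pM => //; last exact: Deta.
  apply: ler_pM => //; first by apply: normX_le; apply: Ye; exact: ltnW.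
  by apply: normX_le; apply: normA; exact: ltnW.
have iYQ i a : (i < m)%N ->
    P.-integrable setT (EFin \o (fun w => Y i w ^+ a * (D i w ^+ 2 - B i w))).
  move=> im; apply: (@bounded_L1 _ _ _ _ _ (e ^+ a * (eta ^+ 2 + 1))).
    apply: measurable_funM; first by apply: measurable_funX; apply: mY; exact: ltnW.
    by apply: measurable_funB; [apply: measurable_funX; exact: mD|exact: mB].
  move=> w; rewrite normrM; apply: ler_pM => //.
    by apply: normX_le; apply: Ye; exact: ltnW.
  rewrite (le_trans (ler_normB _ _))// lerD ?B1//.
  by apply: normX_le; exact: Deta.
pose Phi i w := Y i w ^+ n - c * Y i w ^+ n.-2 * A i w.
(* the martingale increments in the bound of step i; the last one replaces
   D^2 + B by 2 B in the error term *)
pose W i w := n%:R * (Y i w ^+ n.-1 * A i w ^+ 0 * D i w)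
  - c * n.-2%:R * (Y i w ^+ n.-2.-1 * A i w ^+ 1 * D i w)
  + c * (Y i w ^+ n.-2 * (D i w ^+ 2 - B i w))
  + K * eta * (Y i w ^+ 0 * (D i w ^+ 2 - B i w)).
have WE i : (i < m)%N -> P.-integrable setT (EFin \o (W i)) /\ mean P (W i) = 0.
  move=> im.
  have i1 := L1Z n%:R (iYAD i n.-1 0%N im).
  have i2 := L1Z (c * n.-2%:R) (iYAD i n.-2.-1 1%N im).
  have i3 := L1Z c (iYQ i n.-2 im).
  have i4 := L1Z (K * eta) (iYQ i 0%N im).
  split; first exact: (L1D (L1D (L1B i1 i2) i3) i4).
  rewrite /W (expD (L1D (L1B i1 i2) i3) i4) (expD (L1B i1 i2) i3) (expB i1 i2).
  rewrite (expZ _ (iYAD i n.-1 0%N im)) (expZ _ (iYAD i n.-2.-1 1%N im)).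
  rewrite (expZ _ (iYQ i n.-2 im)) (expZ _ (iYQ i 0%N im)).
  by rewrite !orthD// !orthQ// !mulr0 subrr !addr0.
have iW i (im : (i < m)%N) := (WE i im).1.
have EW i (im : (i < m)%N) := (WE i im).2.
have PhiW i w : (i <= m)%N -> Phi i w <= \sum_(j < i) W j w + 2 * K * eta * A i w.
  elim: i => [|i IH] im.
    by rewrite /Phi /Y /A !big_ord0 expr0n/= !mulr0 subr0 addr0.
  have {}IH := IH (ltnW im).
  rewrite big_ord_recr/= {1}/Phi YS AS.
  have /andP[a0 _] := A01 i w (ltnW im).
  have /andP[_ a1] := A01 i.+1 w im; rewrite AS in a1.
  have ye := Ye i w (ltnW im).
  have yxe := Ye i.+1 w im; rewrite YS in yxe.
  have := HK _ _ _ _ eta ye yxe (Deta i w im) a0 (B0 i w im) a1.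
  rewrite -/n -/c => /le_trans; apply.
  move: IH; rewrite /Phi /W !expr0 expr1 !mulr1 mul1r => IH.
  set S := \sum_(j < i) _ in IH *.
  apply: le_trans (lerD (lerD IH (lexx _)) (lexx _)) _.
  by rewrite le_eqVlt; apply/orP; left; apply/eqP; ring.
have iS : P.-integrable setT (EFin \o (fun w => \sum_(j < m) W j w)).
  by apply: L1_sum.
have iYX a : P.-integrable setT (EFin \o (fun w => Y m w ^+ a)).
  apply: (@bounded_L1 _ _ _ _ _ (e ^+ a)); first by apply: measurable_funX; exact: mY.
  by move=> w; apply: normX_le; exact: Ye.
have iAX a : P.-integrable setT (EFin \o (fun w => A m w ^+ a)).
  apply: (@bounded_L1 _ _ _ _ _ (1 ^+ a)); first by apply: measurable_funX; exact: mA.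
  by move=> w; apply: normX_le; exact: normA.
have iA : P.-integrable setT (EFin \o A m) by have := iAX 1%N.
have young w : Y m w ^+ n <= (Y m w ^+ n / 2 + c * (2 * c) ^+ q * A m w ^+ q.+1) +
    (\sum_(j < m) W j w + 2 * K * eta * 1).
  have := PhiW m w (leqnn _); rewrite /Phi => h.
  have /andP[a0 a1] := A01 m w (leqnn _).
  have := young_pow q (sqr_ge0 (Y m w)) a0 c0.
  rewrite -!exprM mulnC muln2 [(2 * q.+1)%N]mulnC muln2 -/n => h2.
  have h3 : K * eta * A m w <= K * eta by rewrite ler_piMr// mulr_ge0.
  move: h h2; rewrite (_ : n.-2 = q.*2)//; lra.
have iY := iYX n; have iAq := iAX q.+1.
have i1 : P.-integrable setT (EFin \o (fun w => 2^-1 * Y m w ^+ n)) by exact: L1Z.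
have i2 : P.-integrable setT (EFin \o (fun w => c * (2 * c) ^+ q * A m w ^+ q.+1)).
  exact: L1Z.
have i3 : P.-integrable setT (EFin \o (fun w => 2 * K * eta : R)).
  by apply: (@bounded_L1 _ _ _ _ _ `|2 * K * eta|).
have : mean P (fun w => Y m w ^+ n) <= mean P (fun w => (2^-1 * Y m w ^+ n
    + c * (2 * c) ^+ q * A m w ^+ q.+1) + (\sum_(j < m) W j w + 2 * K * eta)).
  apply: exp_le => //; first by repeat apply: L1D.
  by move=> w; apply: le_trans (young w) _; rewrite mulr1 [2^-1 * _]mulrC.
rewrite expD; [|exact: L1D|exact: L1D].
rewrite (expD i1 i2) (expD iS i3) (expZ _ iY) (expZ _ iAq) (@exp_sum _ _ _ P m W iW) exp_cst.
rewrite (eq_bigr (fun=> 0)); last by move=> j _; exact: EW.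
rewrite sumr_const mul0rn add0r exprS.
set X := Rintegral _ _ _; set Z := Rintegral _ _ _ => h.
rewrite (_ : 2 * c * (2 * c) ^+ q * Z = 2 * (c * (2 * c) ^+ q * Z)); last by ring.
move: h; set U := c * _ * Z; lra.
Qed.

End discrete_burkholder.

(** * The maximal inequality *)

Section measurability_wrt.
Context d (T : measurableType d) (R : realType).
Implicit Types (G : set_system T) (X Y : T -> R).

Lemma meas_wrtP G X : sigma_algebra setT G ->
  (forall S, measurable S -> G (X @^-1` S)) -> meas_wrt G X.
Proof.
by move=> sG h _ S mS; rewrite setTI measurable_g_measurableTypeE//; exact: h.
Qed.

Lemma meas_wrt_sub G G' X : sigma_algebra setT G -> sigma_algebra setT G' ->
  G `<=` G' -> meas_wrt G X -> meas_wrt G' X.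
Proof.
move=> sG sG' GG' mX; apply: meas_wrtP => // S mS; apply: GG'.
exact: meas_wrt_preimage mX S mS.
Qed.

Lemma meas_wrt_gt G X (c : R) : sigma_algebra setT G -> meas_wrt G X ->
  G [set w | c < X w].
Proof.
move=> sG mX; have := meas_wrt_preimage sG mX (measurable_itv `]c, +oo[).
by congr (G _); apply/seteqP; split => w /=; rewrite in_itv/= andbT.
Qed.

Lemma meas_wrt_le G X (c : R) : sigma_algebra setT G -> meas_wrt G X ->
  G [set w | X w <= c].
Proof.
move=> sG mX; have := sigmaC sG (meas_wrt_gt c sG mX).
by congr (G _); apply/seteqP; split => w /=; [move/negP; rewrite -leNgt|move=> h; apply/negP; rewrite -leNgt].
Qed.

Definition clip (c x : R) := Num.max (- c) (Num.min c x).

Lemma clip_le c x : 0 <= c -> `|clip c x| <= c.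
Proof.
move=> c0; rewrite ler_norml /clip le_max lexx/= ge_max ge_min lexx /= andbT.
lra.
Qed.

Lemma clip_id c x : `|x| <= c -> clip c x = x.
Proof. by rewrite ler_norml /clip => /andP[h1 h2]; rewrite min_r// max_r. Qed.

Lemma meas_wrt_clip G X c : meas_wrt G X -> meas_wrt G (fun w => clip c (X w)).
Proof.
by move=> mX; apply: measurable_maxr => //; apply: measurable_minr.
Qed.

End measurability_wrt.

Lemma rat_between (R : realType) (a b : R) : a < b -> exists q : rat, a < (ratr q : R) < b.
Proof. by move=> /rat_in_itvoo[q]; rewrite in_itv/=; exists q. Qed.

(** Approximation from the left only: the times before a stopping time are those
    on which something is known. *)
Lemma le_of_rat_le (R : realType) (f : R -> R) (s r c : R) : s < r ->
  (forall e : R, 0 < e -> exists2 dl : R, 0 < dl & forall y, s < y -> y < r ->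
     r - y < dl -> f r <= f y + e) ->
  (forall q : rat, s < ratr q -> ratr q < r -> f (ratr q) <= c) -> f r <= c.
Proof.
move=> sr cf fc; apply/ler_addgt0Pr => e e0.
have [dl dl0 hdl] := cf e e0.
have [q /andP[q1 q2]] : exists q : rat, Num.max s (r - dl) < (ratr q : R) < r.
  by apply: rat_between; rewrite gt_max sr ltrBlDr ltrDl.
move: q1; rewrite gt_max => /andP[q1 q3].
apply: le_trans (hdl (ratr q) q1 q2 _) _; first by rewrite ltrBlDr -ltrBlDl.
by rewrite lerD2r fc.
Qed.

Lemma stopping_time_lt d (T : measurableType d) (R : realType) (F : R -> set_system T)
    (tau : T -> R) (r : R) :
  filtration F -> stopping_time F tau -> 0 <= r <= 1 -> F r [set w | tau w < r].
Proof.
move=> [sF _ incF] [tau01 Ftau] /andP[r0 r1].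
have -> : [set w | tau w < r] =
    \bigcup_(q in [set q : rat | 0 <= (ratr q : R) < r]) [set w | tau w <= ratr q].
  apply/seteqP; split => w /=.
    move=> /rat_between[q /andP[h1 h2]]; exists q => /=; last exact: ltW.
    rewrite h2 andbT; apply: le_trans (ltW h1).
    by have := tau01 w; rewrite in_itv/= => /andP[].
  by move=> [q /= /andP[_ h] /le_lt_trans]; apply.
apply: sigma_bigcup; first by apply: sF; rewrite in_itv/= r0.
move=> q /= /andP[q0 qr]; apply: (incF (ratr q)) => //; first exact: ltW.
by apply: Ftau; rewrite in_itv/= q0 (le_trans (ltW qr)).
Qed.

(* Here all paths are continuous, tau1 and tau2 localize M and M^2 - A, and all
   parameters are fixed; the error terms are removed afterwards. *)
Section maximal_inequality_fixed.
Context d (T : measurableType d) (R : realType) (P : probability T R).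
Local Notation L1 X := (P.-integrable [set: T] (EFin \o X)).
Local Notation mean X := (Rintegral P [set: T] X).
Variables (F : R -> set_system T) (M A : R -> T -> R) (tau1 tau2 : T -> R).
Hypothesis fF : filtration F.
Hypothesis aM : forall t, 0 <= t <= 1 -> meas_wrt (F t) (M t).
Hypothesis aA : forall t, 0 <= t <= 1 -> meas_wrt (F t) (A t).
Hypothesis cM : forall w, {within `[0, 1], continuous (M ^~ w)}.
Hypothesis cA : forall w, {within `[0, 1], continuous (A ^~ w)}.
Hypothesis A_mono : forall w r v, 0 <= r -> r <= v -> v <= 1 -> A r w <= A v w.
Hypothesis A0 : forall w, A 0 w = 0.
Hypothesis st1 : stopping_time F tau1.
Hypothesis st2 : stopping_time F tau2.
Let N t w := M t w ^+ 2 - A t w.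
Let Z1 r w := M (Num.min r (tau1 w)) w - M 0 w.
Let Z2 r w := N (Num.min r (tau2 w)) w - N 0 w.
Hypothesis iZ1 : forall r, 0 <= r <= 1 -> L1 (Z1 r).
Hypothesis iZ2 : forall r, 0 <= r <= 1 -> L1 (Z2 r).
Hypothesis mart1 : forall r v E, 0 <= r -> r <= v -> v <= 1 -> F r E ->
  mean (fun w => \1_E w * (Z1 v w - Z1 r w)) = 0.
Hypothesis mart2 : forall r v E, 0 <= r -> r <= v -> v <= 1 -> F r E ->
  mean (fun w => \1_E w * (Z2 v w - Z2 r w)) = 0.
Variables (s t e eta delta K : R).
Hypotheses (s0 : 0 <= s) (st : s < t) (t1 : t <= 1).
Hypotheses (e0 : 0 < e) (eta0 : 0 < eta) (delta0 : 0 < delta).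

Let sF r : 0 <= r <= 1 -> sigma_algebra setT (F r).
Proof. by move=> r01; case: fF => h _ _; apply: h; rewrite in_itv. Qed.

Let mF r E : 0 <= r <= 1 -> F r E -> measurable E.
Proof. by move=> r01; case: fF => _ h _; apply: h; rewrite in_itv. Qed.

Let incF r v E : 0 <= r -> r <= v -> v <= 1 -> F r E -> F v E.
Proof. by move=> r0 rv v1; case: fF => _ _ h; apply: h. Qed.

Let aM' r v : 0 <= r -> r <= v -> v <= 1 -> meas_wrt (F v) (M r).
Proof.
move=> r0 rv v1; have r1 := le_trans rv v1; have v0 := le_trans r0 rv.
have r01 : 0 <= r <= 1 by rewrite r0.
have v01 : 0 <= v <= 1 by rewrite v0.
by apply: (meas_wrt_sub (sF r01) (sF v01) _ (aM r01)) => E; apply: incF.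
Qed.

Let aA' r v : 0 <= r -> r <= v -> v <= 1 -> meas_wrt (F v) (A r).
Proof.
move=> r0 rv v1; have r1 := le_trans rv v1; have v0 := le_trans r0 rv.
have r01 : 0 <= r <= 1 by rewrite r0.
have v01 : 0 <= v <= 1 by rewrite v0.
by apply: (meas_wrt_sub (sF r01) (sF v01) _ (aA r01)) => E; apply: incF.
Qed.

(** Something has gone wrong by the rational time x: M has moved by more than e
    since s, its bracket has grown by more than 1, or M has moved by more than
    eta within a time delta. *)
Definition bad_rational (w : T) (x : R) :=
  [\/ e < `|M x w - M s w|, 1 < A x w - A s w |
   exists p : rat, [/\ s <= ratr p, ratr p <= x, x - ratr p < delta &
     eta < `|M (ratr p) w - M x w|]].

(** Only rational times are considered, so that the infimum rho of the bad times
    satisfies {rho < r} in F_r; by continuity of the paths, nothing is lost.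
    The localizing times are included, so that rho never exceeds them. *)
Definition bad_times w : set R := [set x | [\/ x = tau1 w, x = tau2 w |
  exists q : rat, [/\ x = ratr q, s <= x, x <= t & bad_rational w x]]].

Let rho w := inf (bad_times w).

Let tau1_01 w : 0 <= tau1 w <= 1.
Proof. by case: st1 => /(_ w); rewrite in_itv. Qed.
Let tau2_01 w : 0 <= tau2 w <= 1.
Proof. by case: st2 => /(_ w); rewrite in_itv. Qed.

Let bt_inf w : has_inf (bad_times w).
Proof.
split; first by exists (tau1 w); constructor 1.
exists 0 => x [->|->|[q [_ sx _ _]]]; first by case/andP: (tau1_01 w).
  by case/andP: (tau2_01 w).
exact: le_trans sx.
Qed.

Let rho_le w x : bad_times w x -> rho w <= x.
Proof. by apply: ge_inf; case: (bt_inf w). Qed.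

Let rho_lt w r : rho w < r -> exists2 x, bad_times w x & x < r.
Proof. by move=> /(inf_lt (bt_inf w).1) [x bx xr]; exists x. Qed.

Let rho_tau1 w : rho w <= tau1 w.
Proof. by apply: rho_le; constructor 1. Qed.
Let rho_tau2 w : rho w <= tau2 w.
Proof. by apply: rho_le; constructor 2. Qed.
Let rho_1 w : rho w <= 1.
Proof. by apply: le_trans (rho_tau1 w) _; case/andP: (tau1_01 w). Qed.

Let tau_lt tau r : stopping_time F tau -> 0 <= r <= 1 -> F r [set w | tau w < r].
Proof. by move=> stau r01; exact: stopping_time_lt. Qed.

Let F_bad r x : s <= x -> x <= r -> r <= 1 -> F r [set w | bad_rational w x].
Proof.
move=> sx xr r1; have x0 := le_trans s0 sx; have r0 := le_trans x0 xr.
have x1 := le_trans xr r1; have sr := le_trans sx xr.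
have sG : sigma_algebra setT (F r) by apply: sF; rewrite r0.
have -> : [set w | bad_rational w x] = ([set w | e < `|M x w - M s w|] `|`
   [set w | 1 < A x w - A s w]) `|`
   \bigcup_(p in [set p : rat | [/\ s <= ratr p, ratr p <= x & x - ratr p < delta]])
     [set w | eta < `|M (ratr p) w - M x w|].
  apply/seteqP; split => w /=.
    case=> [h|h|[p [h1 h2 h3 h4]]]; [by left; left|by left; right|right].
    by exists p.
  case=> [[h|h]|[p /= [h1 h2 h3] h4]]; [by constructor 1|by constructor 2|].
  by constructor 3; exists p.
have norm_gt c r1' r2' : 0 <= r1' <= r -> 0 <= r2' <= r ->
    F r [set w | c < `|M r1' w - M r2' w|].
  move=> /andP[a1 a2] /andP[a3 a4]; apply: meas_wrt_gt => //.
  apply: measurableT_comp => //; apply: measurable_funB; exact: aM'.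
apply: sigmaU => //; first apply: sigmaU => //.
- by apply: norm_gt; rewrite ?x0 ?xr ?s0 ?sr.
- by apply: meas_wrt_gt => //; apply: measurable_funB; exact: aA'.
- apply: sigma_bigcup => // p /= [h1 h2 h3]; apply: norm_gt; rewrite ?x0 ?xr//.
  by rewrite (le_trans s0)//= (le_trans h2).
Qed.

Let F_rho r : 0 <= r <= 1 -> F r [set w | rho w < r].
Proof.
move=> r01; have [r0 r1] := andP r01.
have -> : [set w | rho w < r] = ([set w | tau1 w < r] `|` [set w | tau2 w < r]) `|`
    \bigcup_(q in [set q : rat | [/\ s <= ratr q, ratr q <= t & ratr q < r]])
      [set w | bad_rational w (ratr q)].
  apply/seteqP; split => w /=.
    move=> /rho_lt[x [->|->|[q [-> h1 h2 h3]]] xr]; [by left; left|by left; right|].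
    by right; exists q.
  case=> [[h|h]|[q /= [h1 h2 h3] h4]]; [exact: le_lt_trans h|exact: le_lt_trans h|].
  by apply: le_lt_trans h3; apply: rho_le; constructor 3; exists q.
apply: sigmaU; [exact: sF| |].
  by apply: sigmaU; [exact: sF|exact: tau_lt|exact: tau_lt].
apply: sigma_bigcup; first exact: sF.
by move=> q /= [h1 h2 h3]; apply: F_bad => //; exact: ltW.
Qed.

Let dist_M_approx w (r : R) : 0 <= r <= 1 -> forall c : R, 0 < c -> exists2 dl : R,
  0 < dl & forall y, 0 <= y <= 1 -> `|r - y| < dl ->
  `|M r w - M s w| <= `|M y w - M s w| + c.
Proof.
move=> r01 c c0; have [dl dl0 hdl] := within_unif_continuous (@cM w) c0.
exists dl => // y y01 ry; have h := hdl r y r01 y01 ry.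
rewrite (_ : M r w - M s w = (M r w - M y w) + (M y w - M s w)); last by ring.
by rewrite [leRHS]addrC (le_trans (ler_normD _ _))// lerD2r.
Qed.

Let left_M w (c r : R) : s <= r -> r <= 1 -> 0 <= c ->
  (forall q : rat, s < ratr q -> ratr q < r -> `|M (ratr q) w - M s w| <= c) ->
  `|M r w - M s w| <= c.
Proof.
move=> sr r1 c0; move: (sr); rewrite le_eqVlt => /predU1P[<- _|sr'].
  by rewrite subrr normr0.
have r0 := le_trans s0 sr; have r01 : 0 <= r <= 1 by rewrite r0.
apply: (@le_of_rat_le _ (fun x => `|M x w - M s w|)) => // c' c'0.
have [dl dl0 hdl] := dist_M_approx w r01 c'0.
exists dl => // y sy yr ryd; apply: hdl.
  by rewrite (le_trans s0 (ltW sy)) (le_trans (ltW yr)).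
by rewrite gtr0_norm// subr_gt0.
Qed.

Let left_A w (c r : R) : s <= r -> r <= 1 -> 0 <= c ->
  (forall q : rat, s < ratr q -> ratr q < r -> A (ratr q) w - A s w <= c) ->
  A r w - A s w <= c.
Proof.
move=> sr r1 c0; move: (sr); rewrite le_eqVlt => /predU1P[<- _|sr'].
  by rewrite subrr.
have r0 := le_trans s0 sr; have r01 : 0 <= r <= 1 by rewrite r0.
apply: (@le_of_rat_le _ (fun x => A x w - A s w)) => // c' c'0.
have [dl dl0 hdl] := within_unif_continuous (@cA w) c'0.
exists dl => // y sy yr ryd.
have : `|A r w - A y w| <= c'.
  apply: hdl => //; first by rewrite (le_trans s0 (ltW sy)) (le_trans (ltW yr)).
  by rewrite gtr0_norm// subr_gt0.
move=> /(le_trans (ler_norm _)); lra.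
Qed.

Let before_M w (r : R) : s <= r -> r <= t -> r <= rho w -> `|M r w - M s w| <= e.
Proof.
move=> sr rt rr; apply: left_M => //; [exact: le_trans t1|exact: ltW|].
move=> q sq qr; rewrite leNgt; apply/negP => h.
have : rho w <= ratr q.
  apply: rho_le; constructor 3; exists q; split => //; [exact: ltW|exact: le_trans (ltW qr) rt|].
  by constructor 1.
by rewrite leNgt (lt_le_trans qr rr).
Qed.

Let before_A w (r : R) : s <= r -> r <= t -> r <= rho w -> A r w - A s w <= 1.
Proof.
move=> sr rt rr; apply: left_A => //; first exact: le_trans t1.
move=> q sq qr; rewrite leNgt; apply/negP => h.
have : rho w <= ratr q.
  apply: rho_le; constructor 3; exists q; split => //; [exact: ltW|exact: le_trans (ltW qr) rt|].
  by constructor 2.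
by rewrite leNgt (lt_le_trans qr rr).
Qed.

Let before_osc w (r r' : R) : s <= r -> r <= r' -> r' <= t -> r' <= rho w -> r' - r < delta ->
  `|M r w - M r' w| <= eta.
Proof.
have [s0' t1' e0' eta0'] := (And4 s0 t1 e0 eta0).
move=> sr rr' r't r'rho rd; rewrite leNgt; apply/negP => h.
have rr : r < r'.
  by rewrite lt_neqAle rr' andbT; apply/eqP => E; move: h; rewrite E subrr normr0 ltNge ltW.
have h' : 0 < (`|M r w - M r' w| - eta) / 4 by lra.
have [dl dl0 hdl] := within_unif_continuous (@cM w) h'.
have [q /andP[q1 q2]] : exists q : rat, Num.max ((r + r') / 2) (r' - dl) < ratr q < r'.
  by apply: rat_between; rewrite gt_max; apply/andP; split; lra.
have [p /andP[p1 p2]] : exists p : rat, r < ratr p < Num.min ((r + r') / 2) (r + dl).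
  by apply: rat_between; rewrite lt_min; apply/andP; split; lra.
move: q1 p2; rewrite gt_max lt_min => /andP[q1 q3] /andP[p2 p3].
have hq : `|M r' w - M (ratr q) w| <= (`|M r w - M r' w| - eta) / 4.
  apply: hdl; first by apply/andP; split; lra.
    by apply/andP; split; lra.
  by rewrite gtr0_norm; lra.
have hp : `|M r w - M (ratr p) w| <= (`|M r w - M r' w| - eta) / 4.
  apply: hdl; first by apply/andP; split; lra.
    by apply/andP; split; lra.
  by rewrite ltr0_norm; lra.
have : rho w <= ratr q.
  apply: rho_le; constructor 3; exists q; split => //; [lra|lra|].
  constructor 3; exists p; split; [lra|lra|lra|].
  have := ler_normD (M r w - M (ratr p) w) (M (ratr p) w - M (ratr q) w).
  have := ler_normB (M r w - M (ratr p) w + (M (ratr p) w - M (ratr q) w)) (M r' w - M (ratr q) w).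
  rewrite (_ : M r w - _ + _ - _ = M r w - M r' w); last by ring.
  lra.
by rewrite leNgt (lt_le_trans q2 r'rho).
Qed.

(* The bounds deteriorate continuously after rho. *)
Let after_rho w : s <= rho w -> rho w < t -> exists2 dl : R, 0 < dl &
  forall x, s <= x -> x <= t -> x < rho w + dl ->
    `|M x w - M s w| <= e + 1 /\ A x w - A s w <= 2.
Proof.
move=> srho rhot.
have [dl1 d10 h1] := within_unif_continuous (@cM w) ltr01.
have [dl2 d20 h2] := within_unif_continuous (@cA w) ltr01.
exists (Num.min dl1 dl2); first by rewrite lt_min d10.
move=> x sx xt xd.
have x01 : 0 <= x <= 1 by rewrite (le_trans s0)//= (le_trans xt).
have [xr|rx] := leP x (rho w).
  split; first by rewrite (le_trans (before_M sx xt xr))// lerDl ler01.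
  by rewrite (le_trans (before_A sx xt xr))// ler1n.
have rho01 : 0 <= rho w <= 1 by rewrite (le_trans s0)//= rho_1.
have hd : `|x - rho w| < Num.min dl1 dl2.
  by rewrite gtr0_norm ?subr_gt0// ltrBlDl.
move: hd; rewrite lt_min => /andP[hd1 hd2].
have bM := before_M srho (ltW rhot) (lexx _).
have bA := before_A srho (ltW rhot) (lexx _).
have {}h1 := h1 x (rho w) x01 rho01 hd1; have {}h2 := h2 x (rho w) x01 rho01 hd2.
split.
  rewrite (_ : M x w - M s w = (M x w - M (rho w) w) + (M (rho w) w - M s w)); last by ring.
  by rewrite (le_trans (ler_normD _ _))// addrC lerD.
move: h2 => /(le_trans (ler_norm _)); lra.
Qed.

(* The event, known at time s, on which the values at times 0 and s are bounded
   by K and rho >= s. *)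
Let B_ : set T := ([set w | `|M 0 w| <= K] `&` [set w | `|M s w| <= K]) `&`
  ([set w | `|A s w| <= K] `&` [set w | s <= rho w]).

Let chi r : set T := B_ `&` [set w | r <= rho w].

(* The events C of the optional stopping lemma: the bounds that hold just after
   rho have not been exceeded up to time r. *)
Let C_ r : set T := \bigcap_(p in [set p : rat | s <= (ratr p : R) <= r])
  ([set w | `|M (ratr p) w - M s w| <= e + 1] `&` [set w | A (ratr p) w - A s w <= 2]).

Let F_ge_rho r : 0 <= r <= 1 -> F r [set w | r <= rho w].
Proof.
move=> r01; have := sigmaC (sF r01) (F_rho r01).
by congr (F r _); apply/seteqP; split => w /=; [move/negP; rewrite -leNgt|move=> h; apply/negP; rewrite -leNgt].
Qed.

Let in01 r : s <= r -> r <= t -> 0 <= r <= 1.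
Proof. by move=> sr rt; rewrite (le_trans s0)//= (le_trans rt). Qed.

Let norm_le r c (X : T -> R) : 0 <= r <= 1 -> meas_wrt (F r) X -> F r [set w | `|X w| <= c].
Proof.
by move=> r01 mX; apply: meas_wrt_le; [exact: sF|exact: measurableT_comp].
Qed.

Let F_B r : s <= r -> r <= t -> F r B_.
Proof.
move=> sr rt; have r01 := in01 sr rt; have [r0 r1] := andP r01.
have s01 : 0 <= s <= 1 by rewrite s0 (le_trans sr).
apply: sigmaI; first exact: sF.
  apply: sigmaI; first exact: sF.
    by apply: norm_le => //; apply: aM'.
  by apply: norm_le => //; apply: aM'.
apply: sigmaI; first exact: sF.
  by apply: norm_le => //; apply: aA'.
apply: (@incF s) => //; exact: F_ge_rho.
Qed.

Let F_chi r : s <= r -> r <= t -> F r (chi r).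
Proof.
move=> sr rt; apply: sigmaI; [exact/sF/in01|exact: F_B|exact/F_ge_rho/in01].
Qed.

Let F_C r : s <= r -> r <= t -> F r (C_ r).
Proof.
move=> sr rt; have r01 := in01 sr rt; have [r0 r1] := andP r01.
apply: sigma_bigcap; first exact: sF.
move=> p /= /andP[sp pr]; have p0 := le_trans s0 sp.
apply: sigmaI; first exact: sF.
  by apply: norm_le => //; apply: measurable_funB; exact: aM'.
by apply: meas_wrt_le; [exact: sF|apply: measurable_funB; exact: aA'].
Qed.

Let C_le r x w : C_ r w -> s <= x -> x <= r -> r <= t ->
  `|M x w - M s w| <= e + 1 /\ A x w - A s w <= 2.
Proof.
move=> Cw sx xr rt; have x1 : x <= 1 by rewrite (le_trans xr)// (le_trans rt).
split.
  apply: left_M => //; first by rewrite addr_ge0// ltW.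
  by move=> q sq qx; have [] // := Cw q; rewrite /= (ltW sq) (le_trans (ltW qx)).
apply: left_A => //.
by move=> q sq qx; have [] // := Cw q; rewrite /= (ltW sq) (le_trans (ltW qx)).
Qed.

Let C_near u v w : s <= u -> v <= t -> chi u w -> rho w < v ->
  exists2 dl : R, 0 < dl & forall r, rho w < r -> r < rho w + dl -> r <= v -> C_ r w.
Proof.
move=> su vt [[_ [_ /= srho]] _] rhov.
have [dl dl0 hdl] := after_rho srho (lt_le_trans rhov vt).
exists dl => // r rr rd rv p /= /andP[sp pr].
apply: hdl => //; first by rewrite (le_trans pr)// (le_trans rv).
exact: le_lt_trans rd.
Qed.

Let stop_generic (Z : R -> T -> R) K' u v E :
  (forall r, 0 <= r <= 1 -> L1 (Z r)) ->
  (forall r v E, 0 <= r -> r <= v -> v <= 1 -> F r E ->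
    mean (fun w => \1_E w * (Z v w - Z r w)) = 0) ->
  (forall w, {within `[0, 1], continuous (Z ^~ w)}) ->
  (forall r w, u <= r -> r <= v -> chi u w -> C_ r w -> `|Z r w| <= K') ->
  s <= u -> u <= v -> v <= t -> F u E ->
  let Y w := \1_(chi u `&` E) w * (Z (Num.min v (rho w)) w - Z u w) in
  L1 Y /\ mean Y = 0.
Proof.
move=> iZ mZ cZ bZ su uv vt FE.
have u0 := le_trans s0 su; have v1 := le_trans vt t1.
have ut := le_trans uv vt.
have rin r : u <= r <= v -> s <= r /\ r <= t.
  by move=> /andP[h1 h2]; split; [exact: le_trans h1|exact: le_trans h2 _].
apply: (@bounded_optional_stopping _ _ _ P F Z rho (chi u `&` E) C_ u v K') => //.
- by move=> r /rin[h1 h2]; apply: iZ; exact: in01.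
- move=> r E' /andP[h1 h2] FE'; apply: mZ => //; exact: le_trans h1.
- by move=> r /rin[h1 h2]; apply/F_rho/in01.
- by apply: sigmaI => //; [exact/sF/in01|exact: F_chi].
- by move=> w [[_ ]].
- by move=> r /rin[h1 h2]; exact: F_C.
- by move=> r w /andP[h1 h2] [cw _] Cw; exact: bZ.
- by move=> w [cw _]; exact: (C_near su vt cw).
Qed.

Let within_min (f : R -> R) c : 0 <= c <= 1 -> {within `[0, 1], continuous f} ->
  {within `[0, 1], continuous (fun r => f (Num.min r c))}.
Proof.
move=> /andP[c0 c1] cf; apply/subspace_continuousP => x /=; rewrite in_itv/= => x01.
apply/cvgrPdist_le => eps eps0; have [dl dl0 hdl] := within_unif_continuous cf eps0.
rewrite near_withinE; exists dl => //= y xy; rewrite in_itv/= => y01.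
have m01 z : 0 <= z <= 1 -> 0 <= Num.min z c <= 1.
  by move=> /andP[z0 z1]; rewrite le_min z0 c0/= ge_min z1.
apply: hdl; [exact: m01|exact: m01|].
apply: le_lt_trans xy.
have [xc|cx] := leP x c; have [yc|cy] := leP y c => //.
- rewrite ler0_norm ?subr_le0// ler0_norm; lra.
- rewrite ger0_norm ?subr_ge0// ger0_norm; lra.
- by rewrite subrr normr0.
Qed.

Let within_sub (f : R -> R) c : {within `[0, 1], continuous f} ->
  {within `[0, 1], continuous (fun r => f r - c)}.
Proof.
move=> cf; apply/subspace_continuousP => x x01.
by apply: cvgB; [exact: (subspace_continuousP _ _).1 cf x x01|exact: cvg_cst].
Qed.

(* increments over [u, v] of X stopped at rho and restricted to B_ *)
Let inc (X : R -> T -> R) u v w := \1_B_ w * (X (Num.min v (rho w)) w - X (Num.min u (rho w)) w).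

Let incE X u v E w : s <= u -> u <= v -> \1_E w * inc X u v w =
  \1_(chi u `&` E) w * (X (Num.min v (rho w)) w - X u w).
Proof.
move=> su uv; rewrite /inc mulrA -[\1_E w * _]/((\1_E \* \1_B_) w) -indicI.
have [ur|ru] := leP u (rho w).
  by congr (_ * _); rewrite !indicE; congr (_%:R); congr nat_of_bool; apply/idP/idP; rewrite !inE /chi /=; tauto.
rewrite min_r ?subrr ?mulr0; last exact/ltW/(lt_le_trans ru).
rewrite indicE memNset ?mul0r// => -[[_ /=]].
by rewrite leNgt ru.
Qed.

Let rho_chi u w : chi u w -> [/\ `|M 0 w| <= K, `|M s w| <= K, `|A s w| <= K, s <= rho w & u <= rho w].
Proof. by move=> [[[h1 h2] [h3 h4]] h5]. Qed.

Let incM_E u v E : s <= u -> u <= v -> v <= t -> F u E ->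
  L1 (fun w => \1_E w * inc M u v w) /\ mean (fun w => \1_E w * inc M u v w) = 0.
Proof.
move=> su uv vt FE.
have -> : (fun w => \1_E w * inc M u v w) =
    (fun w => \1_(chi u `&` E) w * (Z1 (Num.min v (rho w)) w - Z1 u w)).
  apply/funext => w; rewrite incE// /Z1.
  have [cw|ncw] := pselect (chi u w); last first.
    by rewrite indicE memNset ?mul0r// => -[].
  have [_ _ _ _ ur] := rho_chi cw.
  rewrite -minA (min_l (rho_tau1 w)) (_ : Num.min u (tau1 w) = u); last first.
    by rewrite min_l// (le_trans ur).
  by congr (_ * _); ring.
apply: (@stop_generic _ (e + 1 + K + K)) => //.
  by move=> w; apply: within_sub; apply: (@within_min (M ^~ w)) => //.
move=> r w ur rv cw Cw; rewrite /Z1.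
have [h1 h2 _ h4 h5] := rho_chi cw.
have [h6 _] : `|M (Num.min r (tau1 w)) w - M s w| <= e + 1 /\
    A (Num.min r (tau1 w)) w - A s w <= 2.
  apply: (C_le Cw); first by rewrite le_min (le_trans su)//= (le_trans h4).
    by rewrite ge_min lexx.
  exact: le_trans vt.
rewrite (_ : _ - M 0 w = M (Num.min r (tau1 w)) w - M s w + M s w - M 0 w); last by ring.
by rewrite (le_trans (ler_normB _ _))// lerD// (le_trans (ler_normD _ _))// lerD.
Qed.

Let incN_E u v E : s <= u -> u <= v -> v <= t -> F u E ->
  L1 (fun w => \1_E w * inc N u v w) /\ mean (fun w => \1_E w * inc N u v w) = 0.
Proof.
move=> su uv vt FE.
have -> : (fun w => \1_E w * inc N u v w) =
    (fun w => \1_(chi u `&` E) w * (Z2 (Num.min v (rho w)) w - Z2 u w)).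
  apply/funext => w; rewrite incE// /Z2.
  have [cw|ncw] := pselect (chi u w); last first.
    by rewrite indicE memNset ?mul0r// => -[].
  have [_ _ _ _ ur] := rho_chi cw.
  rewrite -minA (min_l (rho_tau2 w)) (_ : Num.min u (tau2 w) = u); last first.
    by rewrite min_l// (le_trans ur).
  by congr (_ * _); ring.
apply: (@stop_generic _ ((e + 1 + K) ^+ 2 + (2 + K) + K ^+ 2)) => //.
  move=> w; apply: within_sub; apply: (@within_min (N ^~ w)) => //.
  apply/subspace_continuousP => x x01; rewrite /N; apply: cvgB.
    have h := (subspace_continuousP _ _).1 (@cM w) x x01.
    exact: (cvg_comp _ _ h (@exprn_continuous R 2 (M x w))).
  exact: (subspace_continuousP _ _).1 (@cA w) x x01.
move=> r w ur rv cw Cw; rewrite /Z2 /N A0 subr0.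
have [h1 h2 h3 h4 h5] := rho_chi cw.
have sx : s <= Num.min r (tau2 w) by rewrite le_min (le_trans su)//= (le_trans h4).
have xr : Num.min r (tau2 w) <= r by rewrite ge_min lexx.
have rt : r <= t by exact: le_trans vt.
have [h6 h7] := C_le Cw sx xr rt.
have h8 : A s w <= A (Num.min r (tau2 w)) w.
  by apply: A_mono => //; rewrite (le_trans xr)// (le_trans rt).
set x := Num.min r (tau2 w) in h6 h7 h8 *.
have h9 : `|M x w| <= e + 1 + K.
  rewrite (_ : M x w = M x w - M s w + M s w); last by ring.
  by rewrite (le_trans (ler_normD _ _))// lerD.
have h10 : `|A x w| <= 2 + K.
  rewrite (_ : A x w = A x w - A s w + A s w); last by ring.
  by rewrite (le_trans (ler_normD _ _))// lerD// ger0_norm ?subr_ge0.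
rewrite (le_trans (ler_normB _ _))// lerD//; last exact: normX_le.
by rewrite (le_trans (ler_normB _ _))// lerD//; exact: normX_le.
Qed.

Variables (q : nat) (K0 : R).
Hypothesis HK : burkholder_constant q e K0.
Let n := q.+1.*2.
Let c : R := 'C(n, 2)%:R.

Let inc0 X u v w : u <= v -> ~ chi u w -> inc X u v w = 0.
Proof.
move=> uv nc; rewrite /inc; have [ur|ru] := leP u (rho w).
  by rewrite indicE memNset ?mul0r// => Bw; apply: nc.
by rewrite min_r ?subrr ?mulr0// ltW// (lt_le_trans ru).
Qed.

Let inc_chi X u w : s <= u -> chi u w -> inc X s u w = X u w - X s w.
Proof.
move=> su cw; have [Bw ur] := cw; have [_ _ _ sr _] := rho_chi cw.
by rewrite /inc indicE mem_set// mul1r !min_l.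
Qed.

Let inc_add X u v z w : inc X u v w + inc X v z w = inc X u z w.
Proof. by rewrite /inc -mulrDr; congr (_ * _); ring. Qed.

Let F_T u : s <= u -> u <= t -> F u setT.
Proof. by move=> su ut; apply: sigmaT; apply: sF; exact: in01. Qed.

Let L1_incM u v : s <= u -> u <= v -> v <= t -> L1 (inc M u v).
Proof.
move=> su uv vt; have [+ _] := incM_E su uv vt (F_T su (le_trans uv vt)).
by congr (integrable _ _ (EFin \o _)); apply/funext => w; rewrite indicT mul1r.
Qed.

Let L1_incN u v : s <= u -> u <= v -> v <= t -> L1 (inc N u v).
Proof.
move=> su uv vt; have [+ _] := incN_E su uv vt (F_T su (le_trans uv vt)).
by congr (integrable _ _ (EFin \o _)); apply/funext => w; rewrite indicT mul1r.
Qed.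

Let orthM u v h c' : s <= u -> u <= v -> v <= t -> meas_wrt (F u) h ->
  (forall w, `|h w| <= c') -> mean (fun w => h w * inc M u v w) = 0.
Proof.
move=> su uv vt mh hc; have u01 := in01 su (le_trans uv vt).
apply: (orthogonal_bounded (sF u01) _ (L1_incM su uv vt) _ mh hc).
  by move=> E; exact: mF.
by move=> E FE; case: (incM_E su uv vt FE).
Qed.

Let orthN u v h c' : s <= u -> u <= v -> v <= t -> meas_wrt (F u) h ->
  (forall w, `|h w| <= c') -> mean (fun w => h w * inc N u v w) = 0.
Proof.
move=> su uv vt mh hc; have u01 := in01 su (le_trans uv vt).
apply: (orthogonal_bounded (sF u01) _ (L1_incN su uv vt) _ mh hc).
  by move=> E; exact: mF.
by move=> E FE; case: (incN_E su uv vt FE).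
Qed.

(* M_u, clipped at a level that it cannot reach on B_ before rho: a bounded
   coefficient which is measurable with respect to F_u *)
Let k_ u w := clip `|K + e| (M u w).

(* M_v^2 - M_u^2 = (M_v - M_u)^2 + 2 M_u (M_v - M_u) expresses the bracket by
   martingale increments and the square of an increment. *)
Let incA_E u v w : s <= u -> u <= v -> v <= t -> inc A u v w =
  inc M u v w ^+ 2 + 2 * k_ u w * inc M u v w - inc N u v w.
Proof.
move=> su uv vt; have [cw|ncw] := pselect (chi u w); last first.
  by rewrite !inc0// expr0n/= !mulr0 subr0 addr0.
have [Bw ur] := cw; have [_ h2 _ sr _] := rho_chi cw.
have h3 := before_M su (le_trans uv vt) ur.
have kE : k_ u w = M u w.
  apply: clip_id; rewrite (_ : M u w = (M u w - M s w) + M s w); last by ring.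
  by rewrite (le_trans (ler_normD _ _))// addrC (le_trans (lerD h2 h3))// ler_norm.
by rewrite kE /inc indicE mem_set// !mul1r (min_l ur) /N; ring.
Qed.

Let meas_inT u : s <= u -> u <= t -> forall X : T -> R, meas_wrt (F u) X -> measurable_fun setT X.
Proof.
move=> su ut X mX; have u01 := in01 su ut.
by apply: (meas_wrt_measurable (sF u01) _ mX) => E; exact: mF.
Qed.

Let k_meas u : s <= u -> u <= t -> meas_wrt (F u) (k_ u).
Proof. by move=> su ut; apply: meas_wrt_clip; apply: aM; exact: in01. Qed.

Let m_incM u v : s <= u -> u <= v -> v <= t -> measurable_fun setT (inc M u v).
Proof. by move=> su uv vt; exact: L1_measurable (L1_incM su uv vt). Qed.

Let m_incA u v : s <= u -> u <= v -> v <= t -> measurable_fun setT (inc A u v).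
Proof.
move=> su uv vt; rewrite (_ : inc A u v = (fun w =>
  inc M u v w ^+ 2 + 2 * k_ u w * inc M u v w - inc N u v w)); last first.
  by apply/funext => w; exact: incA_E.
have mk := meas_inT su (le_trans uv vt) (k_meas su (le_trans uv vt)).
apply: measurable_funB; last exact: L1_measurable (L1_incN su uv vt).
apply: measurable_funD; first by apply: measurable_funX; exact: m_incM.
by apply: measurable_funM; [exact: measurable_funM|exact: m_incM].
Qed.

Let B_case w : B_ w \/ ~ B_ w. Proof. by have [] := pselect (B_ w); [left|right]. Qed.

Let inc_nB X u v w : ~ B_ w -> inc X u v w = 0.
Proof. by move=> nB; rewrite /inc indicE memNset// mul0r. Qed.

Let inc_B X u v w : B_ w -> inc X u v w = X (Num.min v (rho w)) w - X (Num.min u (rho w)) w.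
Proof. by move=> Bw; rewrite /inc indicE mem_set// mul1r. Qed.

Let min_rho u w : B_ w -> s <= u -> u <= t -> [/\ s <= Num.min u (rho w),
  Num.min u (rho w) <= t & Num.min u (rho w) <= rho w].
Proof.
move=> [_ [_ sr]] su ut; split; first by rewrite le_min su.
  by rewrite ge_min ut.
by rewrite ge_min lexx orbT.
Qed.

Let incM_small u v w : s <= u -> u <= v -> v <= t -> v - u < delta -> `|inc M u v w| <= eta.
Proof.
move=> su uv vt vd; have [Bw|nB] := B_case w; last by rewrite inc_nB// normr0 ltW.
rewrite inc_B// distrC.
have [h1 _ _] := min_rho Bw su (le_trans uv vt).
have [_ h2 h3] := min_rho Bw (le_trans su uv) vt.
apply: before_osc => //.
  by rewrite le_min !ge_min uv lexx orbT.
apply: le_lt_trans vd.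
have [] := leP v (rho w); have [] := leP u (rho w) => h4 h5 //.
- by have := lt_le_trans h4 (le_trans uv h5); rewrite ltxx.
- by rewrite lerD2r ltW.
- by rewrite subrr subr_ge0.
Qed.

Let incA_ge0 u v w : s <= u -> u <= v -> v <= t -> 0 <= inc A u v w.
Proof.
move=> su uv vt; have [Bw|nB] := B_case w; last by rewrite inc_nB.
have [h1 _ _] := min_rho Bw su (le_trans uv vt).
have [_ h2 h3] := min_rho Bw (le_trans su uv) vt.
rewrite inc_B// subr_ge0; apply: A_mono; first exact: le_trans h1.
  by rewrite le_min !ge_min uv lexx orbT.
exact: le_trans h2 _.
Qed.

Let incM_le u w : s <= u -> u <= t -> `|inc M s u w| <= e.
Proof.
move=> su ut; have [Bw|nB] := B_case w; last by rewrite inc_nB// normr0 ltW.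
have [h1 h2 h3] := min_rho Bw su ut.
by rewrite inc_B// (min_l (Bw.2.2 : s <= rho w)); exact: before_M.
Qed.

Let incA_le u w : s <= u -> u <= t -> inc A s u w <= Num.min (A u w - A s w) 1.
Proof.
move=> su ut; have [Bw|nB] := B_case w; last first.
  by rewrite inc_nB// le_min ler01 andbT subr_ge0 A_mono// (le_trans ut).
have [h1 h2 h3] := min_rho Bw su ut.
rewrite inc_B// (min_l (Bw.2.2 : s <= rho w)) le_min before_A// andbT lerD2r.
apply: A_mono; [exact: le_trans h1|by rewrite ge_min lexx|exact: le_trans t1].
Qed.

Let burk : mean (fun w => inc M s t w ^+ n) <=
  (2 * c) ^+ q.+1 * mean (fun w => inc A s t w ^+ q.+1) + K0 * eta.
Proof.
pose m := (Num.truncn ((t - s) / delta)).+1.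
have m0 : (0 : R) < m%:R by rewrite ltr0n.
have hm : (t - s) / m%:R < delta.
  by rewrite ltr_pdivrMr// mulrC -ltr_pdivrMr// truncnS_gt.
pose u (i : nat) := s + (t - s) * (i%:R / m%:R).
have u0 : u 0%N = s by rewrite /u mul0r mulr0 addr0.
have um : u m = t by rewrite /u divff ?gt_eqF// mulr1 addrC subrK.
have umono i j : (i <= j)%N -> u i <= u j.
  move=> ij; rewrite lerD2l; apply: ler_wpM2l; first by rewrite subr_ge0 ltW.
  by apply: ler_wpM2r; [rewrite invr_ge0 ltW|rewrite ler_nat].
have su i : s <= u i by rewrite -{1}u0 umono.
have ut i : (i <= m)%N -> u i <= t by move=> im; rewrite -[leRHS]um; exact: umono.
have uS i : u i <= u i.+1 by exact: umono.
have ud i : u i.+1 - u i < delta.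
  by rewrite (_ : u i.+1 - u i = (t - s) / m%:R)// /u -natr1; ring.
have sumE X i w : \sum_(j < i) inc X (u j) (u j.+1) w = inc X s (u i) w.
  elim: i => [|i IH]; last by rewrite big_ord_recr/= IH inc_add.
  by rewrite big_ord0 u0 /inc subrr mulr0.
have := HK (P := P) (m := m) (D := fun i => inc M (u i) (u i.+1))
  (B := fun i => inc A (u i) (u i.+1)) (eta := eta) (ltW eta0).
have -> : mean (fun w => (\sum_(j < m) inc M (u j) (u j.+1) w) ^+ q.+1.*2) =
    mean (fun w => inc M s t w ^+ n).
  by apply: eq_Rintegral => w _; rewrite sumE um.
have -> : mean (fun w => (\sum_(j < m) inc A (u j) (u j.+1) w) ^+ q.+1) =
    mean (fun w => inc A s t w ^+ q.+1).
  by apply: eq_Rintegral => w _; rewrite sumE um.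
rewrite -/n -/c.
(* On [chi (u i)], where rho has not been reached at time u i, the stopped past
   is the past itself and clipping does not change it; elsewhere the increment
   vanishes.  The clipped past is bounded and measurable with respect to the
   sigma-algebra at time u i, so that it is orthogonal to the increment. *)
pose hh a b i w := clip e (M (u i) w - M s w) ^+ a * clip 1 (A (u i) w - A s w) ^+ b.
have mhh a b i : (i < m)%N -> meas_wrt (F (u i)) (hh a b i).
  move=> im; have it := ut _ (ltnW im); have i1 := le_trans it t1.
  have i0 := le_trans s0 (su i).
  apply: measurable_funM; apply: measurable_funX; apply: meas_wrt_clip;
    apply: measurable_funB; by [exact: aM'|exact: aA'].
have bhh a b i w : `|hh a b i w| <= e ^+ a * 1 ^+ b.
  by rewrite normrM; apply: ler_pM => //; apply: normX_le; apply: clip_le => //; exact: ltW.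
have hE a b i w X v : (i < m)%N -> u i <= v ->
    (\sum_(j < i) inc M (u j) (u j.+1) w) ^+ a * (\sum_(j < i) inc A (u j) (u j.+1) w) ^+ b *
      inc X (u i) v w = hh a b i w * inc X (u i) v w.
  move=> im uv; rewrite !sumE; have [cw|ncw] := pselect (chi (u i) w); last first.
    by rewrite (@inc0 X)// !mulr0.
  have it := ut _ (ltnW im); have ur := cw.2.
  rewrite /hh !inc_chi// !clip_id//; last exact: before_M.
  rewrite ger0_norm; first exact: before_A.
  by rewrite subr_ge0 A_mono// (le_trans it).
apply.
- by move=> i im; apply: m_incM => //; exact: ut.
- by move=> i im; apply: m_incA => //; exact: ut.
- by move=> i w im; apply: incM_small => //; exact: ut.
- by move=> i w im; apply: incA_ge0 => //; exact: ut.
- by move=> i w im; rewrite sumE; apply: incM_le => //; exact: ut.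
- move=> w; rewrite sumE um (le_trans (incA_le _ _ _))//; first exact: ltW.
  by rewrite ge_min lexx orbT.
- move=> i a b im; under eq_Rintegral do rewrite hE//.
  by apply: orthM (mhh a b i im) (bhh a b i) => //; exact: ut.
move=> i a im.
have it := ut _ im; have it' := ut _ (ltnW im).
transitivity (mean (fun w => hh a 0%N i w * inc N (u i) (u i.+1) w -
    2 * hh a 0%N i w * k_ (u i) w * inc M (u i) (u i.+1) w)).
  apply: eq_Rintegral => w _.
  have h1 := @hE a 0%N i w M _ im (uS i); have h2 := @hE a 0%N i w N _ im (uS i).
  rewrite !expr0 !mulr1 in h1 h2.
  rewrite incA_E// -h2.
  rewrite (_ : 2 * _ * _ * _ = 2 * k_ (u i) w * (hh a 0%N i w * inc M (u i) (u i.+1) w)); last by ring.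
  by rewrite -h1; ring.
have mk : meas_wrt (F (u i)) (fun w => 2 * hh a 0%N i w * k_ (u i) w).
  apply: measurable_funM; last exact: k_meas.
  by apply: measurable_funM; [exact: measurable_cst|exact: mhh].
have bk w : `|2 * hh a 0%N i w * k_ (u i) w| <= 2 * (e ^+ a * 1 ^+ 0) * `|K + e|.
  rewrite normrM; apply: ler_pM => //; last exact: clip_le.
  by rewrite normrM (ger0_norm (ler0n R 2)) ler_wpM2l.
have mh := mhh a 0%N i im.
rewrite expB; last 2 first.
- by apply: (L1M _ (bhh a 0%N i)); [exact: meas_inT mh|exact: L1_incN].
- by apply: (L1M _ bk); [exact: meas_inT mk|exact: L1_incM].
rewrite (orthN _ _ _ mh (bhh a 0%N i))// (orthM _ _ _ mk bk)// subrr//.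
Qed.

Let U : set T := [set w | exists p : rat, [/\ s <= ratr p, ratr p <= t &
  e < `|M (ratr p) w - M s w|]].

Let Osc : set T := [set w | exists p p' : rat, [/\ s <= ratr p, ratr p <= (ratr p' : R),
  ratr p' <= t, ratr p' - ratr p < delta & eta < `|M (ratr p) w - M (ratr p') w|]].

Let F_U : F t U.
Proof.
have t0 : 0 <= t by apply: le_trans s0 (ltW st).
have sG : sigma_algebra setT (F t) by apply: sF; rewrite t0.
have -> : U = \bigcup_(p in [set p : rat | s <= (ratr p : R) <= t])
    [set w | e < `|M (ratr p) w - M s w|].
  apply/seteqP; split => w /=; first by move=> [p [h1 h2 h3]]; exists p => //=; rewrite h1.
  by move=> [p /= /andP[h1 h2] h3]; exists p.
apply: sigma_bigcup => // p /= /andP[h1 h2].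
apply: meas_wrt_gt => //; apply: measurableT_comp => //; apply: measurable_funB.
  by apply: aM' => //; exact: le_trans h1.
by apply: aM' => //; exact: ltW.
Qed.

Let F_Osc : F t Osc.
Proof.
have t0 : 0 <= t by apply: le_trans s0 (ltW st).
have sG : sigma_algebra setT (F t) by apply: sF; rewrite t0.
have -> : Osc = \bigcup_(p in [set p : rat | s <= (ratr p : R)])
  \bigcup_(p' in [set p' : rat | [/\ ratr p <= (ratr p' : R), ratr p' <= t &
      ratr p' - ratr p < delta]])
    [set w | eta < `|M (ratr p) w - M (ratr p') w|].
  apply/seteqP; split => w /=.
    by move=> [p [p' [h1 h2 h3 h4 h5]]]; exists p => //=; exists p'.
  by move=> [p /= h1 [p' /= [h2 h3 h4] h5]]; exists p, p'.
apply: sigma_bigcup => // p /= h1; apply: sigma_bigcup => // p' /= [h2 h3 h4].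
have p0 := le_trans s0 h1; have p'0 := le_trans p0 h2.
apply: meas_wrt_gt => //; apply: measurableT_comp => //; apply: measurable_funB.
  by apply: aM' => //; exact: le_trans h3.
exact: aM'.
Qed.

(* The exceptional event: the localizing times have not reached 1, some value
   at time 0 or s exceeds K, or M oscillates by eta within a time delta. *)
Let Exc : set T := ([set w | tau1 w < 1] `|` [set w | tau2 w < 1]) `|`
  (([set w | K < `|M 0 w|] `|` [set w | K < `|M s w|]) `|`
  ([set w | K < `|A s w|] `|` Osc)).

(* Off the exceptional event, if M moves by more than e then rho is reached
   before time t, and it can only be so because M has moved by e or its bracket
   has grown by 1: by continuity this is then true at time rho itself.  The
   event is thus detected by the stopped processes. *)
Let stop_cases w : U w -> ~ Exc w ->
  1 <= (e ^+ n)^-1 * inc M s t w ^+ n + inc A s t w ^+ q.+1.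
Proof.
move=> [p [sp pt ep]] nE.
have tau1E : tau1 w = 1.
  apply/eqP; rewrite eq_le; have /andP[_ ->] := tau1_01 w; rewrite /= leNgt.
  by apply/negP => h; apply: nE; left; left.
have tau2E : tau2 w = 1.
  apply/eqP; rewrite eq_le; have /andP[_ ->] := tau2_01 w; rewrite /= leNgt.
  by apply/negP => h; apply: nE; left; right.
have rp : rho w <= ratr p.
  by apply: rho_le; constructor 3; exists p; split => //; constructor 1.
have rt : rho w <= t by exact: le_trans pt.
have sr : s <= rho w.
  apply: lb_le_inf; first exact: (bt_inf w).1.
  move=> x [->|->|[p' [_ + _ _]]//]; rewrite ?tau1E ?tau2E; exact: le_trans (ltW st) t1.
have Bw : B_ w.
  split; split => //=; rewrite leNgt; apply/negP => h; apply: nE.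
  - by right; left; left.
  - by right; left; right.
  - by right; right; left.
have iM : inc M s t w = M (rho w) w - M s w by rewrite inc_B// min_r// min_l.
have iA : inc A s t w = A (rho w) w - A s w by rewrite inc_B// min_r// min_l.
have iA0 := incA_ge0 w (lexx s) (ltW st) (lexx t).
have nE0 : n = (q.+1 * 2)%N by rewrite muln2.
suff [h|h] : e <= `|inc M s t w| \/ 1 <= inc A s t w.
- apply: ler_wpDr; first exact: exprn_ge0.
  rewrite mulrC ler_pdivlMr ?exprn_gt0// mul1r nE0 mulnC !exprM.
  apply: lerXn2r; rewrite ?nnegrE ?sqr_ge0//.
  by rewrite -(real_normK (num_real (inc M s t w))) lerXn2r ?nnegrE// ltW.
- apply: ler_wpDl; last by rewrite exprn_ege1.
  apply: mulr_ge0; first by rewrite invr_ge0 exprn_ge0// ltW.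
  by rewrite nE0 mulnC exprM exprn_ge0// sqr_ge0.
apply: contrapT => /not_orP[/negP + /negP]; rewrite -!ltNge iM iA => hM hA.
have rlp : rho w < ratr p.
  rewrite lt_neqAle rp andbT; apply/eqP => E.
  by move: ep; rewrite -E ltNge (ltW hM).
have r01 : 0 <= rho w <= 1 by rewrite (le_trans s0)//= rho_1.
have cM0 : 0 < e - `|M (rho w) w - M s w| by rewrite subr_gt0.
have cA0 : 0 < 1 - (A (rho w) w - A s w) by rewrite subr_gt0.
have [d1 d10 h1] := within_unif_continuous (@cM w) cM0.
have [d2 d20 h2] := within_unif_continuous (@cA w) cA0.
have : rho w < Num.min (ratr p) (Num.min (rho w + d1) (rho w + d2)).
  by rewrite !lt_min rlp !ltrDl d10 d20.
move=> /rho_lt[x + ]; rewrite !lt_min => bx /and3P[xp xd1 xd2].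
have p1 : ratr p <= 1 :> R by exact: le_trans t1.
have rx := rho_le bx.
have x01 : 0 <= x <= 1.
  by rewrite (le_trans _ rx) ?(le_trans s0)//= (le_trans (ltW xp)).
have xr1 : `|rho w - x| < d1 by rewrite distrC ger0_norm ?subr_ge0// ltrBlDl.
have xr2 : `|rho w - x| < d2 by rewrite distrC ger0_norm ?subr_ge0// ltrBlDl.
have {}h1 := h1 _ _ r01 x01 xr1; have {}h2 := h2 _ _ r01 x01 xr2.
case: bx => [xE|xE|[p' [xE sx xt []]]].
- by move: xp; rewrite xE tau1E ltNge p1.
- by move: xp; rewrite xE tau2E ltNge p1.
- apply/negP; rewrite -leNgt.
  rewrite (_ : M x w - M s w = (M (rho w) w - M s w) - (M (rho w) w - M x w)); last by ring.
  by rewrite (le_trans (ler_normB _ _))// addrC -lerBrDr.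
- apply/negP; rewrite -leNgt.
  move: h2; rewrite distrC => /(le_trans (ler_norm _)).
  by rewrite lerBrDr addrA subrK.
- move=> [p'' [h3 h4 h5 h6]]; apply: nE; right; right; right; exists p'', p'.
  by rewrite -xE.
Qed.

(** Markov's inequality for the bound of [stop_cases], whose expectation is
    controlled by the Burkholder inequality.  The additional 1 in the constant
    accounts for the event that the bracket grows by 1, and the sum in
    parentheses for the exceptional event. *)
Lemma maximal_inequality_fixed :
  measurable Osc /\
  mean (\1_U) <= ((e ^+ n)^-1 * (2 * c) ^+ q.+1 + 1) *
      mean (fun w => Num.min (A t w - A s w) 1 ^+ q.+1)
    + (e ^+ n)^-1 * K0 * eta
    + (mean (\1_[set w | tau1 w < 1]) + mean (\1_[set w | tau2 w < 1])
    + (mean (\1_[set w | K < `|M 0 w|]) + mean (\1_[set w | K < `|M s w|])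
    + (mean (\1_[set w | K < `|A s w|]) + mean (\1_Osc)))).
Proof.
have t0 : 0 <= t by apply: le_trans s0 (ltW st).
have t01 : 0 <= t <= 1 by rewrite t0.
have s01 : 0 <= s <= 1 by rewrite s0 (le_trans (ltW st)).
have sG := sF t01; have mG := @mF t _ t01.
have mM r : 0 <= r -> r <= t -> measurable_fun setT (M r).
  by move=> r0 rt; apply: (meas_wrt_measurable sG mG); exact: aM'.
have mA r : 0 <= r -> r <= t -> measurable_fun setT (A r).
  by move=> r0 rt; apply: (meas_wrt_measurable sG mG); exact: aA'.
have tauT tau : stopping_time F tau -> measurable [set w | tau w < 1].
  by move=> stau; apply: (@mF 1); rewrite ?ler01 ?lexx//; apply: tau_lt; rewrite // ler01 lexx.
have gtT X : meas_wrt (F t) X -> measurable [set w | K < `|X w|].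
  by move=> mX; apply: mG; apply: meas_wrt_gt => //; exact: measurableT_comp.
have m1 := tauT _ st1; have m2 := tauT _ st2.
have m3 : measurable [set w | K < `|M 0 w|] by apply: gtT; exact: aM'.
have m4 : measurable [set w | K < `|M s w|] by apply: gtT; apply: aM' => //; exact: ltW.
have m5 : measurable [set w | K < `|A s w|] by apply: gtT; apply: aA' => //; exact: ltW.
have mO : measurable Osc by exact: mG F_Osc.
have mExc : measurable Exc by repeat apply: measurableU.
split => //.
have mU : measurable U by exact: mG F_U.
have L1i := @L1_indic _ _ _ P.
apply: (@le_trans _ _ (((e ^+ n)^-1 * (2 * c) ^+ q.+1 + 1) *
      mean (fun w => Num.min (A t w - A s w) 1 ^+ q.+1)
    + (e ^+ n)^-1 * K0 * eta + mean (\1_Exc))); last first.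
  rewrite lerD2l; apply: (le_trans (mean_indicU _ _ _)).
  - exact: measurableU.
  - by repeat apply: measurableU.
  apply: lerD; first exact: mean_indicU.
  apply: (le_trans (mean_indicU _ _ _)); [exact: measurableU|exact: measurableU|].
  by apply: lerD; exact: mean_indicU.
have iM : L1 (fun w => inc M s t w ^+ n).
  apply: (@bounded_L1 _ _ _ _ _ (e ^+ n)).
    by apply: measurable_funX; apply: m_incM => //; exact: ltW.
  by move=> w; apply: normX_le; apply: incM_le => //; exact: ltW.
have A01 w : 0 <= inc A s t w <= Num.min (A t w - A s w) 1.
  by rewrite incA_ge0 ?(ltW st)//= incA_le// ltW.
have iA : L1 (fun w => inc A s t w ^+ q.+1).
  apply: (@bounded_L1 _ _ _ _ _ (1 ^+ q.+1)).
    by apply: measurable_funX; apply: m_incA => //; exact: ltW.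
  move=> w; apply: normX_le; have /andP[a0 a1] := A01 w; rewrite ger0_norm//.
  by rewrite (le_trans a1)// ge_min lexx orbT.
have imin : L1 (fun w => Num.min (A t w - A s w) 1 ^+ q.+1).
  apply: (@bounded_L1 _ _ _ _ _ (1 ^+ q.+1)).
    apply: measurable_funX; apply: measurable_minr => //; apply: measurable_funB.
      exact: mA.
    by apply: mA => //; exact: ltW.
  move=> w; apply: normX_le; have /andP[a0 a1] := A01 w.
  by rewrite ger0_norm ?(le_trans a0)// ge_min lexx orbT.
have iMz := L1Z ((e ^+ n)^-1) iM.
have h1 : mean (\1_U) <= mean (fun w => ((e ^+ n)^-1 * inc M s t w ^+ n +
    inc A s t w ^+ q.+1) + \1_Exc w).
  apply: exp_le; [exact: L1i|by apply: L1D; [exact: L1D|exact: L1i]|].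
  move=> w; have i0 : 0 <= (e ^+ n)^-1 * inc M s t w ^+ n + inc A s t w ^+ q.+1.
    have /andP[a0 _] := A01 w.
    apply: addr_ge0; last exact: exprn_ge0.
    apply: mulr_ge0; first by rewrite invr_ge0 exprn_ge0// ltW.
    by rewrite /n -muln2 mulnC exprM exprn_ge0// sqr_ge0.
  have j0 (E : set T) : 0 <= \1_E w :> R by rewrite indicE.
  have [Uw|nU] := pselect (U w); last by rewrite indicE memNset// addr_ge0.
  rewrite indicE mem_set//.
  have [Ew|nE] := pselect (Exc w); first by rewrite indicE mem_set// lerDr.
  by apply: ler_wpDr => //; exact: stop_cases.
apply: (le_trans h1).
rewrite (expD (L1D iMz iA) (L1i _ mExc)) (expD iMz iA) (expZ _ iM) lerD2r.
have h2 : mean (fun w => inc A s t w ^+ q.+1) <=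
    mean (fun w => Num.min (A t w - A s w) 1 ^+ q.+1).
  apply: exp_le => // w; have /andP[a0 a1] := A01 w.
  by apply: lerXn2r; rewrite ?nnegrE// (le_trans a0).
have en0 : 0 <= (e ^+ n)^-1 by rewrite invr_ge0 exprn_ge0// ltW.
have h3 := ler_wpM2l en0 burk.
have c20 : 0 <= (e ^+ n)^-1 * (2 * c) ^+ q.+1.
  by rewrite mulr_ge0// exprn_ge0// mulr_ge0.
have h4 := ler_wpM2l c20 h2.
move: h2 h3 h4; set X := Rintegral P _ _; set Y := Rintegral P _ _.
set Z := Rintegral P _ _; set cc := (2 * c) ^+ _; set ee := _^-1.
rewrite mulrDr !mulrA mulrDl mul1r; lra.
Qed.

End maximal_inequality_fixed.

Section maximal_inequality.
Context d (T : measurableType d) (R : realType) (P : probability T R).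
Local Notation L1 X := (P.-integrable [set: T] (EFin \o X)).
Local Notation mean X := (Rintegral P [set: T] X).
Variables (F : R -> set_system T) (M A : R -> T -> R) (tau1 tau2 : nat -> T -> R).
Hypothesis fF : filtration F.
Hypothesis aM : forall t, 0 <= t <= 1 -> meas_wrt (F t) (M t).
Hypothesis aA : forall t, 0 <= t <= 1 -> meas_wrt (F t) (A t).
Hypothesis cM : forall w, {within `[0, 1], continuous (M ^~ w)}.
Hypothesis cA : forall w, {within `[0, 1], continuous (A ^~ w)}.
Hypothesis A_mono : forall w r v, 0 <= r -> r <= v -> v <= 1 -> A r w <= A v w.
Hypothesis A0 : forall w, A 0 w = 0.
Hypothesis st1 : forall n, stopping_time F (tau1 n).
Hypothesis st2 : forall n, stopping_time F (tau2 n).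
Hypothesis tail1 : forall c, 0 < c -> exists n, mean (\1_[set w | tau1 n w < 1]) <= c.
Hypothesis tail2 : forall c, 0 < c -> exists n, mean (\1_[set w | tau2 n w < 1]) <= c.
Let N t w := M t w ^+ 2 - A t w.
Let Z1 n r w := M (Num.min r (tau1 n w)) w - M 0 w.
Let Z2 n r w := N (Num.min r (tau2 n w)) w - N 0 w.
Hypothesis iZ1 : forall n r, 0 <= r <= 1 -> L1 (Z1 n r).
Hypothesis iZ2 : forall n r, 0 <= r <= 1 -> L1 (Z2 n r).
Hypothesis mart1 : forall n r v E, 0 <= r -> r <= v -> v <= 1 -> F r E ->
  mean (fun w => \1_E w * (Z1 n v w - Z1 n r w)) = 0.
Hypothesis mart2 : forall n r v E, 0 <= r -> r <= v -> v <= 1 -> F r E ->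
  mean (fun w => \1_E w * (Z2 n v w - Z2 n r w)) = 0.
Variables (s t e : R) (q : nat) (K0 : R).
Hypotheses (s0 : 0 <= s) (st : s < t) (t1 : t <= 1) (e0 : 0 < e).
Hypothesis K00 : 0 <= K0.
Hypothesis HK : burkholder_constant q e K0.
Let n := q.+1.*2.
Let c : R := 'C(n, 2)%:R.

(** The error terms of [maximal_inequality_fixed] vanish when tau1 and tau2 tend
    to 1 and K to infinity, then eta to 0, then delta to 0 by uniform continuity
    of the paths. *)
Lemma maximal_inequality :
  mean (\1_[set w | exists p : rat, [/\ s <= ratr p, ratr p <= t &
    e < `|M (ratr p) w - M s w|]])
  <= ((e ^+ n)^-1 * (2 * c) ^+ q.+1 + 1) *
      mean (fun w => Num.min (A t w - A s w) 1 ^+ q.+1).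
Proof.
pose fixed_ n1 n2 := @maximal_inequality_fixed _ T R P F M A (tau1 n1) (tau2 n2) fF
  aM aA cM cA A_mono A0 (st1 n1) (st2 n2) (iZ1 n1) (iZ2 n2) (mart1 n1) (mart2 n2) s t e.
have sF r : 0 <= r <= 1 -> sigma_algebra setT (F r).
  by move=> r01; case: fF => h _ _; apply: h; rewrite in_itv.
have mF r E : 0 <= r <= 1 -> F r E -> measurable E.
  by move=> r01; case: fF => _ h _; apply: h; rewrite in_itv.
have s01 : 0 <= s <= 1 by rewrite s0 (le_trans (ltW st)).
have z01 : 0 <= (0 : R) <= 1 by rewrite lexx ler01.
have van r (X : T -> R) : 0 <= r <= 1 -> meas_wrt (F r) X -> forall eps : R, 0 < eps ->
    exists k0, forall k, (k0 <= k)%N -> mean (\1_[set w | k%:R < `|X w|]) <= eps.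
  move=> r01 mX; apply: mean_indic_vanish.
    move=> k; apply: (mF r) => //; apply: meas_wrt_gt; first exact: sF.
    exact: measurableT_comp.
  move=> w; exists (Num.truncn `|X w|).+1 => k kk /=; apply/negP; rewrite -leNgt.
  by rewrite (le_trans (ltW (truncnS_gt _)))// ler_nat.
apply/ler_addgt0Pr => eps eps0.
have eps8 : 0 < eps / 8 by rewrite divr_gt0.
(* eta is chosen before delta = 1/(j+1), which depends on it. *)
pose L := (e ^+ n)^-1 * K0.
have L0 : 0 <= L by rewrite mulr_ge0// invr_ge0 exprn_ge0// ltW.
pose eta := (eps / 8) / (L + 1).
have L1' : 0 < L + 1 by rewrite ltr_wpDl.
have eta0 : 0 < eta by rewrite divr_gt0.
have Leta : L * eta <= eps / 8.
  by rewrite mulrA ler_pdivrMr// mulrDr mulr1 mulrC lerDl ltW.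
have [n1 h1] := tail1 eps8; have [n2 h2] := tail2 eps8.
have [k1 hk1] := van _ _ z01 (aM z01) _ eps8.
have [k2 hk2] := van _ _ s01 (aM s01) _ eps8.
have [k3 hk3] := van _ _ s01 (aA s01) _ eps8.
pose k := maxn k1 (maxn k2 k3).
have kk1 : (k1 <= k)%N by rewrite leq_maxl.
have kk2 : (k2 <= k)%N by rewrite !leq_max leqnn orbT.
have kk3 : (k3 <= k)%N by rewrite !leq_max leqnn !orbT.
pose Osc (j : nat) : set T := [set w | exists p p' : rat, [/\ s <= ratr p,
  ratr p <= (ratr p' : R), ratr p' <= t, ratr p' - ratr p < j.+1%:R^-1 :> R &
  eta < `|M (ratr p) w - M (ratr p') w|]].
have j0 j : 0 < j.+1%:R^-1 :> R by rewrite invr_gt0.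
have fx j := fixed_ n1 n2 eta (j.+1%:R^-1) k%:R s0 st t1 e0 eta0 (j0 j) q K0 HK.
have [j hj] : exists k0, forall k, (k0 <= k)%N -> mean (\1_(Osc k)) <= eps / 8.
  apply: mean_indic_vanish => //; first by move=> j; case: (fx j).
  move=> w; have [dl dl0 hdl] := within_unif_continuous (@cM w) eta0.
  exists (Num.truncn dl^-1).+1 => j jj [p [p' [h3 h4 h5 h6]]].
  apply/negP; rewrite -leNgt; apply: hdl.
  - by rewrite (le_trans s0)//= (le_trans h4)// (le_trans h5).
  - by rewrite (le_trans s0) ?(le_trans h3)//= (le_trans h5).
  rewrite distrC ger0_norm ?subr_ge0//; apply: (lt_trans h6).
  rewrite -[ltRHS]invrK ltf_pV2 ?posrE ?invr_gt0//.
  by rewrite (lt_le_trans (truncnS_gt _))// ler_nat (leq_trans jj).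
have [_ /le_trans] := fx j; apply.
rewrite -/n -/c -/L -addrA lerD2l.
have := hk1 k kk1; have := hk2 k kk2; have := hk3 k kk3; have := hj j (leqnn j).
rewrite /Osc; move: h1 h2 Leta eps0; set x1 := Rintegral _ _ _; set x2 := Rintegral _ _ _.
set x3 := Rintegral _ _ _; set x4 := Rintegral _ _ _; set x5 := Rintegral _ _ _.
set x6 := Rintegral _ _ _; lra.
Qed.

End maximal_inequality.

(** * Measurability and continuity of the given processes *)

Section adaptedness.
Context d (T : measurableType d) (R : realType).
Variables (F : R -> set_system T) (Z : R -> T -> R) (t : R).
Hypothesis pZ : progressively_measurable F Z.
Hypothesis t01 : 0 <= t <= 1.

Lemma progressive_adapted : meas_wrt (F t) (Z t).
Proof.
have t01' : t \in `[0, 1] by rewrite in_itv.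
have mZ := pZ t01'; case/andP: t01 => t0 t1.
pose g : g_sigma_algebraType (F t) -> R * g_sigma_algebraType (F t) := fun w => (t, w).
apply: (measurable_comp _ _ mZ (g := g)).
- by apply: measurableX => //; exact: measurable_itv.
- by move=> _ [w _ <-]; split => //=; rewrite in_itv/= t0 lexx.
- by apply/measurable_fun_pairP; split; [exact: measurable_cst|exact: measurable_id].
Qed.

(** Fubini's theorem for the restriction of Z to [0, t] x T with the
    sigma-algebra F_t on T. *)
Lemma progressive_time_integral : meas_wrt (F t) (time_integral Z t).
Proof.
have t01' : t \in `[0, 1] by rewrite in_itv.
have mZ := pZ t01'.
pose S := g_sigma_algebraType (F t).
pose D : set (R * S) := `[0, t] `*` [set: T].
pose f : R * S -> \bar R := (fun z => (Z z.1 z.2)%:E) \_ D.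
have mD : measurable D by apply: measurableX => //; exact: measurable_itv.
have mf : measurable_fun setT f.
  have mZ' : measurable_fun D (EFin \o (fun z : R * S => Z z.1 z.2)).
    by apply/measurable_EFinP; exact: mZ.
  exact: (measurable_restrictT _ mD).1 mZ'.
have mp := @measurable_fun_fubini_tonelli_G _ _ (measurableTypeR R) S R lebesgue_measure _
  (measurable_funepos mf) (fun x => funepos_ge0 f x).
have mn := @measurable_fun_fubini_tonelli_G _ _ (measurableTypeR R) S R lebesgue_measure _
  (measurable_funeneg mf) (fun x => funeneg_ge0 f x).
rewrite /meas_wrt (_ : time_integral Z t = (fun w : S =>
    fine (fubini_G lebesgue_measure f^\+ w - fubini_G lebesgue_measure f^\- w)%E)).
  by apply: measurableT_comp => //; exact: emeasurable_funB.
apply/funext => w; rewrite /time_integral /Rintegral; congr fine.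
rewrite integral_mkcond integralE /fubini_G; congr (_ - _)%E.
  apply: eq_integral => s _; rewrite !funeposE /f !patchE; congr (maxe _ _).
  congr (if _ then _ else _).
  by apply/idP/idP; rewrite !inE /D /=; tauto.
apply: eq_integral => s _; rewrite !funenegE /f !patchE; congr (maxe (- _) _)%E.
congr (if _ then _ else _).
by apply/idP/idP; rewrite !inE /D /=; tauto.
Qed.

End adaptedness.

Section time_integral_paths.
Variables (R : realType) (f : R -> R).
Hypothesis intf : lebesgue_measure.-integrable `[0, 1] (fun t => (f t)%:E).
Local Notation I x := (\int[lebesgue_measure]_(s in `[0, x]) f s).

Lemma integral_path_continuous : {within `[0, 1], continuous (fun x => I x)}.
Proof. exact: (@parameterized_integral_continuous R 0 1 f ler01 intf). Qed.

Lemma integral_path_0 : I 0 = 0.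
Proof. by rewrite set_itv1 Rintegral_set1. Qed.

Lemma integral_path_increment (x y : R) : 0 <= x -> x <= y -> y <= 1 ->
  I y - I x = \int[lebesgue_measure]_(s in `]x, y]) f s.
Proof.
move=> x0 xy y1; rewrite (@Rintegral_itvB R f (BLeft 0) (BRight y) x)//.
  apply: integrableS intf => //; apply: subset_itvl; rewrite bnd_simp//.
Qed.

End time_integral_paths.

Section null_sets.
Context d (T : measurableType d) (R : realType) (P : probability T R).
Local Notation L1 X := (P.-integrable [set: T] (EFin \o X)).
Local Notation mean X := (Rintegral P [set: T] X).
Variable Om : set T.
Hypothesis mOm : measurable Om.
Hypothesis POm : P (~` Om) = 0%E.

Lemma mean_full (X : T -> R) : L1 X -> mean (fun w => \1_Om w * X w) = mean X.
Proof.
move=> iX; rewrite /Rintegral; congr fine; apply: ae_eq_integral => //.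
- exact: measurable_int (L1_indicM mOm iX).
- exact: measurable_int iX.
exists (~` Om); split => //; first exact: measurableC.
by move=> w /= h Ow; apply: h => _; rewrite indicE mem_set// mul1r.
Qed.

(** The paths have the required properties only on an event Om of full
    probability, which need not belong to any F_t.  The processes are multiplied
    by the indicator of Om, and the filtration is enlarged to the measurable
    events that coincide on Om with an event of F_t. *)
Definition trace_filtration (F : R -> set_system T) (t : R) : set_system T :=
  [set B | measurable B /\ exists2 B', F t B' & B `&` Om = B' `&` Om].

Lemma trace_filtrationP F : filtration F -> filtration (trace_filtration F).
Proof.
move=> [sF mF incF]; split => [t t01|t t01 B []//|r t r0 rt t1 B [mB [B' FB' BB']]].
  have sG := sF t t01; split.
  - by split => //; exists set0 => //; case: sG.
  - move=> A [mA [A' FA' AA']]; split; first by rewrite setTD; exact: measurableC.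
    exists (~` A'); first exact: sigmaC.
    rewrite setTD; apply/seteqP; split => w [/= nA Ow]; split => //= h; apply: nA.
      by have [] : (A `&` Om) w by rewrite AA'.
    by have [] : (A' `&` Om) w by rewrite -AA'.
  - move=> A hA; split; first by apply: bigcup_measurable => k _; case: (hA k).
    have /choice[A' hA'] : forall k, exists B', F t B' /\ A k `&` Om = B' `&` Om.
      by move=> k; case: (hA k) => _ [B' h1 h2]; exists B'.
    exists (\bigcup_k A' k); first by case: sG => _ _; apply => k; case: (hA' k).
    by rewrite !setI_bigcupl; apply: eq_bigcupr => k _; case: (hA' k).
by split => //; exists B' => //; exact: incF FB'.
Qed.

Lemma sub_trace F t : filtration F -> 0 <= t <= 1 -> F t `<=` trace_filtration F t.
Proof. by move=> [_ mF _] t01 B FB; split; [apply: mF FB; rewrite in_itv|exists B]. Qed.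

Lemma trace_meas F t (X : T -> R) : filtration F -> 0 <= t <= 1 -> meas_wrt (F t) X ->
  meas_wrt (trace_filtration F t) (fun w => \1_Om w * X w).
Proof.
move=> fF t01 mX; have [sF mF _] := fF; have t01' : t \in `[0, 1] by rewrite in_itv.
have sG := sF _ t01'; have [sG' _ _] := trace_filtrationP fF.
apply: meas_wrtP => [|S mS]; first exact: sG'.
have mXT := meas_wrt_measurable sG (mF _ t01') mX.
split.
  rewrite -[X in measurable X]setTI.
  by apply: measurable_funM => //; exact: measurable_indic.
exists (X @^-1` S); first exact: (meas_wrt_preimage sG mX).
apply/seteqP; split => w /= [+ Ow]; rewrite indicE mem_set// mul1r; by split.
Qed.

Lemma stopping_trace F tau : filtration F -> stopping_time F tau ->
  stopping_time (trace_filtration F) tau.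
Proof.
by move=> fF [h1 h2]; split => // t t01; apply: sub_trace => //; exact: h2.
Qed.

(** A null set does not change expectations, so enlarging the filtration
    preserves martingales. *)
Lemma martingale_trace F Z : filtration F -> martingale P F Z ->
  (forall r, 0 <= r <= 1 -> L1 (fun w => \1_Om w * Z r w)) /\
  (forall r v E, 0 <= r -> r <= v -> v <= 1 -> trace_filtration F r E ->
    mean (fun w => \1_E w * (\1_Om w * Z v w - \1_Om w * Z r w)) = 0).
Proof.
move=> fF [_ iZ mZ].
have iZ' r : 0 <= r <= 1 -> L1 (Z r) by move=> r01; apply: iZ; rewrite in_itv.
split => [r r01|r v E r0 rv v1 [mE [E' FE' EE']]].
  by apply: L1_indicM => //; exact: iZ'.
have r01 : 0 <= r <= 1 by rewrite r0 (le_trans rv).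
have v01 : 0 <= v <= 1 by rewrite (le_trans r0).
have mE' : measurable E' by case: fF => _ mF _; apply: (mF r) FE'; rewrite in_itv.
transitivity (mean (fun w => \1_Om w * (\1_E' w * (Z v w - Z r w)))).
  apply: eq_Rintegral => w _; rewrite -mulrBr !mulrA; congr (_ * _).
  rewrite -[LHS]/((\1_E \* \1_Om) w) -indicI EE' indicI /=.
  by rewrite mulrC.
rewrite mean_full; last by apply: L1_indicM => //; apply: L1B; exact: iZ'.
have [_ _ /(_ _ FE') h] := mZ r v r0 rv v1.
have toI (X : T -> R) : mean (fun w => \1_E' w * X w) = fine (\int[P]_(w in E') (X w)%:E).
  rewrite /Rintegral [in RHS]integral_mkcond; congr fine; apply: eq_integral => w _.
  by rewrite patchE indicE; case: (_ \in _); rewrite /= ?mul1r ?mul0r.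
have -> : mean (fun w => \1_E' w * (Z v w - Z r w)) =
    mean (fun w => \1_E' w * Z v w - \1_E' w * Z r w).
  by apply: eq_Rintegral => w _; rewrite mulrBr.
rewrite expB; [|by apply: L1_indicM => //; exact: iZ'|by apply: L1_indicM => //; exact: iZ'].
by rewrite !toI h subrr.
Qed.

End null_sets.

(** * Oscillations of the martingale part *)

Section oscillation.
Context d (T : measurableType d) (R : realType) (P : probability T R).
Local Notation mean X := (Rintegral P [set: T] X).

Definition oscillates (X : R -> T -> R) (s t e : R) : set T :=
  [set w | exists p : rat, [/\ s <= ratr p, ratr p <= t & e < `|X (ratr p) w - X s w|]].

Definition osc_constant (q : nat) (e : R) : R :=
  (e ^+ q.+1.*2)^-1 * (2 * 'C(q.+1.*2, 2)%:R) ^+ q.+1 + 1.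

(** The maximal inequality for the processes of the theorem: on the event Om
    all the almost sure hypotheses hold, and [maximal_inequality] applies to
    M and the integral of alpha, multiplied by the indicator of Om, in the
    filtration [trace_filtration Om F]. *)
Lemma oscillation_bound (F : R -> set_system T) (phi beta alpha : R -> T -> R) :
  let M := fun t w => phi t w - time_integral beta t w in
  let A := time_integral alpha in
  filtration F ->
  progressively_measurable F phi ->
  progressively_measurable F beta ->
  progressively_measurable F alpha ->
  {ae P, forall w, forall t, t \in `[0, 1] -> 0 <= alpha t w} ->
  {ae P, forall w,
    lebesgue_measure.-integrable `[0, 1] (fun t => (beta t w)%:E)} ->
  {ae P, forall w,
    lebesgue_measure.-integrable `[0, 1] (fun t => (alpha t w)%:E)} ->
  continuous_local_martingale P F M ->
  continuous_local_martingale P F (fun t w => M t w ^+ 2 - A t w) ->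
  exists Om : set T, [/\ measurable Om, P (~` Om) = 0%E,
    forall w, Om w -> [/\ forall t, 0 <= t <= 1 -> 0 <= alpha t w,
      lebesgue_measure.-integrable `[0, 1] (fun t => (beta t w)%:E),
      lebesgue_measure.-integrable `[0, 1] (fun t => (alpha t w)%:E) &
      {within `[0, 1], continuous (M ^~ w)}] &
    forall s t e q K0, 0 <= s -> s < t -> t <= 1 -> 0 < e -> 0 <= K0 ->
      burkholder_constant q e K0 ->
      mean (\1_(Om `&` oscillates M s t e)) <=
      osc_constant q e * mean (fun w => \1_Om w * Num.min (A t w - A s w) 1 ^+ q.+1)].
Proof.
move=> M A fF pphi pbeta palpha alpha0 ibeta ialpha [cM [_ [tau1 [st1 incr1 end1 mart1]]]]
  [_ [_ [tau2 [st2 incr2 end2 mart2]]]].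
have [N0 [mN0 PN0 N0P]] : {ae P, forall w,
    [/\ [/\ forall t, t \in `[0, 1] -> 0 <= alpha t w,
      lebesgue_measure.-integrable `[0, 1] (fun t => (beta t w)%:E),
      lebesgue_measure.-integrable `[0, 1] (fun t => (alpha t w)%:E) &
      {within `[0, 1], continuous (M ^~ w)}],
      (forall n, tau1 n w <= tau1 n.+1 w) /\ (exists n, tau1 n w = 1) &
      (forall n, tau2 n w <= tau2 n.+1 w) /\ (exists n, tau2 n w = 1)]}.
  apply: filterS (filterI (filterI (filterI alpha0 ibeta) (filterI ialpha cM))
    (filterI (filterI incr1 end1) (filterI incr2 end2))).
  by move=> w [[[h1 h2] [h3 h4]] [[h5 h6] [h7 h8]]].
pose Om := ~` N0.
have mOm : measurable Om by exact: measurableC.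
have POm : P (~` Om) = 0%E by rewrite setCK.
have OmP w : Om w -> [/\ [/\ forall t, t \in `[0, 1] -> 0 <= alpha t w,
      lebesgue_measure.-integrable `[0, 1] (fun t => (beta t w)%:E),
      lebesgue_measure.-integrable `[0, 1] (fun t => (alpha t w)%:E) &
      {within `[0, 1], continuous (M ^~ w)}],
      (forall n, tau1 n w <= tau1 n.+1 w) /\ (exists n, tau1 n w = 1) &
      (forall n, tau2 n w <= tau2 n.+1 w) /\ (exists n, tau2 n w = 1)].
  by move=> Ow; apply: contrapT => h; apply: Ow; apply: N0P.
exists Om; split => //.
  move=> w /OmP[[h1 h2 h3 h4] _ _]; split => // t t01; exact: h1.
have fG := trace_filtrationP Om fF.
pose M' t w := \1_Om w * M t w; pose A' t w := \1_Om w * A t w.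
have aM t : 0 <= t <= 1 -> meas_wrt (F t) (M t).
  move=> t01; apply: measurable_funB; first exact: progressive_adapted.
  exact: progressive_time_integral.
have aA t : 0 <= t <= 1 -> meas_wrt (F t) (A t).
  by move=> t01; exact: progressive_time_integral.
have cont0 (f : R -> R) w : (Om w -> {within `[0, 1], continuous f}) ->
    {within `[0, 1], continuous (fun t => \1_Om w * f t)}.
  move=> cf; have [Ow|nOw] := pselect (Om w).
    rewrite (_ : (fun t => _) = f); first exact: cf.
    by apply/funext => t; rewrite indicE mem_set// mul1r.
  rewrite (_ : (fun t => _) = cst 0).
    by apply/subspace_continuousP => x _; exact: cvg_cst.
  by apply/funext => t; rewrite indicE memNset// mul0r.
have cM' w : {within `[0, 1], continuous (M' ^~ w)}.
  by apply: cont0 => /OmP[[]].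
have cA' w : {within `[0, 1], continuous (A' ^~ w)}.
  apply: cont0 => /OmP[[_ _ h _] _ _]; exact: integral_path_continuous h.
have A'mono w r v : 0 <= r -> r <= v -> v <= 1 -> A' r w <= A' v w.
  move=> r0 rv v1; rewrite /A'; have [Ow|nOw] := pselect (Om w); last first.
    by rewrite !indicE memNset// !mul0r.
  have [[h1 _ h3 _] _ _] := OmP w Ow.
  rewrite indicE mem_set// !mul1r -subr_ge0 integral_path_increment//.
  apply: Rintegral_ge0 => s /=; rewrite in_itv/= => /andP[rs sv].
  by apply: h1; rewrite in_itv/= (le_trans r0 (ltW rs)) (le_trans sv).
have A'0 w : A' 0 w = 0 by rewrite /A' [A 0 w]integral_path_0 mulr0.
have tail (tau : nat -> T -> R) : (forall n, stopping_time F (tau n)) ->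
   (forall w, Om w -> (forall n, tau n w <= tau n.+1 w) /\ (exists n, tau n w = 1)) ->
   forall c, 0 < c -> exists n, mean (\1_[set w | tau n w < 1]) <= c.
  move=> st hO c c0.
  have mt n : measurable [set w | tau n w < 1].
    have [_ mF _] := fF; apply: (mF 1); first by rewrite in_itv/= ler01 lexx.
    by apply: stopping_time_lt => //; rewrite ler01 lexx.
  have [w|k hk] := mean_indic_vanish P (E := fun n => Om `&` [set w | tau n w < 1])
    (fun n => measurableI _ _ mOm (mt n)) _ c0.
    have [Ow|nOw] := pselect (Om w); last by exists 0%N => k _ [].
    have [inc [n nE]] := hO w Ow; exists n => k nk [_ /=].
    apply/negP; rewrite -leNgt -nE; elim: k nk => [|k IH]; first by rewrite leqn0 => /eqP ->.
    rewrite leq_eqVlt => /predU1P[->//|]; rewrite ltnS => /IH /le_trans; apply; exact: inc.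
  exists k; have := hk k (leqnn k).
  rewrite -(mean_full mOm POm (L1_indic P (mt k))).
  by rewrite indicI.
move=> s t e q K0 s0 st t1 e0 K00 HK.
have N'E r w : M' r w ^+ 2 - A' r w = \1_Om w * (M r w ^+ 2 - A r w).
  by rewrite /M' /A' indicE; case: (_ \in _); rewrite /= ?mul1r// !mul0r expr0n subrr.
have m1 n := martingale_trace mOm POm fF (mart1 n).
have m2 n := martingale_trace mOm POm fF (mart2 n).
have E1 n r w : M' (Num.min r (tau1 n w)) w - M' 0 w =
  \1_Om w * (stopped M (tau1 n) r w - M 0 w) by rewrite /M' -mulrBr.
have E2 n r w : (M' (Num.min r (tau2 n w)) w ^+ 2 - A' (Num.min r (tau2 n w)) w) -
    (M' 0 w ^+ 2 - A' 0 w) =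
  \1_Om w * (stopped (fun t w => M t w ^+ 2 - A t w) (tau2 n) r w - (M 0 w ^+ 2 - A 0 w)).
  by rewrite !N'E -mulrBr.
have := @maximal_inequality _ T R P (trace_filtration Om F) M' A' tau1 tau2 fG
  (fun t t01 => trace_meas mOm fF t01 (aM t t01))
  (fun t t01 => trace_meas mOm fF t01 (aA t t01)) cM' cA' A'mono A'0
  (fun n => stopping_trace Om fF (st1 n)) (fun n => stopping_trace Om fF (st2 n)).
have t1' : forall c, 0 < c -> exists n, mean (\1_[set w | tau1 n w < 1]) <= c.
  by apply: tail => // w /OmP[].
have t2' : forall c, 0 < c -> exists n, mean (\1_[set w | tau2 n w < 1]) <= c.
  by apply: tail => // w /OmP[].
move=> /(_ t1' t2').
have i1 n r : 0 <= r <= 1 -> P.-integrable setT (EFin \o (fun w =>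
    M' (Num.min r (tau1 n w)) w - M' 0 w)).
  by move=> r01; under eq_fun do rewrite E1; exact: (m1 n).1.
have i2 n r : 0 <= r <= 1 -> P.-integrable setT (EFin \o (fun w =>
    (M' (Num.min r (tau2 n w)) w ^+ 2 - A' (Num.min r (tau2 n w)) w) -
    (M' 0 w ^+ 2 - A' 0 w))).
  by move=> r01; under eq_fun do rewrite E2; exact: (m2 n).1.
move=> /(_ i1 i2).
have j1 n r v E : 0 <= r -> r <= v -> v <= 1 -> trace_filtration Om F r E ->
    mean (fun w => \1_E w * ((M' (Num.min v (tau1 n w)) w - M' 0 w) -
      (M' (Num.min r (tau1 n w)) w - M' 0 w))) = 0.
  move=> r0 rv v1 FE; under eq_Rintegral do rewrite !E1; exact: (m1 n).2 FE.
have j2 n r v E : 0 <= r -> r <= v -> v <= 1 -> trace_filtration Om F r E ->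
    mean (fun w => \1_E w * (((M' (Num.min v (tau2 n w)) w ^+ 2 - A' (Num.min v (tau2 n w)) w) -
    (M' 0 w ^+ 2 - A' 0 w)) - ((M' (Num.min r (tau2 n w)) w ^+ 2 - A' (Num.min r (tau2 n w)) w) -
    (M' 0 w ^+ 2 - A' 0 w)))) = 0.
  move=> r0 rv v1 FE; under eq_Rintegral do rewrite !E2; exact: (m2 n).2 FE.
move=> /(_ j1 j2 s t e q K0 s0 st t1 e0 K00 HK).
congr (mean (\1_ _) <= _ * mean _).
  apply/seteqP; split => w /=.
    move=> [p [h1 h2 h3]]; have [Ow|nOw] := pselect (Om w); last first.
      by move: h3; rewrite /M' indicE memNset// !mul0r subrr normr0 ltNge ltW.
    by split => //; exists p; split => //; move: h3; rewrite /M' indicE mem_set// !mul1r.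
  move=> [Ow [p [h1 h2 h3]]]; exists p; split => //.
  by rewrite /M' indicE mem_set// !mul1r.
apply/funext => w; rewrite /A' indicE; case: (_ \in _); rewrite /= ?mul1r//.
by rewrite !mul0r subrr min_l// expr0n.
Qed.

End oscillation.

(** * Superlinear functions *)

Section superlinear.
Variable R : realType.
Implicit Types (Th : R -> R).

Lemma superlinear_ge Th (L : R) : Th x / x @[x --> +oo] --> +oo ->
  exists2 K : R, 0 < K & forall x, K <= x -> L * x <= Th x.
Proof.
move=> /cvgryPge/(_ L)[K [_ hK]]; exists (Num.max 1 (K + 1)).
  by rewrite lt_max ltr01.
move=> x; rewrite ge_max => /andP[x1 Kx].
have x0 : 0 < x by exact: lt_le_trans x1.
by rewrite -ler_pdivlMr//; apply: hK; rewrite (lt_le_trans _ Kx)// ltrDl.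
Qed.

(** Halving x divides Th x by at most 2^p, so Th decreases to 0 at most
    polynomially; the number k of doublings that bring x above X is the
    induction parameter. *)
Lemma doubling_lower Th (C X : R) p : (forall x, 0 <= x -> 0 <= Th x) ->
  (forall x, 0 <= x -> Th (2 * x) <= C * Th x) -> C <= 2 ^+ p ->
  1 <= X -> (forall x, X <= x -> x <= Th x) ->
  forall x, 0 < x -> x <= X -> ((2 * X)^-1 * x) ^+ p <= Th x.
Proof.
move=> Th0 dbl Cp X1 XT x x0 xX.
have X0 : 0 < X by exact: lt_le_trans X1.
have [k hk] : exists k : nat, X <= 2 ^+ k * x.
  exists (Num.truncn (X / x)).+1; rewrite -ler_pdivrMr//.
  apply: le_trans (ltW (truncnS_gt _)) _.
  by rewrite -natrX ler_nat ltnW// ltn_expl.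
elim: k x x0 xX hk => [|k IH] x x0 xX hk.
  move: hk; rewrite expr0 mul1r => hk.
  have -> : x = X by apply/eqP; rewrite eq_le xX.
  apply: le_trans (XT X (lexx _)); apply: le_trans X1.
  rewrite invfM -mulrA mulVf ?gt_eqF// mulr1 exprn_ile1// invf_le1//.
  by rewrite ler1n.
have Tx0 : 0 <= Th x by apply/Th0/ltW.
have h2 : Th (2 * x) <= 2 ^+ p * Th x.
  by apply: le_trans (dbl x (ltW x0)) _; rewrite ler_wpM2r.
have p2 : 0 < 2 ^+ p :> R by rewrite exprn_gt0.
have [xX2|xX2] := leP (2 * x) X.
  have := IH (2 * x) (mulr_gt0 (ltr0Sn R 1) x0) xX2.
  rewrite mulrA -exprSr => /(_ hk) h3.
  have := le_trans h3 h2.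
  rewrite (_ : (2 * X)^-1 * (2 * x) = 2 * ((2 * X)^-1 * x)); last by ring.
  by rewrite exprMn ler_pM2l.
rewrite -(ler_pM2l p2); apply: le_trans h2; apply: (le_trans _ (XT _ (ltW xX2))).
apply: (le_trans _ (ltW xX2)); apply: le_trans X1.
rewrite -exprMn mulrA invfM mulrA divff// mul1r exprn_ile1//.
  by rewrite mulr_ge0 ?invr_ge0 ?ltW.
by rewrite mulrC ler_pdivrMr// mul1r.
Qed.

(** An affine minorant l (x - y) of Th integrates, over a cell of length 1/N
    where alpha has integral a, to l (a - y/N).  The pole y is half the mean
    a N of alpha, so that this is l a / 2.  The slope l comes from the
    polynomial lower bound when a N is bounded, is a small constant when a is
    small but a N is large, and comes from superlinearity when a is not
    small. *)
Lemma supporting_lines Th (C : R) : (forall x, 0 <= x -> 0 <= Th x) ->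
  Th x / x @[x --> +oo] --> +oo ->
  (forall x, 0 <= x -> Th (2 * x) <= C * Th x) ->
  exists q : nat, forall Lam : R, 0 < Lam -> exists N0 : nat, forall N, (N0 <= N)%N ->
    forall a, 0 <= a -> exists y l, [/\ forall x, 0 <= x -> l * (x - y) <= Th x &
      Lam * Num.min a 1 ^+ q.+1 <= l * (a - y / N%:R)].
Proof.
move=> Th0 Thoo dbl.
have [X' X'0 hX'] := superlinear_ge 1 Thoo.
pose X := Num.max 1 X'.
have X1 : 1 <= X by rewrite le_max lexx.
have X0 : 0 < X by exact: lt_le_trans X1.
have XT x : X <= x -> x <= Th x.
  by rewrite ge_max => /andP[_ /hX']; rewrite mul1r.
pose q := (Num.truncn C).+1.
have Cp : C <= 2 ^+ q.+1.
  apply: le_trans (ltW (truncnS_gt _)) _.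
  by rewrite -natrX ler_nat -/q ltnW// (leq_ltn_trans (leqnSn q))// ltn_expl.
exists q => Lam Lam0.
have low := doubling_lower Th0 dbl Cp X1 XT.
pose kap := (2 * X)^-1 ^+ q.+1.
have kap0 : 0 < kap by rewrite exprn_gt0// invr_gt0 mulr_gt0.
have lowX x : 0 < x -> x <= X -> kap * x ^+ q.+1 <= Th x.
  by move=> x0 xX; rewrite -exprMn; exact: low.
have line l y : 0 <= l -> (forall x, y <= x -> 0 <= x -> l * x <= Th x) -> 0 <= y ->
    forall x, 0 <= x -> l * (x - y) <= Th x.
  move=> l0 hl y0 x x0; have [xy|yx] := leP x y.
    by apply: le_trans (Th0 x x0); rewrite mulr_ge0_le0// subr_le0.
  by apply: le_trans (hl x (ltW yx) x0); rewrite ler_wpM2l// lerBlDr lerDl.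
(* slope at a pole below X, from the polynomial lower bound *)
have small y : 0 <= y -> y <= X -> forall x, y <= x -> 0 <= x -> kap * y ^+ q * x <= Th x.
  move=> y0 yX x yx x0.
  have [xX|Xx] := leP x X.
    move: x0; rewrite le_eqVlt => /predU1P[<-|x0]; first by rewrite mulr0 Th0.
    apply: le_trans (lowX x x0 xX); rewrite exprSr mulrA ler_wpM2r ?(ltW x0)//.
    by rewrite ler_wpM2l ?(ltW kap0)// lerXn2r// nnegrE ltW.
  apply: le_trans (XT x (ltW Xx)); apply: ler_piMl => //.
  apply: (@le_trans _ _ (kap * X ^+ q)).
    by rewrite ler_wpM2l ?(ltW kap0)// lerXn2r// nnegrE// ltW.
  rewrite /kap exprSr -mulrA [_^-1 * _]mulrC mulrA -exprMn.
  have -> : (2 * X)^-1 * X = 2^-1 by rewrite invfM -mulrA mulVf ?mulr1// gt_eqF.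
  apply: mulr_ile1.
  - by rewrite exprn_ge0// invr_ge0.
  - by rewrite invr_ge0 mulr_ge0// ltW.
  - by rewrite exprn_ile1// ?invr_ge0// invf_le1// ler1n.
  - by rewrite invf_le1 ?mulr_gt0//; lra.
pose l0 := kap * X ^+ q.
have l00 : 0 < l0 by rewrite mulr_gt0// exprn_gt0.
pose a0 := Num.min 1 (l0 / (2 * Lam)).
have a00 : 0 < a0 by rewrite lt_min ltr01 divr_gt0// mulr_gt0.
have [Y Y0 hY] := superlinear_ge (2 * Lam) Thoo.
pose N1 := (Num.truncn (4 * Lam / kap)).+1.
pose N2 := (Num.truncn (2 * Y / a0)).+1.
exists (maxn 2 (maxn N1 N2)) => N; rewrite !geq_max => /and3P[N_2 N_1 N_3] a a_0.
have N0 : 0 < N%:R :> R by rewrite ltr0n (leq_trans _ N_2).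
have hN1 : 4 * Lam <= kap * N%:R.
  rewrite [leRHS]mulrC -ler_pdivrMr// (le_trans (ltW (truncnS_gt _)))// ler_nat//.
have hN2 : 2 * Y <= a0 * N%:R.
  rewrite [leRHS]mulrC -ler_pdivrMr// (le_trans (ltW (truncnS_gt _)))// ler_nat//.
have N2' : 1 <= N%:R / 2 :> R by rewrite ler_pdivlMr// mul1r ler_nat.
pose y := a * N%:R / 2.
have y0 : 0 <= y by rewrite !mulr_ge0// ?ltW// invr_gt0.
have aE : a - y / N%:R = a / 2.
  by rewrite /y -mulrA [2^-1 * _]mulrC mulrA mulfK ?gt_eqF//; field.
exists y; rewrite aE.
have min1 : Num.min a 1 ^+ q.+1 <= a.
  apply: (@le_trans _ _ (Num.min a 1)); last by rewrite ge_min lexx.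
  by rewrite ler_iXnr// ?le_min ?a_0//= ge_min lexx orbT.
have minp : Num.min a 1 ^+ q.+1 <= a ^+ q.+1.
  by apply: lerXn2r; rewrite ?nnegrE ?le_min ?a_0 ?ler01// ge_min lexx.
have [yX|Xy] := leP y X.
  exists (kap * y ^+ q); split.
    apply: line => //; last exact: small.
    by apply: mulr_ge0; [exact: ltW|exact: exprn_ge0].
  apply: (@le_trans _ _ (Lam * a ^+ q.+1)); first by rewrite ler_wpM2l// ltW.
  rewrite /y -mulrA exprMn exprSr.
  rewrite (_ : kap * _ * _ = (kap * (N%:R / 2) ^+ q / 2) * (a ^+ q * a)); last by ring.
  rewrite ler_wpM2r ?mulr_ge0 ?exprn_ge0//.
  rewrite ler_pdivlMr//; apply: (@le_trans _ _ (kap * (N%:R / 2))); first by lra.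
  by rewrite ler_wpM2l ?(ltW kap0)// ler_eXnr.
have [aa|aa] := leP a a0.
  exists l0; split.
    apply: line => //; first exact: ltW.
    by move=> x yx x0; apply: small => //; [exact: ltW|exact: (le_trans (ltW Xy) yx)].
  have aLam : Lam * a <= l0 / 2.
    have : a <= l0 / (2 * Lam) by apply: le_trans aa _; rewrite ge_min lexx orbT.
    rewrite ler_pdivlMr ?mulr_gt0// ler_pdivlMr//; congr (_ <= _); ring.
  apply: (@le_trans _ _ (Lam * a ^+ q.+1)); first by rewrite ler_wpM2l// ltW.
  rewrite (_ : l0 * (a / 2) = l0 / 2 * a); last by ring.
  rewrite exprSr mulrA ler_wpM2r//; apply: le_trans aLam; rewrite ler_wpM2l ?(ltW Lam0)//.
  by rewrite ler_iXnr// (le_trans aa)// ge_min lexx.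
exists (2 * Lam); split.
  apply: line => //; first by rewrite mulr_ge0// ltW.
  move=> x yx _; apply: hY; apply: le_trans yx.
  rewrite /y ler_pdivlMr// mulrC (le_trans hN2)// ler_wpM2r// ltW//.
rewrite (_ : 2 * Lam * (a / 2) = Lam * a); last by field.
by rewrite ler_wpM2l// ltW.
Qed.

End superlinear.

(** * The energy of a path *)

Section path_energy.
Variable R : realType.
Local Notation leb := (@lebesgue_measure R).
Local Notation cell N i := (`]i%:R / N%:R, i.+1%:R / N%:R]%classic : set R).

Lemma cell_sub (N i : nat) : (i < N)%N -> cell N i `<=` `[0 : R, 1]%classic.
Proof.
move=> iN t /=; rewrite !in_itv/= => /andP[it ti].
have N0 : (0 : R) < N%:R by rewrite ltr0n (leq_trans _ iN).
rewrite (le_trans _ (ltW it)) ?divr_ge0//= (le_trans ti)//.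
by rewrite ler_pdivrMr// mul1r ler_nat.
Qed.

Lemma cell_disj (N i j : nat) (t : R) : (0 < N)%N -> t \in cell N i -> t \in cell N j -> i = j.
Proof.
move=> N0; have N0' : (0 : R) < N%:R by rewrite ltr0n.
rewrite !inE/= !in_itv/= => /andP[it ti] /andP[jt tj].
apply/eqP; rewrite eqn_leq; apply/andP; split; rewrite leqNgt; apply/negP => ij.
  have := lt_le_trans it tj; rewrite ltr_pM2r ?invr_gt0// ltr_nat ltnS leqNgt ij//.
have := lt_le_trans jt ti; rewrite ltr_pM2r ?invr_gt0// ltr_nat ltnS leqNgt ij//.
Qed.

(** Integration over the cells of integrable minorants of an arbitrary
    nonnegative function. *)
Lemma piecewise_integral_le (N : nat) (h : nat -> R -> R) (Th : R -> R) : (0 < N)%N ->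
  (forall i, (i < N)%N -> leb.-integrable `[0, 1] (EFin \o h i)) ->
  (forall t, 0 <= t <= 1 -> 0 <= Th t) ->
  (forall i t, (i < N)%N -> cell N i t -> h i t <= Th t) ->
  ((\sum_(i < N) \int[leb]_(t in cell N i) h i t)%R%:E <=
    \int[leb]_(t in `[0%R, 1%R]) (Th t)%:E)%E.
Proof.
move=> N0 ih Th0 hTh.
pose g n t := \sum_(i < n) (h i \_ (cell N i)) t.
have mI : measurable (`[0, 1]%classic : set R) by exact: measurable_itv.
have gE n : (n <= N)%N -> leb.-integrable `[0, 1] (EFin \o g n) /\
    \int[leb]_(t in `[0, 1]) g n t = \sum_(i < n) \int[leb]_(t in cell N i) h i t.
  elim: n => [|n IH] nN.
    rewrite big_ord0 (_ : g 0%N = cst 0); last by apply/funext => t; rewrite /g big_ord0.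
    by split; [exact: integrable0|rewrite Rintegral_cst// mul0r].
  have [ig Eg] := IH (ltnW nN).
  have ip : leb.-integrable `[0, 1] (EFin \o (h n \_ (cell N n))).
    rewrite -restrict_EFin; apply/integrable_restrict => //.
    apply: integrableS (ih n nN) => //; exact: measurableI.
  have gS : g n.+1 = (fun t => g n t + (h n \_ (cell N n)) t).
    by apply/funext => t; rewrite /g big_ord_recr.
  rewrite gS big_ord_recr/=; split; first exact: (integrableD _ ig ip).
  rewrite RintegralD// Eg; congr (_ + _).
  by rewrite -Rintegral_mkcondr setIidr//; exact: cell_sub.
have [ig <-] := gE N (leqnn N).
have gTh t : 0 <= t <= 1 -> g N t <= Th t.
  move=> t01; have [[i ti]|ni] := pselect (exists i : 'I_N, t \in cell N i).
    rewrite /g (bigD1 i)//= patchE ti big1 ?addr0.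
      by apply: hTh => //; exact: set_mem.
    move=> j ji; rewrite patchE; case: ifPn => // tj.
    by move: ji; rewrite (val_inj (cell_disj N0 tj ti)) eqxx.
  rewrite /g big1 ?Th0// => i _; rewrite patchE; case: ifPn => // ti.
  by exfalso; apply: ni; exists i.
apply: (@le_trans _ _ (\int[leb]_(t in `[0%R, 1%R]) (Num.max (g N t) 0)%:E)%E).
  rewrite /Rintegral fineK; last exact: integrable_fin_num.
  apply: le_integral => //.
    have -> : (fun t => (Num.max (g N t) 0)%:E) = (EFin \o g N)^\+%E.
      by apply/funext => t; rewrite funeposE/= EFin_max.
    exact: integrable_funepos.
  by move=> t _; rewrite lee_fin le_max lexx.
apply: le_integral_ae.
  by move=> t _; rewrite lee_fin le_max lexx orbT.
apply: aeW => t /=; rewrite in_itv/= => t01.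
by rewrite lee_fin ge_max gTh//= Th0.
Qed.

Lemma cell_measure (N i : nat) : (0 < N)%N -> fine (leb (cell N i)) = N%:R^-1.
Proof.
move=> N0; have N0' : (0 : R) < N%:R by rewrite ltr0n.
rewrite lebesgue_measure_itv/= lte_fin ltr_pM2r ?invr_gt0// ltr_nat ltnSn.
by rewrite -EFinB/= -mulrBl -natrB// subSnn mul1r.
Qed.

(** E i says that the drift moves by eps on the cell i.  On each cell the
    integrand is bounded below by an affine function of |b| and one of a, whose
    integrals are computed exactly. *)
Lemma path_energy_bound (Theta1 Theta2 : R -> R) (L K Lam Lam' eps : R) (q N : nat)
    (b a : R -> R) (E : nat -> bool) :
  (0 < N)%N -> 0 <= L -> 0 <= Lam' ->
  (forall x, 0 <= x -> 0 <= Theta1 x) -> (forall x, 0 <= x -> 0 <= Theta2 x) ->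
  (forall x, 0 <= x -> L * (x - K) <= Theta1 x) ->
  Lam <= L * (eps - K / N%:R) ->
  (forall z, 0 <= z -> exists y l, [/\ forall x, 0 <= x -> l * (x - y) <= Theta2 x &
      Lam' * Num.min z 1 ^+ q.+1 <= l * (z - y / N%:R)]) ->
  leb.-integrable `[0, 1] (EFin \o b) -> leb.-integrable `[0, 1] (EFin \o a) ->
  (forall t, 0 <= t <= 1 -> 0 <= a t) ->
  (forall i, (i < N)%N -> E i -> eps <= \int[leb]_(t in cell N i) `|b t|) ->
  ((\sum_(i < N) (Lam * (E i)%:R +
     Lam' * Num.min (\int[leb]_(t in cell N i) a t) 1 ^+ q.+1))%R%:E <=
    \int[leb]_(t in `[0%R, 1%R]) (Theta1 `|b t| + Theta2 (a t))%:E)%E.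
Proof.
move=> N0 L0 Lam'0 T10 T20 T1L LamL T2l ib ia a0 bE.
have N0' : (0 : R) < N%:R by rewrite ltr0n.
have za i : (i < N)%N -> 0 <= \int[leb]_(t in cell N i) a t.
  by move=> iN; apply: Rintegral_ge0 => t /(cell_sub iN); rewrite /= in_itv/= => /a0.
have /choice[yl ylP] : forall i : 'I_N, exists yl : R * R,
    (forall x, 0 <= x -> yl.2 * (x - yl.1) <= Theta2 x) /\
    Lam' * Num.min (\int[leb]_(t in cell N i) a t) 1 ^+ q.+1 <=
      yl.2 * (\int[leb]_(t in cell N i) a t - yl.1 / N%:R).
  by move=> i; have [y [l [h1 h2]]] := T2l _ (za i (ltn_ord i)); exists (y, l).
pose yl' i := match insub i : option 'I_N with Some j => yl j | None => (0, 0) end.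
have yl'E (i : 'I_N) : yl' i = yl i.
  by rewrite /yl' insubT//=; move=> ?; congr yl; exact: val_inj.
(* The minorant of Theta1 is used only on the cells where the drift moves; on
   the others it could have a negative integral. *)
pose h i t := (E i)%:R * L * (`|b t| - K) + (yl' i).2 * (a t - (yl' i).1).
have cstI (k : R) : leb.-integrable `[0, 1] (EFin \o (fun=> k)).
  apply: measurable_bounded_integrable => //.
    by rewrite /= lebesgue_measure_itv/= lte01 oppr0 adde0 ltry.
  by exists `|k|; split => [|x kx t _ /=]; [exact: num_real|exact: ltW].
have inb : leb.-integrable `[0, 1] (EFin \o (fun t => `|b t|)).
  by apply: integrable_norm.
have i1 (k : R) : leb.-integrable `[0, 1] (EFin \o (fun t => k * (`|b t| - K))).
  exact: (integrableZl _ k (integrableB _ inb (cstI K))).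
have i2 (k y : R) : leb.-integrable `[0, 1] (EFin \o (fun t => k * (a t - y))).
  exact: (integrableZl _ k (integrableB _ ia (cstI y))).
have ih i : leb.-integrable `[0, 1] (EFin \o h i).
  exact: (integrableD _ (i1 _) (i2 _ _)).
apply: (@le_trans _ _ (\sum_(i < N) \int[leb]_(t in cell N i) h i t)%:E); last first.
  apply: piecewise_integral_le => //.
    by move=> t t01; rewrite addr_ge0// ?T10// T20// a0.
  move=> i t iN it; have := cell_sub iN it; rewrite /= in_itv/= => t01.
  have := yl'E (Ordinal iN); rewrite /h /= => ->.
  apply: lerD; last by case: (ylP (Ordinal iN)) => + _; apply; exact: a0.
  by case: (E i); rewrite /= ?mul1r ?mul0r; [exact: T1L|exact: T10].
rewrite lee_fin; apply: ler_sum => i _.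
have sub := @cell_sub N i (ltn_ord i).
have mc : measurable (cell N i) by exact: measurable_itv.
have S (f : R -> R) : leb.-integrable `[0, 1] (EFin \o f) ->
    leb.-integrable (cell N i) (EFin \o f).
  by move=> h'; apply: integrableS h'.
have cm k : \int[leb]_(t in cell N i) (fun=> k) t = k / N%:R.
  by rewrite Rintegral_cst// cell_measure.
rewrite RintegralD//; [|exact: S (i1 _)|exact: S (i2 _ _)].
have -> : \int[leb]_(t in cell N i) ((E i)%:R * L * (`|b t| - K)) =
    (E i)%:R * L * (\int[leb]_(t in cell N i) `|b t| - K / N%:R).
  rewrite RintegralZl//; last exact: S (integrableB _ inb (cstI K)).
  by rewrite RintegralB ?cm//; [exact: S|exact: S (cstI K)].
have -> : \int[leb]_(t in cell N i) ((yl' i).2 * (a t - (yl' i).1)) =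
    (yl' i).2 * (\int[leb]_(t in cell N i) a t - (yl' i).1 / N%:R).
  rewrite RintegralZl//; last exact: S (integrableB _ ia (cstI _)).
  by rewrite RintegralB ?cm//; [exact: S|exact: S (cstI _)].
apply: lerD; last by rewrite yl'E; case: (ylP i).
have := bE i (ltn_ord i); case: (E i) => /= h1; last by rewrite mulr0 !mul0r.
by rewrite mulr1 mul1r (le_trans LamL)// ler_wpM2l// lerD2r h1.
Qed.

End path_energy.

(** * From one cell to the whole path *)

Section key_estimate.
Context d (T : measurableType d) (R : realType) (P : probability T R).
Local Notation mean X := (Rintegral P [set: T] X).

(** The event that the trajectory is wild, read off the process at countably
    many times, which makes it measurable. *)
Definition wild_event (phi : R -> T -> R) (X e : R) (N : nat) : set T :=
  [set w | X < `|phi 0 w|] `|`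
  \bigcup_(i in [set i | (i < N)%N])
    oscillates phi (i%:R / N%:R) (i.+1%:R / N%:R) e.

Lemma measurable_superlevel (f : T -> R) (c : R) :
  measurable_fun setT f -> measurable [set w | c < f w].
Proof.
move=> mf; rewrite (_ : [set w | _] = setT `&` f @^-1` `]c, +oo[); first exact: mf.
by rewrite setTI; apply/seteqP; split => w /=; rewrite in_itv/= andbT.
Qed.

Lemma measurable_oscillates (Y : R -> T -> R) (s t e : R) : 0 <= s -> s <= t -> t <= 1 ->
  (forall r, 0 <= r <= 1 -> measurable_fun setT (Y r)) ->
  measurable (oscillates Y s t e).
Proof.
move=> s0 st t1 mY.
have -> : oscillates Y s t e = \bigcup_(p in [set p : rat | s <= (ratr p : R) <= t])
    [set w | e < `|Y (ratr p) w - Y s w|].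
  apply/seteqP; split => w /=; first by move=> [p [h1 h2 h3]]; exists p => //=; rewrite h1.
  by move=> [p /= /andP[h1 h2] h3]; exists p.
apply: (sigma_bigcup (sigma_algebra_measurable T)) => p /= /andP[h1 h2].
apply: measurable_superlevel.
apply: measurableT_comp => //; apply: measurable_funB; apply: mY.
  by rewrite (le_trans s0)//= (le_trans h2).
by rewrite s0 (le_trans st).
Qed.

(** If phi moves by more than e on a cell, then M or the drift moves by more than
    e/2.  So the probability of the wild event is at most the expectation of H,
    which sums over the cells the indicator that the drift moves and the bound
    of [oscillation_bound]; and Lam H is pathwise at most the energy, by
    [path_energy_bound]. *)
Lemma key_estimate (F : R -> set_system T) (phi beta alpha : R -> T -> R)
    (theta Theta1 Theta2 : R -> R) (X e L K Lam : R) (N q : nat) (K0 : R) :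
  let M := fun t w => phi t w - time_integral beta t w in
  filtration F ->
  progressively_measurable F phi ->
  progressively_measurable F beta ->
  progressively_measurable F alpha ->
  {ae P, forall w, forall t, t \in `[0, 1] -> 0 <= alpha t w} ->
  {ae P, forall w,
    lebesgue_measure.-integrable `[0, 1] (fun t => (beta t w)%:E)} ->
  {ae P, forall w,
    lebesgue_measure.-integrable `[0, 1] (fun t => (alpha t w)%:E)} ->
  continuous_local_martingale P F M ->
  continuous_local_martingale P F (fun t w => M t w ^+ 2 - time_integral alpha t w) ->
  (forall x, 0 <= x -> 0 <= theta x) ->
  (forall x, 0 <= x -> 0 <= Theta1 x) -> (forall x, 0 <= x -> 0 <= Theta2 x) ->
  0 < e -> 0 < Lam -> (0 < N)%N -> 0 <= L ->
  (forall x, 0 <= x -> X < x -> Lam <= theta x) ->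
  (forall x, 0 <= x -> L * (x - K) <= Theta1 x) ->
  Lam <= L * (e / 2 - K / N%:R) ->
  0 <= K0 -> burkholder_constant q (e / 2) K0 ->
  (forall z, 0 <= z -> exists y l, [/\ forall x, 0 <= x -> l * (x - y) <= Theta2 x &
      Lam * osc_constant q (e / 2) * Num.min z 1 ^+ q.+1 <= l * (z - y / N%:R)]) ->
  exists Om : set T, [/\ measurable Om, P (~` Om) = 0%E,
    forall w, Om w -> {within `[0, 1], continuous (phi ^~ w)},
    measurable (wild_event phi X e N) &
   ((Lam * mean (\1_(Om `&` wild_event phi X e N)))%:E <=
     \int[P]_w ((theta `|phi 0 w|)%:E +
             \int[lebesgue_measure]_(t in `[0%R, 1%R])
               (Theta1 `|beta t w| + Theta2 (alpha t w))%:E))%E].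
Proof.
move=> M fF pphi pbeta palpha alpha0 ibeta ialpha lM lN th0 T10 T20 e0 Lam0 N0 L0 thX
  T1L LamL K00 HK T2l.
have [Om [mOm POm OmP bound]] := oscillation_bound fF pphi pbeta palpha alpha0 ibeta ialpha lM lN.
have N0' : (0 : R) < N%:R by rewrite ltr0n.
have e20 : 0 < e / 2 by rewrite divr_gt0.
pose B := time_integral beta; pose A := time_integral alpha.
pose u i : R := i%:R / N%:R.
have u0 i : 0 <= u i by rewrite divr_ge0.
have u1 i : (i < N)%N -> u i.+1 <= 1 by move=> iN; rewrite ler_pdivrMr// mul1r ler_nat.
have uS i : u i < u i.+1 by rewrite ltr_pM2r ?invr_gt0// ltr_nat.
have [sF mF _] := fF.
have mT (Y : T -> R) (r : R) : 0 <= r <= 1 -> meas_wrt (F r) Y -> measurable_fun setT Y.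
  move=> r01 mY; have r01' : r \in `[0, 1] by rewrite in_itv.
  exact: meas_wrt_measurable (sF r r01') (mF r r01') mY.
have mphi r : 0 <= r <= 1 -> measurable_fun setT (phi r).
  by move=> r01; apply: (mT _ _ r01); exact: progressive_adapted.
have mB r : 0 <= r <= 1 -> measurable_fun setT (B r).
  by move=> r01; apply: (mT _ _ r01); exact: progressive_time_integral.
have mA r : 0 <= r <= 1 -> measurable_fun setT (A r).
  by move=> r01; apply: (mT _ _ r01); exact: progressive_time_integral.
have mM r : 0 <= r <= 1 -> measurable_fun setT (M r).
  by move=> r01; apply: measurable_funB; [exact: mphi|exact: mB].
have mosc (Y : R -> T -> R) : (forall r, 0 <= r <= 1 -> measurable_fun setT (Y r)) ->
    forall i (e' : R), (i < N)%N -> measurable (oscillates Y (u i) (u i.+1) e').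
  by move=> mY i e' iN; apply: measurable_oscillates => //; [exact: ltW|exact: u1].
pose S0 := [set w | X < `|phi 0 w|].
pose EB i := oscillates B (u i) (u i.+1) (e / 2).
pose EM i := oscillates M (u i) (u i.+1) (e / 2).
have mS0 : measurable S0.
  apply: measurable_superlevel.
  by apply: measurableT_comp => //; apply: mphi; rewrite lexx ler01.
have mEB i : (i < N)%N -> measurable (EB i) by move=> iN; exact: mosc.
have mEM i : (i < N)%N -> measurable (EM i) by move=> iN; exact: mosc.
have mV : measurable (wild_event phi X e N).
  by apply: measurableU => //; apply: bigcup_measurable => i /= iN; exact: mosc.
exists Om; split => //.
  move=> w Ow; have [_ ib _ cM] := OmP w Ow.
  rewrite (_ : phi ^~ w = (fun t => M t w + B t w)).
    apply/subspace_continuousP => x x01; apply: cvgD.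
      exact: (subspace_continuousP _ _).1 cM x x01.
    exact: (subspace_continuousP _ _).1 (integral_path_continuous ib) x x01.
  by apply/funext => t; rewrite /M subrK.
pose a i w := A (u i.+1) w - A (u i) w.
pose c := osc_constant q (e / 2).
have c0 : 0 <= c.
  by rewrite addr_ge0// mulr_ge0 ?invr_ge0 ?exprn_ge0// ?(ltW e20)// mulr_ge0.
have aE i w : (i < N)%N -> Om w ->
    a i w = \int[lebesgue_measure]_(t in `]i%:R / N%:R, i.+1%:R / N%:R]) alpha t w.
  move=> iN Ow; have [_ _ ia _] := OmP w Ow.
  by rewrite /a [LHS](integral_path_increment ia (u0 i) (ltW (uS i)) (u1 i iN)).
have a0 i w : (i < N)%N -> Om w -> 0 <= a i w.
  move=> iN Ow; have [al0 _ _ _] := OmP w Ow.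
  rewrite aE//; apply: Rintegral_ge0 => t /(cell_sub iN); rewrite /= in_itv/=; exact: al0.
pose m i w := \1_Om w * Num.min (a i w) 1 ^+ q.+1.
have im i : (i < N)%N -> P.-integrable setT (EFin \o m i).
  move=> iN; apply: (@bounded_L1 _ _ _ _ _ 1).
    apply: measurable_funM; first exact: measurable_indic.
    apply: measurable_funX; apply: measurable_minr => //.
    by apply: measurable_funB; apply: mA; rewrite u0 ?u1// (le_trans (ltW (uS i)))// u1.
  move=> w; rewrite /m indicE; have [Ow|nOw] := pselect (Om w).
    have min0 : 0 <= Num.min (a i w) 1 by rewrite le_min a0 ?ler01.
    by rewrite mem_set// mul1r ger0_norm ?exprn_ge0// exprn_ile1// ge_min lexx orbT.
  by rewrite memNset// mul0r normr0.
have iI (E : set T) : measurable E -> P.-integrable setT (EFin \o (\1_E : T -> R)).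
  exact: L1_indic.
pose G i w := \1_(Om `&` EB i) w + c * m i w.
pose H w := \1_(Om `&` S0) w + \sum_(i < N) G i w.
have iG i : (i < N)%N -> P.-integrable setT (EFin \o G i).
  by move=> iN; apply: L1D; [apply: iI; apply: measurableI => //; exact: mEB|apply: L1Z; exact: im].
have iS0 : P.-integrable setT (EFin \o (\1_(Om `&` S0) : T -> R)).
  by apply: iI; exact: measurableI.
have iH : P.-integrable setT (EFin \o H) by apply: L1D => //; exact: L1_sum.
have leH : mean (\1_(Om `&` wild_event phi X e N)) <= mean H.
  pose G' i w := \1_(Om `&` EB i) w + \1_(Om `&` EM i) w : R.
  have iG' i : (i < N)%N -> P.-integrable setT (EFin \o G' i).
    move=> iN; apply: L1D; apply: iI; apply: measurableI => //; [exact: mEB|exact: mEM].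
  apply: (@le_trans _ _ (mean (fun w => \1_(Om `&` S0) w + \sum_(i < N) G' i w))).
    apply: exp_le; first by apply: iI; exact: measurableI.
      by apply: L1D => //; exact: L1_sum.
    move=> w; have pos i : 0 <= G' i w by rewrite /G' !indicE addr_ge0.
    have S0pos : 0 <= \1_(Om `&` S0) w :> R by rewrite indicE.
    have [[Ow Vw]|nV] := pselect ((Om `&` wild_event phi X e N) w); last first.
      by rewrite [leLHS]indicE memNset// addr_ge0// sumr_ge0.
    rewrite [leLHS]indicE mem_set//; case: Vw => [Sw|[i /= iN [p [h1 h2 h3]]]].
      by rewrite indicE mem_set//= lerDl sumr_ge0.
    rewrite ler_wpDl// (bigD1 (Ordinal iN))//= ler_wpDr ?sumr_ge0//.
    have [hB|hB] := ltP (e / 2) `|B (ratr p) w - B (u i) w|.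
      rewrite /G' [X in _ <= X + _]indicE mem_set; last by split => //; exists p.
      by rewrite lerDl indicE.
    rewrite /G' [X in _ <= _ + X]indicE mem_set; first by rewrite lerDr indicE.
    split => //; exists p; split => //.
    have := ler_normD (M (ratr p) w - M (u i) w) (B (ratr p) w - B (u i) w).
    rewrite (_ : M (ratr p) w - _ + _ = phi (ratr p) w - phi (u i) w); last first.
      by rewrite /M /B; ring.
    by move=> tri; rewrite -(ltrD2r (e / 2)) -splitr (lt_le_trans h3)// (le_trans tri)// lerD2l.
  rewrite expD//; last exact: L1_sum.
  rewrite /H expD//; last exact: L1_sum.
  rewrite (@exp_sum _ _ _ P N G' iG') (@exp_sum _ _ _ P N G iG) lerD2l.
  apply: ler_sum => i _; have iN := ltn_ord i.
  rewrite /G' /G expD; [|by apply: iI; apply: measurableI => //; exact: mEB|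
    by apply: iI; apply: measurableI => //; exact: mEM].
  rewrite expD; [|by apply: iI; apply: measurableI => //; exact: mEB|by apply: L1Z; exact: im].
  rewrite lerD2l expZ; last exact: im.
  exact: (bound (u i) (u i.+1) (e / 2) q K0 (u0 i) (uS i) (u1 i iN) e20 K00 HK).
have iLH : P.-integrable setT (EFin \o (fun w => Lam * H w)) by exact: L1Z.
apply: (@le_trans _ _ (mean (fun w => Lam * H w))%:E).
  by rewrite lee_fin expZ// ler_wpM2l// ltW.
rewrite /Rintegral fineK; last exact: (integrable_fin_num measurableT iLH).
have m0 i w : (i < N)%N -> 0 <= m i w.
  move=> iN; rewrite /m indicE; have [Ow|nOw] := pselect (Om w).
    by rewrite mem_set// mul1r exprn_ge0// le_min a0//=.
  by rewrite memNset// mul0r.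
apply: le_integral_ae.
  move=> w _; rewrite lee_fin mulr_ge0 ?(ltW Lam0)// addr_ge0//.
  by apply: sumr_ge0 => i _; rewrite addr_ge0// mulr_ge0// m0.
exists (~` Om); split => //; first exact: measurableC.
apply: subsetC => w Ow _.
have [al0 ib ia cM] := OmP w Ow.
have inb : lebesgue_measure.-integrable `[0, 1] (EFin \o (fun t => `|beta t w|)).
  by apply: integrable_norm.
rewrite /H mulrDr EFinD; apply: leeD.
  rewrite lee_fin indicE; have [h|h] := pselect (S0 w).
    by rewrite mem_set// mulr1 thX.
  by rewrite memNset ?mulr0 ?th0// => -[].
have := @path_energy_bound R Theta1 Theta2 L K Lam (Lam * c) (e / 2) q N (beta ^~ w)
  (alpha ^~ w) (fun i => w \in EB i) N0 L0 (mulr_ge0 (ltW Lam0) c0) T10 T20 T1L LamL T2l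
  ib ia al0.
move=> /(_ _)/(le_trans _); apply; last first.
  move=> i iN /set_mem[p [h1 h2 h3]]; apply: le_trans (ltW h3) _.
  have p1 : ratr p <= 1 :> R by apply: le_trans h2 _; exact: u1.
  rewrite [X in `|X|](integral_path_increment ib (u0 i) h1 p1).
  have sub1 : `]u i, (ratr p : R)]%classic `<=` `]u i, u i.+1]%classic.
    by apply: subset_itvl; rewrite bnd_simp.
  have sub2 := @cell_sub R N i iN.
  have mi x y : measurable (`]x, y]%classic : set R) by exact: measurable_itv.
  apply: (@le_trans _ _ (\int[lebesgue_measure]_(t in `]u i, (ratr p : R)]) `|beta t w|)).
    apply: le_normr_Rintegral => //.
    by apply: integrableS ib => //; exact: subset_trans sub1 sub2.
  have ic : lebesgue_measure.-integrable `]u i, u i.+1] (EFin \o (fun t => `|beta t w|)).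
    by apply: integrableS inb.
  rewrite -[leRHS](subrK (\int[lebesgue_measure]_(t in `]u i, (ratr p : R)]) `|beta t w|)).
  rewrite lerDr (@Rintegral_itvB R (fun t => `|beta t w|) (BRight (u i)) (BRight (u i.+1)) (ratr p))//.
  exact: Rintegral_ge0.
rewrite lee_fin mulr_sumr; apply: ler_sum => i _; have iN := ltn_ord i.
rewrite /G /m -(aE i w iN Ow) indicI /= !indicE !(mem_set Ow) !mul1r mulrDr.
by rewrite mulrA.
Qed.

End key_estimate.

(** * The penalty *)

Section penalty.
Variable R : realType.
Implicit Types (X e : nat -> R) (N : nat -> nat) (f : C01 R).

Definition penalty X e N f : \bar R :=
  \sum_(k <oo) (2 ^+ k * \1_(wild (X k) (e k) (N k)) f)%:E.

Lemma penalty_ge0 X e N f : (0 <= penalty X e N f)%E.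
Proof. by apply: nneseries_ge0 => k _ _; rewrite lee_fin mulr_ge0. Qed.

(** Psi f <= c forbids f to be in the k-th wild set as soon as 2^k > c. *)
Lemma penalty_coercive X e N : e @ \oo --> 0 -> (forall k, (0 < N k)%N) ->
  coercive (penalty X e N).
Proof.
move=> e0 N0 c c0; pose k0 := (Num.truncn c).+1.
apply: (@tame_precompact _ X e N k0) => // f /= fc k kk wf.
have : ((2 ^+ k * \1_(wild (X k) (e k) (N k)) f)%:E <= c%:E)%E.
  apply: le_trans fc; apply: le_trans (@nneseries_lim_ge _ _ _ 0 k.+1 _); last first.
    by move=> n _ _; rewrite lee_fin mulr_ge0.
  rewrite big_nat_recr//= leeDr//; apply: sume_ge0 => n _.
  by rewrite lee_fin mulr_ge0.
rewrite lee_fin indicE mem_set// mulr1 leNgt => /negP; apply.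
apply: lt_le_trans (truncnS_gt c) _.
rewrite -natrX ler_nat (leq_trans kk)//; exact/ltnW/ltn_expl.
Qed.

Lemma penalty_borel X e N : borel_measurable (penalty X e N).
Proof.
apply: ge0_emeasurable_sum => [k f _ _|k _]; first by rewrite lee_fin mulr_ge0.
apply/measurable_EFinP; apply: measurable_funM => //.
apply: measurable_indic; apply: sub_sigma_algebra; exact: open_wild.
Qed.

End penalty.

Section trajectories.
Context d (T : measurableType d) (R : realType).

Lemma trajectoryE (phi : R -> T -> R) w
    (t : set_type `[0 : R, 1]%classic) :
  {within `[0, 1], continuous (phi ^~ w)} -> trajectory phi w t = phi (\val t) w.
Proof.
move=> /subspace_sigL_continuousP cphi.
by rewrite /trajectory val_insubd ifT//; exact/continuous_predP.
Qed.

Lemma wild_trajectory (phi : R -> T -> R) w X e N :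
  0 <= e -> {within `[0, 1], continuous (phi ^~ w)} ->
  wild X e N (trajectory phi w) -> wild_event phi X e N w.
Proof.
move=> e0 cphi [[t [t0 Xt]]|[i [s [t [iN si st ti est]]]]].
  by left; rewrite /= -t0 -trajectoryE.
right; exists i => //; apply: contrapT => nosc.
move: est; rewrite !trajectoryE// ltNge => /negP; apply.
have [ts|st'] := leP (\val t) (\val s).
  by have /val_inj-> : \val t = \val s by [apply/le_anti/andP]; rewrite subrr normr0.
apply: (@le_of_rat_le _ (fun x => `|phi x w - phi (\val s) w|) (\val s)) => //.
  move=> c c0; have [dl dl0 hdl] := within_unif_continuous cphi c0.
  exists dl => // y sy yt ytd.
  have /andP[s0 _] := unitIP s; have /andP[t0 t1] := unitIP t.
  have := ler_distD (phi y w) (phi (\val t) w) (phi (\val s) w).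
  move=> /le_trans; apply; rewrite addrC lerD2l; apply: hdl; rewrite ?t0//.
    by rewrite (le_trans s0 (ltW sy)) (le_trans (ltW yt)).
  by rewrite gtr0_norm// subr_gt0.
move=> p sp pt; rewrite leNgt; apply/negP => ep; apply: nosc.
by exists p; rewrite -si; split; [exact: ltW|exact: le_trans (ltW pt) ti|].
Qed.

End trajectories.

Section wildness_estimate.
Variable R : realType.

(** The order of the choices matters: q depends only on Theta2, the Burkholder
    constant on q and e, then X, L and K on Lam, and N is taken last.  The
    resulting X and N are the same for all processes. *)
Lemma wildness_estimate (theta Theta1 Theta2 : R -> R) (C : R) :
  (forall x, 0 <= x -> 0 <= theta x) ->
  (forall x, 0 <= x -> 0 <= Theta1 x) ->
  (forall x, 0 <= x -> 0 <= Theta2 x) ->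
  theta x @[x --> +oo] --> +oo ->
  Theta1 x / x @[x --> +oo] --> +oo ->
  Theta2 x / x @[x --> +oo] --> +oo ->
  (forall x, 0 <= x -> Theta2 (2 * x) <= C * Theta2 x) ->
  forall e Lam : R, 0 < e -> 0 < Lam -> exists X (N : nat), (0 < N)%N /\
  forall d (T : measurableType d) (P : probability T R)
    (F : R -> set_system T) (phi beta alpha : R -> T -> R),
  filtration F ->
  progressively_measurable F phi ->
  progressively_measurable F beta ->
  progressively_measurable F alpha ->
  {ae P, forall w, forall t, t \in `[0, 1] -> 0 <= alpha t w} ->
  {ae P, forall w,
    lebesgue_measure.-integrable `[0, 1] (fun t => (beta t w)%:E)} ->
  {ae P, forall w,
    lebesgue_measure.-integrable `[0, 1] (fun t => (alpha t w)%:E)} ->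
  let M := fun t w => phi t w - time_integral beta t w in
  continuous_local_martingale P F M ->
  continuous_local_martingale P F (fun t w => M t w ^+ 2 - time_integral alpha t w) ->
  exists Om : set T, [/\ measurable Om, P (~` Om) = 0%E,
    forall w, Om w -> {within `[0, 1], continuous (phi ^~ w)},
    measurable (wild_event phi X e N) &
   ((Lam * Rintegral P setT (\1_(Om `&` wild_event phi X e N)))%:E <=
     \int[P]_w ((theta `|phi 0 w|)%:E +
             \int[lebesgue_measure]_(t in `[0%R, 1%R])
               (Theta1 `|beta t w| + Theta2 (alpha t w))%:E))%E].
Proof.
move=> th0 T10 T20 thoo T1oo T2oo dbl e Lam e0 Lam0.
have [q lines] := supporting_lines T20 T2oo dbl.
have e20 : 0 < e / 2 by rewrite divr_gt0.
have [K0 K00 HK] := discrete_burkholder q (ltW e20).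
pose c := osc_constant q (e / 2).
have c0 : 0 < c.
  rewrite ltr_wpDl// mulr_ge0 ?invr_ge0 ?exprn_ge0// ?(ltW e20)// mulr_ge0//.
have [N0 N0P] := lines (Lam * c) (mulr_gt0 Lam0 c0).
(* L e / 4 = Lam, and N will make K / N at most e / 4 *)
pose L := 4 * Lam / e.
have L0 : 0 <= L by rewrite divr_ge0 ?mulr_ge0 ?(ltW Lam0) ?(ltW e0).
have [K Kpos KP] := superlinear_ge L T1oo.
have T1L x : 0 <= x -> L * (x - K) <= Theta1 x.
  move=> x0; have [Kx|xK] := leP K x.
    by apply: le_trans (KP x Kx); rewrite ler_wpM2l// gerBl ltW.
  by apply: le_trans (T10 x x0); rewrite mulr_ge0_le0// subr_le0 ltW.
have [X0 [_ X0P]] := (@cvgryPge _ _ _ _ theta).1 thoo Lam.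
pose N := maxn N0 (Num.truncn (4 * K / e)).+1.
have Npos : (0 < N)%N by rewrite leq_max ltnS orbT.
have N0' : (0 : R) < N%:R by rewrite ltr0n.
have KN : K / N%:R <= e / 4.
  have : 4 * K / e <= N%:R.
    by rewrite (le_trans (ltW (truncnS_gt _)))// ler_nat leq_max leqnn orbT.
  rewrite ler_pdivrMr// => h; rewrite ler_pdivrMr//; lra.
have LamL : Lam <= L * (e / 2 - K / N%:R).
  apply: (@le_trans _ _ (L * (e / 4))).
    have -> : L * (e / 4) = Lam by rewrite /L; field; rewrite gt_eqF.
    exact: lexx.
  by rewrite ler_wpM2l//; lra.
exists X0, N; split => // d T P F phi beta alpha fF pphi pbeta palpha al0 ib ia M lM lN.
apply: (key_estimate fF pphi pbeta palpha al0 ib ia lM lN th0 T10 T20 e0 Lam0 Npos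
  L0 _ T1L LamL K00 HK).
- by move=> x _; exact: X0P.
- by apply: N0P; rewrite leq_max leqnn.
Qed.

End wildness_estimate.
Theorem theoremA2 (R : realType) (theta Theta1 Theta2 : R -> R) (C : R)
  (theta_ge0 : forall x : R, 0 <= x -> 0 <= theta x)
  (Theta1_ge0 : forall x : R, 0 <= x -> 0 <= Theta1 x)
  (Theta2_ge0 : forall x : R, 0 <= x -> 0 <= Theta2 x)
  (Theta1_convex : convex_function (`[0, +oo[%classic : set R) Theta1)
  (Theta2_convex : convex_function (`[0, +oo[%classic : set R) Theta2)
  (Theta1_lsc :
    lower_semicontinuous (fun x : subspace `[0 : R, +oo[ => (Theta1 x)%:E))
  (Theta2_lsc :
    lower_semicontinuous (fun x : subspace `[0 : R, +oo[ => (Theta2 x)%:E))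
  (theta_infty : theta x @[x --> +oo] --> +oo)
  (Theta1_infty : Theta1 x / x @[x --> +oo] --> +oo)
  (Theta2_infty : Theta2 x / x @[x --> +oo] --> +oo)
  (C_ge0 : 0 <= C)
  (Theta2_doubling : forall x : R, 0 <= x -> Theta2 (2 * x) <= C * Theta2 x) :
  exists Psi : C01 R -> \bar R,
    [/\ forall f, (0 <= Psi f)%E,
        coercive Psi,
        borel_measurable Psi &
        forall (d : measure_display) (T : measurableType d)
          (P : probability T R) (F : R -> set_system T)
          (phi beta alpha : R -> T -> R),
          filtration F ->
          progressively_measurable F phi ->
          progressively_measurable F beta ->
          progressively_measurable F alpha ->
          {ae P, forall w, forall t, t \in `[0, 1] -> 0 <= alpha t w} ->
          {ae P, forall w,
            lebesgue_measure.-integrable `[0, 1] (fun t => (beta t w)%:E)} ->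
          {ae P, forall w,
            lebesgue_measure.-integrable `[0, 1] (fun t => (alpha t w)%:E)} ->
          let M := fun t w => phi t w - time_integral beta t w in
          continuous_local_martingale P F M ->
          continuous_local_martingale P F
            (fun t w => M t w ^+ 2 - time_integral alpha t w) ->
          (\int[P]_w Psi (trajectory phi w) <=
           \int[P]_w ((theta `|phi 0 w|)%:E +
             \int[lebesgue_measure]_(t in `[0%R, 1%R])
               (Theta1 `|beta t w| + Theta2 (alpha t w))%:E))%E].
Proof.
pose e (k : nat) : R := k.+1%:R^-1.
have e0 k : 0 < e k by rewrite invr_gt0.
(* one factor for the weight 2^k of the wild set, one for summability *)
pose Lam (k : nat) : R := 2 ^+ k * (2 ^ k.+1)%:R.
have Lam0 k : 0 < Lam k by rewrite mulr_gt0 ?exprn_gt0// ltr0n expn_gt0.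
have est := wildness_estimate theta_ge0 Theta1_ge0 Theta2_ge0 theta_infty
  Theta1_infty Theta2_infty Theta2_doubling.
have [X HX] := choice (fun k => est (e k) (Lam k) (e0 k) (Lam0 k)).
have [N HN] := choice HX.
exists (penalty X e N); split.
- exact: penalty_ge0.
- apply: penalty_coercive; first exact: cvg_harmonic.
  by move=> k; case: (HN k).
- exact: penalty_borel.
move=> d T P F phi beta alpha fF pphi pbeta palpha al0 ib ia M lM lN.
have [Om HOm] := choice (fun k =>
  (HN k).2 d T P F phi beta alpha fF pphi pbeta palpha al0 ib ia lM lN).
set rhs := (leRHS) in HOm *.
pose W k := Om k `&` wild_event phi (X k) (e k) (N k).
have mW k : measurable (W k) by have [mO _ _ mV _] := HOm k; exact: measurableI.
have mean0 k : 0 <= Rintegral P setT (\1_(W k)) by apply: Rintegral_ge0.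
have leW k : ((Lam k * Rintegral P setT (\1_(W k)))%:E <= rhs)%E by case: (HOm k).
have rhs0 : (0 <= rhs)%E.
  by apply: le_trans (leW 0%N); rewrite lee_fin mulr_ge0// ltW.
apply: (@le_trans _ _ (\int[P]_w \sum_(k <oo) (2 ^+ k * \1_(W k) w)%:E)%E).
  apply: le_integral_ae; first by move=> w _; exact: penalty_ge0.
  have : {ae P, forall w, forall k, Om k w}.
    apply: ae_foralln => k; have [mO PO _ _ _] := HOm k.
    by exists (~` Om k); split => //; exact: measurableC.
  apply: filterS => w Ow _; apply: lee_nneseries => k _.
    by move=> _; rewrite lee_fin mulr_ge0.
  rewrite lee_fin ler_wpM2l// !indicE.
  have [wW|nW] := pselect (wild (X k) (e k) (N k) (trajectory phi w)); last first.
    by rewrite memNset.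
  rewrite (mem_set (A := W k))//; first by case: (_ \in _).
  split; first exact: Ow.
  have [_ _ cO _ _] := HOm k.
  by apply: wild_trajectory => //; [exact: ltW|exact: cO].
rewrite integral_nneseries//; last first.
  by move=> k; apply/measurable_EFinP; apply: measurable_funM => //.
case: rhs rhs0 leW => [r r0 leW|_ _|//]; rewrite ?leey//.
apply: le_trans (epsilon_trick0 xpredT r0).
apply: lee_nneseries => k _.
  by move=> _; apply: integral_ge0 => w _; rewrite lee_fin mulr_ge0.
have i1 := L1_indic P (mW k).
rewrite -(fineK (integrable_fin_num measurableT (L1Z (2 ^+ k) i1))) -/(Rintegral _ _ _).
rewrite expZ// lee_fin ler_pdivlMr ?ltr0n ?expn_gt0//.
by have := leW k; rewrite lee_fin /Lam mulrAC.
Qed.
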